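(* For every $\varepsilon>0$ there is a constant $C=C(\varepsilon)>0$, depending only on $\varepsilon$, such that for every prime $M$ and every primitive Dirichlet character $\chi$ modulo $M$, $$\left|L\left(\tfrac{1}{2},\chi\right)\right|\leq C\, M^{1/4-1/16+\varepsilon}.$$
   Context: Here $L(s,\chi)=\sum_{n=1}^\infty \chi(n)n^{-s}$ for $\mathrm{Re}(s)>1$ is the Dirichlet $L$-function of $\chi$, extended to all $s\in\mathbb{C}$ by analytic continuation. *)

(* Defs.v *)
From mathcomp Require Import all_boot all_order all_algebra.
From mathcomp Require Import all_classical all_reals all_analysis.
From mathcomp Require Export complex.

Set Implicit Arguments.
Unset Strict Implicit.
Unset Printing Implicit Defensive.

Import Order.TTheory GRing.Theory Num.Theory.
Import numFieldNormedType.Exports.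

Local Open Scope classical_set_scope.
Local Open Scope ring_scope.
Local Open Scope complex_scope.

Definition dirichlet_character (R : realType) (M : nat) (chi : int -> R[i]) :
    Prop :=
  [/\ forall a : int, chi (a + M%:Z) = chi a,
      forall a b : int, chi (a * b) = chi a * chi b
    & forall a : int, (chi a != 0) = coprimez a M%:Z].

(* [chi] is not induced by a character of smaller modulus: the conductor of
   [chi] is [M] itself. *)
Definition primitive_dirichlet_character (R : realType) (M : nat)
    (chi : int -> R[i]) : Prop :=
  dirichlet_character M chi /\
  ~ exists (d : nat) (psi : int -> R[i]),
      [/\ (d %| M)%N, (d < M)%N, dirichlet_character d psi
        & forall a : int, coprimez a M%:Z -> chi a = psi a].

(* exp (x + i y) = e^x (cos y + i sin y) *)
Definition cexp (R : realType) (z : R[i]) : R[i] :=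
  (expR (complex.Re z))%:C * (cos (complex.Im z) +i* sin (complex.Im z)).

(* n ^ s = exp (s log n), with the real logarithm; meant for n >= 1. *)
Definition natpowc (R : realType) (n : nat) (s : R[i]) : R[i] :=
  cexp (s * (ln (n%:R : R))%:C).

(* Complex differentiability at every point of the plane: over the field of
   scalars [R[i]], the derivative in the direction 1 is the limit of
   (f (s + h) - f s) / h as the complex number h tends to 0. *)
Definition entire (R : realType) (f : R[i] -> R[i]) : Prop :=
  forall s : R[i], derivable (f : R[i]^o -> R[i]^o) s 1.

(* [L] is the analytic continuation of s |-> L(s, chi) to the whole plane: an
   entire function equal to the sum of the Dirichlet series for Re s > 1.
   There is at most one such [L], by the identity theorem; there is one exactly
   when [chi] is not principal, so in particular for primitive characters of
   modulus greater than 1. *)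
Definition is_dirichlet_L (R : realType) (chi : int -> R[i]) (L : R[i] -> R[i]) :
    Prop :=
  entire L /\
  forall s : R[i], 1 < complex.Re s ->
    (fun N : nat => \sum_(1 <= n < N) chi n%:Z * natpowc n (- s) : R[i]^o)
      @ \oo --> (L s : R[i]^o).

(* Main.v *)
Require Import Defs.
From mathcomp Require Import all_boot all_order all_algebra.
From mathcomp Require Import all_classical all_reals all_analysis.
From mathcomp Require Import all_field qpoly ring lra zify.

(** Let S(m, n) be the sum of chi over n consecutive integers starting at m.
    Stepanov's method bounds the number of x in F_(p^n) where the norm of
    (a1 - x) (a2 - x) (a3 - x)^(p-2) takes a given value.  Since the L-function
    of u |-> chi ((a1 - u) (a2 - u)) (chi (a3 - u))^* is a polynomial of degree
    at most 2, letting n grow bounds its inverse roots, and the sum of these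
    values over F_p is at most 2 sqrt p.  This controls the fourth moment of
    S(x, B) over x mod p, with B about p^(1/4).  Burgess' argument (shifting by
    products a b and applying Hoelder), run as an induction on n, then gives
    |S(m, n)| <= Y sqrt n with Y of order p^(3/16) (log p)^(1/2), and by partial
    summation all partial sums of the series at s = 1/2 are at most
    Y (3 + log p).

    They converge to L(1/2): multiply L minus a partial sum by
    exp (K (s^2 - 1/4)), which is 1 at s = 1/2, and apply Cauchy's estimate on a
    rectangle around 1/2.  On the part of the boundary with Re s > 1 the series
    converges uniformly; elsewhere the weight is small for large K. *)

Set Implicit Arguments.
Unset Strict Implicit.
Unset Printing Implicit Defensive.

Import Order.TTheory GRing.Theory Num.Theory.
Import numFieldNormedType.Exports.

Local Open Scope ring_scope.

(** * Hasse derivatives and Stepanov's method *)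

(** With B about p^(1/4) and S a sum of length n, Hoelder's inequality gives (A B |S|)^4 <= (A n)^2
    * (number of coincidences) * (fourth moment). The coincidences number about A n, the moment is
    about B^6, and A is of order n / B, so |S|^4 is about n^2 B^3 up to logarithms: this is where
    3/16 = 1/4 - 1/16 comes from. Counting coincidences requires 2 A n <= p, that is n^2 below about
    B^5. This is also the length at which n^(1/2) p^(3/16) reaches p^(1/2), so for longer sums the
    elementary second moment is enough.

    With three factors only two inverse roots remain, and a direct elimination in their power sums
    bounds them. Stepanov's method bounds each number of solutions only from above; the lower bound
    is recovered because the counts over all values add up to p^n. The constants lost on the way
    depend on p but not on n, so they disappear as n grows. *)

Section HasseDerivatives.
Variable K : fieldType.
Implicit Types f g h r : {poly K}.

(** [tay q] is q(X + Y), seen as a polynomial in one variable over polynomials in the other. Its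
    coefficients are the Hasse derivatives of q, and q |-> q(X + Y) is multiplicative, so the
    Leibniz rule is the product formula for coefficients. *)
Lemma nderivnM f g n :
  (f * g)^`N(n) = \sum_(i < n.+1) f^`N(i) * g^`N(n - i).
Proof.
pose tay (q : {poly K}) : {poly {poly K}} := map_poly polyC q \Po ('X + ('X)%:P).
have tayE q l : (tay q)`_l = q^`N(l).
  elim/poly_ind: q l => [|q c IH] l.
    by rewrite /tay rmorph0 comp_poly0 coef0 linear0.
  rewrite /tay rmorphD rmorphM /= map_polyX map_polyC /= comp_polyD comp_polyM.
  rewrite comp_polyX comp_polyC -/(tay q) mulrDr coefD coefC coefD coefMX coefMC IH.
  case: l => [|l] /=; first by rewrite IH !nderivn0 add0r.
  by rewrite IH nderivnMXaddC addr0.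
rewrite -tayE /tay rmorphM /= comp_polyM coefM.
by apply: eq_bigr => i _; rewrite !tayE.
Qed.

(** A derivative of order l costs at most l factors f. This makes the quotients [U] in Stepanov's
    argument exact. *)
Lemma dvdp_nderivn_expM f r s l : f ^+ (s - l) %| (f ^+ s * r)^`N(l).
Proof.
elim: s l => [|s IH] l; first by rewrite sub0n expr0 dvd1p.
case: (leqP l s) => ls; last by rewrite (eqP (_ : (s.+1 - l == 0)%N)) ?expr0 ?dvd1p // subn_eq0.
rewrite exprS -mulrA nderivnM; elim/big_ind: _ => [|a b|[[|i] /= il] _].
- exact: dvdp0.
- exact: dvdp_add.
- by rewrite nderivn0 subn0 subSn // exprS dvdp_mul // IH.
- apply/dvdp_mull/(dvdp_trans _ (IH _))/dvdp_exp2l.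
  by rewrite ltnS in il; lia.
Qed.

Lemma nderivnXnM (p n : nat) j r l : p \in [pchar K] -> (l < p ^ n)%N ->
  ('X^(j * p ^ n) * r)^`N(l) = 'X^(j * p ^ n) * r^`N(l).
Proof.
move=> pK ln; rewrite nderivnM big_ord_recl nderivn0 subn0 big1 ?addr0 // => i _.
suff -> : ('X^(j * p ^ n))^`N(lift ord0 i) = 0 :> {poly K} by rewrite mul0r.
have i0 : (0 < lift ord0 i < p ^ n)%N.
  by rewrite /= (leq_ltn_trans _ ln) // -ltnS.
move: (nat_of_ord (lift ord0 i)) i0 => {}i i0.
have bin0 k : (0 < k < p ^ n)%N -> ('X^(p ^ n))^`N(k) = 0 :> {poly K}.
  case/andP=> k0 kn; rewrite nderivnXn -scaler_nat.
  suff pC : (p %| 'C(p ^ n, k))%N.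
    by case/dvdnP: pC => c ->; rewrite natrM (pcharf0 pK) mulr0 scale0r.
  have p_pr := pcharf_prime pK.
  (* k C(p^n, k) = p^n C(p^n - 1, k - 1), while p^n does not divide k; hence C(p^n, k) is not prime
     to p. *)
  have : (p ^ n %| k * 'C(p ^ n, k))%N.
    by case: k k0 {kn} => // k _; rewrite -mul_bin_diag dvdn_mulr.
  apply: contraLR => pC; rewrite Gauss_dvdl; last by rewrite coprimeXl // prime_coprime.
  by rewrite gtnNdvd.
elim: j i i0 => [|j IH] i i0.
  by rewrite mul0n expr0 -polyC1 nderivnC gtn_eqF //; case/andP: i0.
rewrite mulSn exprD nderivnM big_ord_recl subn0 IH // mulr0 add0r big1 // => k _.
rewrite bin0 ?mul0r //=; case/andP: i0 => _; apply: leq_ltn_trans.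
by rewrite -ltnS; case: k.
Qed.

(** Taylor expansion of f at x. Hasse derivatives detect multiplicities of any size, whereas
    ordinary derivatives in characteristic p fail from order p on. *)
Lemma dvdp_XsubC_nderivn f x M :
  (forall l, (l < M)%N -> f^`N(l).[x] = 0) -> ('X - x%:P) ^+ M %| f.
Proof.
move=> H; rewrite -[X in _ %| X]comp_polyXr /comp_poly -[X in _.[X]](subrK x%:P) [X in _.[X]]addrC.
rewrite nderiv_taylor; last exact: mulrC.
elim/big_ind: _ => [|a b|i _]; [exact: dvdp0|exact: dvdp_add|].
rewrite nderivn_map (horner_map polyC) /=; case: (ltnP i M) => [/H ->|Mi].
  by rewrite mul0r dvdp0.
by apply/dvdp_mull/dvdp_exp2l.
Qed.

End HasseDerivatives.

Lemma exists_nontrivial_relation (K : fieldType) (I J : finType) (a : I -> J -> K) :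
  (#|J| < #|I|)%N ->
  exists2 v : I -> K, exists i, v i != 0 & forall j, \sum_i v i * a i j = 0.
Proof.
move=> JI; pose A := \matrix_(i < #|I|, j < #|J|) a (enum_val i) (enum_val j).
have: kermx A != 0.
  rewrite -mxrank_eq0 mxrank_ker subn_eq0 -ltnNge.
  exact: leq_ltn_trans (rank_leq_col A) JI.
case/rowV0Pn => v /sub_kermxP vA v0.
exists (fun i => v 0 (enum_rank i)).
  case/rV0Pn: v0 => i vi; exists (enum_val i); by rewrite enum_valK.
move=> j; have /rowP/(_ (enum_rank j)) := vA.
rewrite !mxE => e; rewrite -[RHS]e (reindex_onto enum_val enum_rank) /=; last by move=> i _; rewrite enum_rankK.
by apply: eq_big => i; rewrite ?enum_valK ?eqxx // => _; rewrite mxE enum_rankK.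
Qed.

(** Among the terms with nonzero coefficient, the one of largest degree has a leading coefficient
    that nothing cancels. *)
Lemma sum_distinct_degrees (K : fieldType) (I : finType) (v : I -> K)
    (P : I -> {poly K}) (deg : I -> nat) :
    injective deg -> (forall i, size (P i) = (deg i).+1) ->
  (exists i, v i != 0) -> \sum_i v i *: P i != 0.
Proof.
move=> inj sz [i0 vi0].
case: (arg_maxnP deg (vi0 : (fun i => v i != 0) i0)) => i vi imax.
apply/eqP => /polyP/(_ (deg i)); rewrite coef0 coef_sum (bigD1 i) //= big1 => [|j ji].
  move/eqP; rewrite addr0 coefZ -[deg i]/((deg i).+1.-1) -sz -lead_coefE mulf_eq0 (negPf vi).
  by rewrite lead_coef_eq0 -size_poly_eq0 sz.
rewrite coefZ; have [->|vj] := eqVneq (v j) 0; first by rewrite mul0r.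
rewrite nth_default ?mulr0 // sz ltn_neqAle [(_ <= _)%N]imax // andbT.
by apply: contra ji => /eqP/inj ->.
Qed.

Lemma prod_XsubC_exp_dvdp (K : fieldType) (s : seq K) i (h : {poly K}) : uniq s ->
  (forall z, z \in s -> ('X - z%:P) ^+ i %| h) ->
  (\prod_(z <- s) ('X - z%:P)) ^+ i %| h.
Proof.
elim: s => [|z s IH] /=; first by rewrite big_nil expr1n dvd1p.
case/andP=> zs us H; rewrite big_cons exprMn Gauss_dvdp.
  by rewrite H ?mem_head // IH // => y ys; apply: H; rewrite inE ys orbT.
by apply/coprimep_expl/coprimep_expr; rewrite coprimep_sym coprimep_XsubC root_prod_XsubC.
Qed.

Section Stepanov.
Variables (K : fieldType) (p : nat) (pK : p \in [pchar K]).
Variables (f : {poly K}) (n : nat) (szf : size f = p.+1).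
Local Notation Q := (p ^ n)%N.
Local Notation e := (\sum_(i < n) p ^ i)%N.
Local Notation d := p.-1.

Lemma stepanov_dE : (d * e = Q.-1)%N.
Proof. by rewrite [RHS]predn_exp. Qed.

Variables (T J : nat) (c : K) (s : seq K).
Hypotheses (p2 : (2 < p)%N) (Te : e = T.+1) (J2 : (1 < J)%N).
Hypothesis TJ : ((d ^ 2 + 1) * J ^ 2 <= T)%N.
Hypotheses (us : uniq s) (sQ : forall x, x \in s -> x ^+ Q = x)
  (sc : forall x, x \in s -> f.[x] ^+ e = c).

(* The auxiliary polynomial is R = sum of v_(i,j,k) f^(M+ie) X^k X^(jQ).  The
   factors X^(jQ) behave as constants under the Hasse derivatives of order less
   than M; since f^e = c and x^Q = x on s, the vanishing of these derivatives on
   s amounts to so few linear conditions on v that some nonzero v meets them.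
   R is not 0 because its terms have distinct degrees. *)
Lemma stepanov_bound :
  (d * (J.-1) * size s <= d * J.-1 * p + d * Q + J.-1 * Q)%N.
Proof.
have Q0 : (0 < Q)%N by rewrite expn_gt0; lia.
have dE := stepanov_dE.
have p0 : (0 < p)%N by lia.
have epE : (e * p = Q.-1 + e)%N.
  by rewrite mulnC -{1}(prednK p0) mulSn dE addnC.
have T0 : (0 < T)%N.
  by apply: leq_trans TJ; rewrite muln_gt0 addn1 expn_gt0 (ltnW J2).
(* M is the order of vanishing and W bounds the number of coefficients of a derivative once it is
   reduced on s. The M W conditions are fewer than the d J T unknowns when (J - 1) (M d + J) < T,
   which follows from [TJ]. *)
pose M := (d * J.-1)%N; pose W := (T + M * d + J)%N.
pose I : finType := ('I_d * 'I_J * 'I_T)%type.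
pose U l (a : I) : {poly K} :=
  let: (i, j, k) := a in (f ^+ (M + i * e) * 'X^k)^`N(l) %/ f ^+ (M + i * e - l).
have f0 : f != 0 by rewrite -size_poly_eq0 szf.
have szfX m : size (f ^+ m) = (m * p).+1.
  by rewrite (polySpred (expf_neq0 _ f0)) size_exp szf /= mulnC.
(* After division by the power of f, the size is at most T + l d whatever i is. This independence of
   i keeps the number of conditions small. *)
have szU l a : (l < M)%N -> (size (U l a) <= T + M * d)%N.
  case: a => [[i j] k] lM; rewrite /U size_divp ?expf_neq0 //.
  rewrite szfX /=.
  have : (size (f ^+ (M + i * e) * 'X^k)^`N(l) <= ((M + i * e) * p + T) - l)%N.
    apply: (leq_trans (size_poly _ _)); apply: leq_sub2r.
    apply: (leq_trans (size_polyMleq _ _)).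
    by rewrite szfX size_polyXn /=; have := ltn_ord k; lia.
  move=> h; apply: leq_trans (leq_sub2r _ h) _.
  have lE : (l <= M + i * e)%N by rewrite ltnW // ltn_addr.
  rewrite mulnBl.
  have h2 : (l * d <= M * d)%N by rewrite leq_mul2r (ltnW lM) orbT.
  have h3 : (l * p <= (M + i * e) * p)%N by rewrite leq_mul2r lE orbT.
  have h4 : (l * p = l * d + l)%N by rewrite -mulnSr prednK //; lia.
  move: (l * d)%N (M * d)%N h2 h4 => A1 A2 h2 h4.
  move: ((M + i * e) * p)%N (l * p)%N h3 h4 => A3 A4 h3 h4; lia.
have [v v0 Hv] : exists2 v : I -> K, exists a, v a != 0 &
    forall l : 'I_M * 'I_W, \sum_a v a * (c ^+ a.1.1 *: ('X^(a.1.2) * U l.1 a))`_l.2 = 0.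
  apply: exists_nontrivial_relation.
  rewrite !card_prod !card_ord /W /M.
  move: TJ J2; case: (J) => [//|J'] /= TJ' J'2.
  have d1 : (0 < d)%N by lia.
  move: d1 TJ'; rewrite -mulnn; move: (d) => D D1 TJ'.
  have key : (J' * (D * J' * D + J'.+1) < T)%N.
    apply: leq_trans TJ'; rewrite -mulnn.
    have := leq0n (D * D * J'); have := leq0n (D * D); have := leq0n (J' * J').
    lia.
  rewrite -[X in (X < _)%N]mulnA -[X in (_ < X)%N]mulnA ltn_pmul2l // mulSn -addnA mulnDr addnC.
  by rewrite ltn_add2r.
pose R' : {poly K} := \sum_a v a *: (f ^+ (a.1.1 * e) * ('X^(a.2) * 'X^(a.1.2 * Q))).
have R'0 : R' != 0.
  pose dg (a : I) := (a.1.1 * e * p + (a.2 + a.1.2 * Q))%N.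
  apply: (sum_distinct_degrees (deg := dg)) => //.
    (* Since e p = Q + T, division by Q recovers i + j and the remainder i T + k, and division of
       the latter by T recovers i and k. *)
    have dgE a : dg a = ((a.1.1 + a.1.2) * Q + (a.1.1 * T + a.2))%N.
      rewrite /dg -mulnA; rewrite epE.
      have -> : (Q.-1 + e = Q + T)%N by rewrite Te; lia.
      by rewrite mulnDr mulnDl; lia.
    have lt (a : I) : (a.1.1 * T + a.2 < Q)%N.
      have : (a.1.1.+1 * T <= d * T)%N by apply: leq_mul => //; exact: ltn_ord a.1.1.
      have := ltn_ord a.2; move: dE; rewrite Te mulnS mulSn; lia.
    move=> a b; rewrite !dgE => E.
    have := congr1 (modn^~ Q) E; have := congr1 (divn^~ Q) E.
    rewrite !divnMDl // !modnMDl !divn_small ?lt // !modn_small ?lt // !addn0 => e1 e2.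
    have := congr1 (modn^~ T) e2; have := congr1 (divn^~ T) e2.
    rewrite !divnMDl // !modnMDl !divn_small // !modn_small // !addn0 => e3 e4.
    move: e1 e3 e4; case: a b {E e2} => [[i j] k] [[i' j'] k'] /= e1 e3 e4.
    have ei : i = i' by apply: val_inj.
    have ej : j = j' by apply/val_inj/eqP; rewrite -(eqn_add2l i) e1 e3.
    by rewrite ei ej; congr (_, _); apply: val_inj.
  move=> a; rewrite -exprD size_mulXn ?expf_neq0 // szfX /dg; lia.
pose R := f ^+ M * R'.
have Rder l x : (l < M)%N -> x \in s -> R^`N(l).[x] = 0.
  move=> lM xs; have lQ : (l < Q)%N.
    apply: (ltn_trans lM); rewrite -(prednK Q0) ltnS -dE leq_mul2l; apply/orP; right.
    apply: leq_trans (leq_pred _) _; rewrite Te; apply/ltnW; rewrite ltnS.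
    by apply: leq_trans TJ; rewrite mulnA leq_pmull // muln_gt0 addn1 (ltnW J2).
  have Rl : R^`N(l).[x] = f.[x] ^+ (M - l) *
     (\sum_a v a *: (c ^+ a.1.1 *: ('X^(a.1.2) * U l a))).[x].
    rewrite /R /R' mulr_sumr linear_sum horner_sum /= horner_sum mulr_sumr.
    apply: eq_bigr => -[[i j] k] _ /=.
    rewrite -scalerAr linearZ /= !hornerZ [RHS]mulrCA; congr (_ * _).
    rewrite !mulrA -exprD [_ * 'X^(j * Q)]mulrC nderivnXnM // hornerM hornerXn.
    rewrite -[X in _ * X.[x] = _](divpK (dvdp_nderivn_expM f _ _ _)) hornerM horner_exp.
    rewrite hornerM hornerXn mulnC exprM sQ //.
    set u := (_ %/ _).
    rewrite -addnBAC ?(ltnW lM) // exprD [(i * _)%N]mulnC exprM sc //; ring.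
  rewrite Rl; suff -> : \sum_a v a *: (c ^+ a.1.1 *: ('X^(a.1.2) * U l a)) = 0.
    by rewrite horner0 mulr0.
  apply/polyP => w; rewrite coef0 coef_sum; case: (ltnP w W) => wW.
    rewrite -[RHS](Hv (Ordinal lM, Ordinal wW)); apply: eq_bigr => a _.
    by rewrite coefZ.
  apply: big1 => a _; rewrite !coefZ nth_default ?mulr0 //.
  apply: leq_trans wW; apply: (leq_trans (size_polyMleq _ _)).
  by rewrite size_polyXn /= addnC; apply: leq_add; [exact: szU | exact/ltnW/ltn_ord].
have szR' : (size R' <= d * Q.-1 + J.-1 * Q)%N.
  rewrite /R'; elim/big_ind: _ => [|P1 P2 h1 h2|a _]; first by rewrite size_poly0.
    by rewrite (leq_trans (size_polyD _ _)) // geq_max h1.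
  apply: (leq_trans (size_scale_leq _ _)).
  rewrite -exprD size_mulXn ?expf_neq0 // szfX.
  have := ltn_ord a.2; have := ltn_ord a.1.2; have := ltn_ord a.1.1.
  case: a => [[i j] k] /= hi hj hk.
  have h1 : (i * e * p <= d.-1 * e * p)%N by rewrite leq_mul2r leq_mul2r -ltnS prednK ?hi ?orbT //; lia.
  have h2 : (j * Q <= J.-1 * Q)%N by rewrite leq_mul2r -ltnS prednK ?hj ?orbT //; lia.
  have h3 : (d.-1 * e * p + T <= d * Q.-1)%N.
    rewrite -mulnA; rewrite epE.
    have -> : (d * Q.-1 = d.-1 * Q.-1 + Q.-1)%N by rewrite -mulSnr prednK; lia.
    have : (d.-1 * e + e = Q.-1)%N by rewrite -dE -mulSnr prednK; lia.
    by rewrite mulnDr Te; lia.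
  move: (i * e * p)%N (d.-1 * e * p)%N (j * Q)%N (J.-1 * Q)%N (d * Q.-1)%N h1 h2 h3.
  move=> x1 x2 x3 x4 x5 h1 h2 h3; lia.
have R0 : R != 0 by rewrite mulf_neq0 ?expf_neq0.
have dv : (\prod_(x <- s) ('X - x%:P)) ^+ M %| R.
  apply: prod_XsubC_exp_dvdp => // x xs; apply: dvdp_XsubC_nderivn => l lM.
  exact: Rder.
have := dvdp_leq R0 dv.
rewrite [X in (X <= _)%N]polySpred ?expf_neq0 ?monic_neq0 ?monic_prod_XsubC //.
rewrite size_exp size_prod_XsubC /= mulnC => h.
have : (size R <= M * p + size R')%N.
  apply: (leq_trans (size_polyMleq _ _)).
  by rewrite szfX; lia.
have : (d * Q.-1 <= d * Q)%N by rewrite leq_mul2l leq_pred orbT.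
rewrite -/M => h1 h2; apply: leq_trans (ltnW h) _; apply: leq_trans h2 _.
by rewrite -addnA leq_add2l (leq_trans szR') // leq_add2r.
Qed.

End Stepanov.

(** * Frobenius orbits *)

Section FrobeniusOrbits.
Variables (F : finFieldType) (p : nat) (p_pr : prime p) (cardF : #|F| = p).
Variables (Om : closedFieldType) (iota : {rmorphism F -> Om}).

Lemma pcharOm : p \in [pchar Om].
Proof. by rewrite (fmorph_pchar iota) (card_finPcharP (n := 1)) // cardF expn1. Qed.

Lemma frobD j (x y : Om) : (x + y) ^+ (p ^ j) = x ^+ (p ^ j) + y ^+ (p ^ j).
Proof. by apply: exprDn_pchar; rewrite pnatX orbC (eq_pnat _ (pcharf_eq pcharOm)) pnat_id ?orbT. Qed.

Lemma frobN j (x : Om) : (- x) ^+ (p ^ j) = - x ^+ (p ^ j).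
Proof.
apply/eqP; rewrite -addr_eq0 -frobD addNr expr0n expn_eq0.
by case: (p) (prime_gt0 p_pr).
Qed.

Lemma frob_inj j : injective (fun x : Om => x ^+ (p ^ j)).
Proof.
move=> x y /= /eqP; rewrite -subr_eq0 -frobN -frobD expf_eq0 => /andP[_].
by rewrite subr_eq0 => /eqP.
Qed.

Lemma frob_iter i j (x : Om) : (x ^+ (p ^ i)) ^+ (p ^ j) = x ^+ (p ^ (i + j)).
Proof. by rewrite -exprM expnD. Qed.

Lemma frob_iota j a : iota a ^+ (p ^ j) = iota a.
Proof.
have ap : a ^+ p = a by rewrite -[in LHS]cardF expf_card.
elim: j => [|j IH]; first by rewrite expn0 expr1.
by rewrite expnSr exprM IH -rmorphXn ap.
Qed.

(** X^p - X already splits over F, so all its roots in [Om] come from F. *)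
Lemma frob_fixed (y : Om) : y ^+ p = y -> exists a, y = iota a.
Proof.
move=> yp.
have: root (map_poly iota ('X^#|F| - 'X)) y.
  by rewrite rmorphB /= map_polyXn map_polyX rootE !hornerE cardF yp subrr.
rewrite finField_genPoly rmorph_prod /= /root horner_prod prodf_seq_eq0.
case/hasP=> a _ /=; rewrite rmorphB /= map_polyX map_polyC !hornerE subr_eq0.
by move=> /eqP; exists a.
Qed.

(* For x in F_(p^j), the characteristic polynomial of x over F_p. *)
Definition conjpoly j (x : Om) : {poly Om} :=
  \prod_(i < j) ('X - (x ^+ (p ^ i))%:P).

(** Frobenius permutes the factors cyclically, because x^(p^j) = x. The coefficients are therefore
    fixed by Frobenius and lie in F. *)
Lemma conjpoly_map j x : x ^+ (p ^ j) = x ->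
  exists2 g : {poly F}, conjpoly j x = map_poly iota g & g \is monic /\ size g = j.+1.
Proof.
move=> xj; set c := conjpoly j x.
have coefc i : c`_i ^+ p = c`_i.
  have fr : forall x0 y, (x0 + y) ^+ p = x0 ^+ p + y ^+ p :> Om.
    by move=> u v; have := frobD 1 u v; rewrite expn1.
  pose f := pFrobenius_aut pcharOm.
  have -> : c`_i ^+ p = (map_poly f c)`_i.
    by rewrite coef_map /= pFrobenius_autE.
  congr (_`_i); rewrite /c /conjpoly rmorph_prod /=.
  under eq_bigr => k _ do rewrite rmorphB /= map_polyX map_polyC /= pFrobenius_autE -exprM -expnSr.
  case: j xj @c => [|j] xj c; first by rewrite !big_ord0.
  by rewrite big_ord_recr big_ord_recl /= mulrC xj expr1.
have sz : size c = j.+1.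
  by rewrite /c /conjpoly size_prod_XsubC /index_enum -enumT size_enum_ord.
pose pre y := odflt 0 [pick a | iota a == y].
have preK i : iota (pre c`_i) = c`_i.
  rewrite /pre; case: pickP => [a /eqP //|].
  by case: (frob_fixed (coefc i)) => a -> /(_ a); rewrite eqxx.
have cg : c = map_poly iota (\poly_(i < size c) pre c`_i).
  apply/polyP => i; rewrite coef_map coef_poly; case: ltnP => h; last by rewrite nth_default //= rmorph0.
  by rewrite -[LHS]preK.
exists (\poly_(i < size c) pre c`_i) => //.
split; last by rewrite -sz [in RHS]cg size_map_poly.
by rewrite -(map_monic iota) -cg monic_prod_XsubC.
Qed.

(** For j > 0, the elements of F_(p^j). Taking them inside [Om] puts all the extensions into one
    field. *)
Definition frob_roots j : seq Om := sval (closed_field_poly_normal ('X^(p ^ j) - 'X)).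

Lemma frob_rootsP j : (0 < j)%N ->
  [/\ uniq (frob_roots j), size (frob_roots j) = (p ^ j)%N &
      forall x, (x \in frob_roots j) = (x ^+ (p ^ j) == x)].
Proof.
move=> j0; have p1 := prime_gt1 p_pr.
have pj1 : (1 < p ^ j)%N by rewrite -{1}(expn0 p) ltn_exp2l.
rewrite /frob_roots; set P : {poly Om} := 'X^(p ^ j) - 'X.
have szP : size P = (p ^ j).+1.
  by rewrite size_polyDl ?size_polyXn // size_polyN size_polyX ltnS.
have lP : lead_coef P = 1.
  by rewrite lead_coefDl ?lead_coefXn // size_polyN size_polyX size_polyXn ltnS.
case: (closed_field_poly_normal P) => s /=; rewrite lP scale1r => Ps.
split; last first.
- by move=> x; rewrite -root_prod_XsubC -Ps rootE !hornerE subr_eq0.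
- by have := szP; rewrite Ps size_prod_XsubC => -[].
rewrite -separable_prod_XsubC -Ps unlock /P derivB derivXn derivX -scaler_nat.
have -> : (p ^ j)%:R = 0 :> Om by rewrite natrX (pcharf0 pcharOm) expr0n eqn0Ngt j0.
rewrite scale0r.
apply/Bezout_eq1_coprimepP; exists (0, -1).
by rewrite /= mul0r add0r sub0r mulrNN mul1r.
Qed.

(** The orbit of x stays among the finitely many roots of h, so two iterates agree, and injectivity
    of Frobenius brings the coincidence back to x itself. The least period is m. *)
Lemma frob_period (h : {poly Om}) x : h != 0 -> root h x ->
    (forall y, root h y -> root h (y ^+ p)) ->
  exists2 m, (0 < m)%N & forall j, (x ^+ (p ^ j) == x) = (m %| j)%N.
Proof.
move=> h0 hx inv.
have hxi i : root h (x ^+ (p ^ i)).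
  by elim: i => [|i IH]; rewrite ?expn0 ?expr1 // expnSr exprM inv.
have [m /andP[m0 /eqP xm] mmin] : {m | (0 < m)%N && (x ^+ (p ^ m) == x) &
    forall j, (0 < j)%N && (x ^+ (p ^ j) == x) -> (m <= j)%N}.
  suff ex : exists m, (0 < m)%N && (x ^+ (p ^ m) == x).
    by exists (ex_minn ex); case: ex_minnP.
  have /uniqPn : ~~ uniq [seq x ^+ (p ^ i) | i <- seq.iota 0 (size h)].
    apply/negP => u.
    have al : all (root h) [seq x ^+ (p ^ i) | i <- seq.iota 0 (size h)].
      by apply/allP => y /mapP[i _ ->].
    by have := max_poly_roots h0 al u; rewrite size_map size_iota ltnn.
  move=> /(_ 0) [i [j [ij]]]; rewrite size_map size_iota => js.
  rewrite !(nth_map 0%N) ?size_iota ?(ltn_trans ij) // !nth_iota ?(ltn_trans ij) // !add0n.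
  rewrite -(subnK (ltnW ij)) -frob_iter => /frob_inj e.
  by exists (j - i)%N; rewrite subn_gt0 ij -e /=.
have xmi i : x ^+ (p ^ (m * i)) = x.
  by elim: i => [|i IH]; rewrite ?muln0 ?expn0 ?expr1 // mulnS -frob_iter xm IH.
exists m => // j; rewrite {1}(divn_eq j m) mulnC -frob_iter xmi.
have := ltn_pmod j m0; rewrite /dvdn; case: (j %% m)%N => [|r] rm.
  by rewrite expn0 expr1 !eqxx.
by apply: contraTF rm => e; rewrite -leqNgt mmin.
Qed.

Lemma sum_dvdn m n k : (0 < m)%N -> (m * n <= k)%N ->
  (\sum_(1 <= j < k.+1) ((m %| j) && (j <= m * n)))%N = n.
Proof.
move=> m0 mnk.
under eq_bigr => j _ do rewrite -[nat_of_bool _]muln1 mulnbl.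
rewrite -big_mkcond /= sum1_count -size_filter.
rewrite (perm_size (s2 := [seq (m * i.+1)%N | i <- seq.iota 0 n])).
  by rewrite size_map size_iota.
apply: uniq_perm; rewrite ?filter_uniq ?iota_uniq // ?map_inj_uniq ?iota_uniq //.
  by move=> i j /eqP; rewrite eqn_pmul2l // eqSS => /eqP.
move=> j; rewrite mem_filter mem_index_iota ltnS; apply/idP/mapP.
  case/and3P=> /andP[/dvdnP[i ->]]; rewrite mulnC leq_pmul2l // muln_gt0 => ilen /andP[_ i0] _.
  by exists i.-1; rewrite ?mem_iota ?prednK //= add0n.
case=> i; rewrite mem_iota add0n => /andP[_ ilt] ->.
by rewrite dvdn_mulr // leq_pmul2l // ilt muln_gt0 m0 /= (leq_trans _ mnk) // leq_pmul2l.
Qed.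

Lemma size_undup_count (T : eqType) (s : seq T) :
  (\sum_(x <- undup s) count_mem x s)%N = size s.
Proof.
rewrite -[RHS]sum1_size -(big_undup_iterop_count _ s xpredT (fun=> 1%N)) /=.
apply: eq_bigr => x _; case: (count_mem x s) => // n.
by rewrite Monoid.iteropE iter_addn mul1n addn0.
Qed.

Lemma conjpolyM m i x : x ^+ (p ^ m) = x -> conjpoly (m * i) x = conjpoly m x ^+ i.
Proof.
move=> xm; elim: i => [|i IH]; first by rewrite muln0 /conjpoly big_ord0 expr0.
rewrite mulnS exprS -IH /conjpoly big_split_ord /=; congr (_ * _).
by apply: eq_bigr => j _; rewrite -frob_iter xm.
Qed.

Lemma size_conjpoly j x : size (conjpoly j x) = j.+1.
Proof. by rewrite size_prod_XsubC /index_enum -enumT size_enum_ord. Qed.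

Lemma root_conjpoly j x : (0 < j)%N -> root (conjpoly j x) x.
Proof.
by case: j => // j _; rewrite /conjpoly big_ord_recl expn0 expr1 rootM root_XsubC eqxx.
Qed.

(* A root of h of multiplicity i whose Frobenius orbit has m elements is counted
   for j = m, 2m, .., im. *)
Lemma sum_conjpoly_dvdp (rt : nat -> seq Om) (h0 : {poly F}) k :
    (forall j, (0 < j)%N -> uniq (rt j)) ->
    (forall j x, (0 < j)%N -> (x \in rt j) = (x ^+ (p ^ j) == x)) ->
    h0 \is monic -> size h0 = k.+1 ->
  (\sum_(1 <= j < k.+1) \sum_(x <- rt j) (conjpoly j x %| map_poly iota h0)%R)%N = k.
Proof.
move=> urt mrt mon sz; set h := map_poly iota h0.
have hneq0 : h != 0 by rewrite map_poly_eq0 monic_neq0.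
have [rs hrs] := closed_field_poly_normal h.
rewrite lead_coef_map (monicP mon) rmorph1 scale1r in hrs.
have szrs : size rs = k by have := sz; rewrite -(size_map_poly iota) -/h hrs size_prod_XsubC => -[].
have mrs x : (x \in rs) = root h x by rewrite hrs root_prod_XsubC.
pose f := pFrobenius_aut pcharOm.
have hf : map_poly f h = h.
  by apply/polyP => i; rewrite !coef_map /= pFrobenius_autE -[p in LHS]expn1 frob_iota.
have mupf x i : ('X - x%:P) ^+ i %| h -> ('X - (x ^+ p)%:P) ^+ i %| h.
  rewrite -(dvdp_map f) hf rmorphXn rmorphB /= map_polyX map_polyC /=.
  by rewrite pFrobenius_autE.
have rootf y : root h y -> root h (y ^+ p).
  by rewrite -!dvdp_XsubCl => /(@mupf y 1%N).
(* Only roots of h contribute, since x is a root of [conjpoly j x]. The outer sum can then run over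
   the roots and the inner one over j. *)
transitivity (\sum_(1 <= j < k.+1) \sum_(x <- undup rs)
    ((x ^+ (p ^ j) == x) && (conjpoly j x %| h)%R))%N.
  apply: eq_big_nat => j /andP[j0 _].
  rewrite [LHS](bigID (mem rs)) /= [X in (_ + X)%N]big1 ?addn0; last first.
    move=> x; rewrite mrs; case: (boolP (_ %| h)) => // d.
    by rewrite -dvdp_XsubCl (dvdp_trans _ d) // dvdp_XsubCl root_conjpoly.
  under [RHS]eq_bigr => x _ do rewrite -mulnb mulnbl.
  rewrite -[RHS]big_mkcond -big_filter -[RHS]big_filter; apply: perm_big.
  apply: uniq_perm; rewrite ?filter_uniq ?undup_uniq ?urt // => x.
  by rewrite !mem_filter mem_undup mrt //= andbC.
rewrite exchange_big -[RHS]szrs -[RHS]size_undup_count; apply: eq_big_seq => x.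
rewrite mem_undup mrs => hx.
have [m m0 per] := frob_period hneq0 hx rootf.
have xm : x ^+ (p ^ m) = x by apply/eqP; rewrite per.
(* The m conjugates of x are distinct because m is the least period, and they all have the same
   multiplicity in h because h is fixed by Frobenius. *)
have cmE i : (conjpoly m x ^+ i %| h) = (i <= count_mem x rs)%N.
  rewrite -mu_prod_XsubC -hrs mup_geq //; apply/idP/idP.
    by apply/dvdp_trans/dvdp_exp2r; rewrite dvdp_XsubCl root_conjpoly.
  move=> xi; rewrite /conjpoly -(big_map (fun i : 'I_m => x ^+ (p ^ i)) xpredT (fun z => 'X - z%:P)).
  apply: prod_XsubC_exp_dvdp.
    rewrite map_inj_in_uniq ?/index_enum -?enumT ?enum_uniq // => a b _ _.
    wlog ab : a b / (a <= b)%N.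
      by move=> W; case: (leqP a b) => [|/ltnW] le e; [apply: W | symmetry; apply: W].
    rewrite -(subnK ab) -frob_iter => /frob_inj /esym/eqP; rewrite per.
    move=> d; apply/val_inj/eqP; rewrite /= eqn_leq ab /= -subn_eq0.
    by rewrite -leqn0 leqNgt; apply/negP => ba; have := dvdn_leq ba d; rewrite leqNgt (leq_ltn_trans (leq_subr _ _)).
  move=> z /mapP[l _ ->]; elim: (l : nat) => [|j IH]; first by rewrite expn0 expr1.
  by rewrite expnSr exprM mupf.
rewrite -[RHS](@sum_dvdn m _ k) //; last first.
  have := cmE (count_mem x rs); rewrite leqnn -conjpolyM // => /dvdp_leq-/(_ hneq0).
  by rewrite size_conjpoly size_map_poly sz ltnS.
apply: eq_bigr => j _; rewrite per; case: (boolP (m %| j)%N) => //= /dvdnP[i ->].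
by rewrite mulnC conjpolyM // cmE leq_pmul2l.
Qed.

End FrobeniusOrbits.

(** * The L-function of a character sum *)

Section MonicSums.
Variable F : finFieldType.

(** Parametrises the monic polynomials of degree k by a finite type, so that sums over them are
    ordinary big operators. *)
Definition monicp k (t : {poly_k F}) : {poly F} := 'X^k + t.

Lemma size_monicp k t : size (@monicp k t) = k.+1.
Proof. by rewrite size_polyDl ?size_polyXn ?ltnS ?size_npoly. Qed.

Lemma monicp_monic k t : @monicp k t \is monic.
Proof. by rewrite monicE lead_coefDl ?lead_coefXn ?size_polyXn ?ltnS ?size_npoly. Qed.

Definition unmonicp k (h : {poly F}) : {poly_k F} := npolyp k (h - 'X^k).

Lemma unmonicpK k h : h \is monic -> size h = k.+1 -> monicp (unmonicp k h) = h.
Proof.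
move=> mh sh.
have s : (size (h - 'X^k)%R <= k)%N.
  apply/leq_sizeP => j; rewrite leq_eqVlt coefB coefXn => /orP[/eqP<-|kj].
    by move: mh; rewrite monicE lead_coefE sh /= => /eqP ->; rewrite eqxx subrr.
  by rewrite nth_default ?sh // gtn_eqF // subr0.
by rewrite /monicp /unmonicp (npolypK s) addrC subrK.
Qed.

Lemma monicpK k t : unmonicp k (@monicp k t) = t.
Proof.
have e : monicp t - 'X^k = t by rewrite /monicp addrC addKr.
apply: val_inj; rewrite /unmonicp e /=.
by rewrite npolypK ?size_npoly.
Qed.

(** Multiplication by g is a bijection from the monic polynomials of degree k - j onto the monic
    multiples of g of degree k. *)
Lemma sum_monic_mul (C : pzRingType) (f : {poly F} -> C) k j (g : {poly F}) :
    (j <= k)%N -> g \is monic -> size g = j.+1 ->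
  \sum_(t : {poly_(k - j) F}) f (g * monicp t)
    = \sum_(t : {poly_k F} | g %| monicp t) f (monicp t).
Proof.
move=> jk mg sg.
rewrite [RHS](reindex_onto (fun t : {poly_(k - j) F} => unmonicp k (g * monicp t))
   (fun t => unmonicp (k - j) (monicp t %/ g))) /=; last first.
  move=> t d; have e : monicp t %/ g * g = monicp t by rewrite divpK.
  have s : size (monicp t %/ g) = (k - j).+1.
    by rewrite size_divp ?monic_neq0 // size_monicp sg /= subSn.
  have m : monicp t %/ g \is monic by rewrite -(monicMr _ mg) e monicp_monic.
  by rewrite (unmonicpK m s) mulrC e monicpK.
have E (t : {poly_(k - j) F}) : monicp (unmonicp k (g * monicp t)) = g * monicp t.
  apply: unmonicpK; first by rewrite monicMl ?monicp_monic.
  by rewrite size_monicM ?monic_neq0 ?monicp_monic // size_monicp sg addnS /= addSn subnKC.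
apply: eq_big => t; last by rewrite E.
by rewrite E dvdp_mulr // mulrC mulpK ?monic_neq0 // monicpK eqxx.
Qed.

End MonicSums.

Section LFunction.
Variables (F : finFieldType) (p : nat) (p_pr : prime p) (cardF : #|F| = p).
Variables (Om : closedFieldType) (iota : {rmorphism F -> Om}).
Variables (C : numClosedFieldType) (chi : F -> C).
Hypothesis chiM : forall a b, chi (a * b) = chi a * chi b.
Hypothesis chi_eq0 : forall a, (chi a == 0) = (a == 0).
Variable r : F.
Hypotheses (r0 : r != 0) (chir : chi r != 1).
Variables a1 a2 a3 : F.

Lemma chi0 : chi 0 = 0. Proof. by apply/eqP; rewrite chi_eq0. Qed.
Lemma chi1 : chi 1 = 1.
Proof.
have : chi 1 != 0 by rewrite chi_eq0 oner_eq0.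
by move/mulfI; apply; rewrite -chiM !mulr1.
Qed.

Lemma chiX a n : chi (a ^+ n) = chi a ^+ n.
Proof. by elim: n => [|n IH]; rewrite ?expr0 ?chi1 // !exprS chiM IH. Qed.

Lemma norm_chi a : a != 0 -> `|chi a| = 1.
Proof.
move=> a0; have ap : a ^+ p.-1 = 1.
  apply: (mulfI a0); rewrite -exprS prednK ?prime_gt0 // mulr1.
  by rewrite -[in LHS]cardF expf_card.
apply/eqP; rewrite -(pexpr_eq1 (n := p.-1)) ?normr_ge0 //; last by rewrite -subn1 subn_gt0 prime_gt1.
by rewrite -normrX -chiX ap chi1 normr1.
Qed.

(** Plays the part of a Dirichlet character on monic polynomials: it is completely multiplicative,
    and at X - u it is the summand of the character sum. *)
Definition xi (h : {poly F}) : C := chi h.[a1] * chi h.[a2] * (chi h.[a3])^*.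

Lemma xiM g h : xi (g * h) = xi g * xi h.
Proof. by rewrite /xi !hornerM !chiM rmorphM /=; ring. Qed.

(* The coefficient of T^k in the L-function. *)
Definition Asum k : C := \sum_(t : {poly_k F}) xi (monicp t).

Lemma Asum0 : Asum 0 = 1.
Proof.
rewrite /Asum (big_pred1 0) => [|t].
  by rewrite /monicp expr0 addr0 /xi !hornerC chi1 rmorph1 !mulr1.
apply/esym/eqP; apply: val_inj; apply/eqP.
by rewrite -size_poly_eq0 -leqn0 size_npoly.
Qed.

(* The map h |-> r h + (1 - r) q, where q is monic and vanishes at a1, a2, a3,
   permutes the monic polynomials of degree k and multiplies xi by chi r. *)
Lemma Asum_ge3 k : (3 <= k)%N -> Asum k = 0.
Proof.
move=> k3.
pose q : {poly F} := 'X^(k - 3) * (('X - a1%:P) * (('X - a2%:P) * ('X - a3%:P))).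
have mq : q \is monic by rewrite !(monicMl, monicXn, monicXsubC).
have sq : size q = k.+1.
  rewrite size_monicM ?monicXn ?monic_neq0 ?monicMl ?monicXsubC //.
  rewrite size_polyXn !size_monicM ?monic_neq0 ?monicMl ?monicXsubC // !size_XsubC.
  by lia.
have qk : q`_k = 1 by have := mq; rewrite monicE lead_coefE sq => /eqP.
pose T c (t : {poly_k F}) := unmonicp k (c *: monicp t + (1 - c) *: q).
have TE c t : monicp (T c t) = c *: monicp t + (1 - c) *: q.
  have lt : (monicp t)`_k = 1.
    by have := monicp_monic t; rewrite monicE lead_coefE size_monicp => /eqP.
  have co j : (k <= j)%N -> (c *: monicp t + (1 - c) *: q)`_j = (j == k)%:R.
    rewrite leq_eqVlt => /orP[/eqP <-|kj].
      by rewrite coefD !coefZ lt qk !mulr1 eqxx addrC subrK.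
    by rewrite gtn_eqF // coefD !coefZ !nth_default ?sq ?size_monicp // !mulr0 addr0.
  have s : size (c *: monicp t + (1 - c) *: q) = k.+1.
    apply/eqP; rewrite eqn_leq; apply/andP; split.
      by apply/leq_sizeP => j kj; rewrite co ?(ltnW kj) // gtn_eqF.
    rewrite ltnNge; apply/negP => /leq_sizeP/(_ k (leqnn k))/eqP.
    by rewrite co // eqxx oner_eq0.
  apply: unmonicpK => //.
  by rewrite monicE lead_coefE s /= co // eqxx.
have TK c : c != 0 -> cancel (T c) (T c^-1).
  move=> c0 t; rewrite -[RHS]monicpK /T TE; congr unmonicp.
  rewrite scalerDr !scalerA mulVf // scale1r -addrA -scalerDl.
  suff -> : c^-1 * (1 - c) + (1 - c^-1) = 0 by rewrite scale0r addr0.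
  by rewrite mulrBr mulVf // mulr1 addrA subrK subrr.
have bT : bijective (T r).
  exists (T r^-1); first exact: TK.
  by move=> t; rewrite -{1}[r]invrK TK // invr_eq0.
have q0 a : a \in [:: a1; a2; a3] -> q.[a] = 0.
  by rewrite !inE => /or3P[] /eqP ->; rewrite /q !hornerM !hornerXsubC subrr ?(mul0r, mulr0).
have : Asum k = chi r * Asum k.
  rewrite {1}/Asum (reindex _ (onW_bij _ bT)) mulr_sumr; apply: eq_bigr => t _.
  rewrite TE /xi !hornerD !hornerZ !q0 ?inE ?eqxx ?orbT // !mulr0 !addr0 !chiM rmorphM /=.
  (* Two factors [chi r] and one conjugate, all of absolute value 1, leave a single [chi r]. *)
  have -> : chi r * chi (monicp t).[a1] * (chi r * chi (monicp t).[a2]) *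
     ((chi r)^* * (chi (monicp t).[a3])^*) =
     (chi r * (chi r)^*) * (chi r * (chi (monicp t).[a1] * chi (monicp t).[a2] * (chi (monicp t).[a3])^*)) by ring.
  by rewrite -normCK norm_chi // expr1n mul1r /monicp !hornerD.
move/eqP; rewrite eq_sym -subr_eq0 -{2}[Asum k]mul1r -mulrBl mulf_eq0 subr_eq0.
by rewrite (negPf chir) => /eqP.
Qed.

(** Transports [chi] to the image of [iota], where its arguments lie in the sums over F_(p^j); the
    value 0 elsewhere is a convention. *)
Definition chiO (y : Om) : C := if [pick a | iota a == y] is Some a then chi a else 0.

Lemma chiO_iota a : chiO (iota a) = chi a.
Proof.
rewrite /chiO; case: pickP => [b /eqP/fmorph_inj -> //|/(_ a)].
by rewrite eqxx.
Qed.

Definition xiO (g : {poly Om}) : C :=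
  chiO g.[iota a1] * chiO g.[iota a2] * (chiO g.[iota a3])^*.

Lemma xiO_map h : xiO (map_poly iota h) = xi h.
Proof. by rewrite /xiO !horner_map !chiO_iota. Qed.

(** When s lists F_(p^j), this is the character sum lifted to F_(p^j) through the norm; j = 1 gives
    the sum to be bounded. *)
Definition Ssum (s : seq Om) j : C := \sum_(x <- s) xiO (conjpoly p j x).

(* The logarithmic derivative of the Euler product, written without series. *)
Lemma Ssum_recurrence (rt : nat -> seq Om) k :
    (forall j, (0 < j)%N -> uniq (rt j)) ->
    (forall j x, (0 < j)%N -> (x \in rt j) = (x ^+ (p ^ j) == x)) ->
  k%:R * Asum k = \sum_(1 <= j < k.+1) Ssum (rt j) j * Asum (k - j).
Proof.
move=> urt mrt.
rewrite {1}/Asum mulr_sumr.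
(* The factor k counts the pairs (j, x) for which [conjpoly p j x] divides the given monic
   polynomial. *)
transitivity (\sum_(t : {poly_k F}) \sum_(1 <= j < k.+1) \sum_(x <- rt j)
   (if conjpoly p j x %| map_poly iota (monicp t) then xi (monicp t) else 0)).
  apply: eq_bigr => t _.
  have := sum_conjpoly_dvdp p_pr cardF iota urt mrt (monicp_monic t) (size_monicp t).
  move=> e; rewrite -{1}e natr_sum mulr_suml; apply: eq_bigr => j _.
  rewrite natr_sum mulr_suml; apply: eq_bigr => x _.
  by case: ifP; rewrite ?mul1r ?mul0r.
rewrite exchange_big; apply: eq_big_nat => j /andP[j0 jk] /=.
rewrite exchange_big /Ssum mulr_suml; apply: eq_big_seq => x.
rewrite mrt // => /eqP xj /=.
have [g cg [mg sg]] := conjpoly_map p_pr cardF iota xj.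
rewrite cg xiO_map -big_mkcond /= mulr_sumr.
under eq_bigl => t do rewrite dvdp_map.
rewrite -(@sum_monic_mul F C xi k j) //.
by apply: eq_bigr => t _; rewrite xiM.
Qed.

End LFunction.

(** * Power sums *)

Section PowerSums.
Variable C : numClosedFieldType.
Hypothesis archi : forall x : C, 0 <= x -> exists n : nat, x < n%:R.

(** If x > r, Bernoulli's inequality makes (x / r)^k grow at least linearly, beyond c by the
    archimedean property [archi]. *)
Lemma le_of_expn_bounded (x r c : C) : 0 <= x -> 0 < r ->
  (forall k, (3 <= k)%N -> x ^+ k <= c * r ^+ k) -> x <= r.
Proof.
move=> x0 r0 H; have [//|rx] := real_leP (ger0_real x0) (gtr0_real r0).
pose h := x / r - 1; have h0 : 0 < h by rewrite subr_gt0 ltr_pdivlMr ?mul1r.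
have bern k : 1 + k%:R * h <= (1 + h) ^+ k.
  elim: k => [|k IH]; first by rewrite mul0r addr0 expr0.
  have p1 : 0 <= 1 + h by rewrite addr_ge0 // ltW.
  rewrite exprSr; apply: le_trans (ler_wpM2r p1 IH); rewrite -subr_ge0.
  have -> : (1 + k%:R * h) * (1 + h) - (1 + k.+1%:R * h) = k%:R * h ^+ 2.
    by rewrite -[k.+1]addn1 natrD; ring.
  by rewrite mulr_ge0 // exprn_ge0 // ltW.
have xr : x / r = 1 + h by rewrite /h addrC subrK.
have c0 : 0 <= c.
  have := H 3%N isT; rewrite -ler_pdivrMr ?exprn_gt0 //; apply: le_trans.
  by rewrite divr_ge0 ?exprn_ge0 // ltW.
have [n hn] := archi (divr_ge0 c0 (ltW h0)).
have := H (n + 3)%N (leq_addl _ _); rewrite -ler_pdivrMr ?exprn_gt0 // -expr_div_n xr => le1.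
have := le_trans (bern _) le1; rewrite natrD mulrDl addrA => le2.
have : c < c by move: hn; rewrite ltr_pdivrMr // => /lt_le_trans; apply; apply: le_trans le2;
  rewrite addrAC lerDr addr_ge0 // mulr_ge0 // ltW.
by rewrite ltxx.
Qed.

(** The other root is eliminated by u^k (u - v) = (u^(k+1) + v^(k+1)) - v (u^k + v^k), which bounds
    |u|^k when u and v differ. When they coincide the power sum is 2 u^k. *)
Lemma norm_le_of_power_sum (u v r c : C) : 0 < r ->
  (forall k, (3 <= k)%N -> `|u ^+ k + v ^+ k| <= c * r ^+ k) -> `|u| <= r.
Proof.
move=> r0 H; have [uv|uv] := eqVneq u v.
  apply: (@le_of_expn_bounded _ _ (c / 2)) => // k /H.
  rewrite -uv (_ : u ^+ k + u ^+ k = u ^+ k * 2%:R); last by ring.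
  by rewrite normrM normr_nat normrX mulrAC ler_pdivlMr.
apply: (@le_of_expn_bounded _ _ ((c * (r + `|v|)) / `|u - v|)) => // k k3.
have uv0 : 0 < `|u - v| by rewrite normr_gt0 subr_eq0.
rewrite mulrAC ler_pdivlMr // -normrX -normrM.
have -> : u ^+ k * (u - v) = (u ^+ k.+1 + v ^+ k.+1) - v * (u ^+ k + v ^+ k).
  by rewrite !exprS; ring.
apply: (le_trans (ler_normB _ _)); rewrite normrM mulrDr mulrDl lerD //.
  by rewrite -mulrA -exprS H // ltnW.
by rewrite [c * _]mulrC -mulrA ler_wpM2l // H.
Qed.

(** Newton's identities, with 1 + A_1 T + A_2 T^2 = (1 - u T) (1 - v T). *)
Lemma two_roots_of_recurrence (A S : nat -> C) : A 0%N = 1 ->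
  (forall k, (3 <= k)%N -> A k = 0) ->
  (forall k, k%:R * A k = \sum_(1 <= j < k.+1) S j * A (k - j)%N) ->
  exists u v : C, forall n, (0 < n)%N -> S n = - (u ^+ n + v ^+ n).
Proof.
move=> A0 A3 rec.
pose D := sqrtC (A 1%N ^+ 2 - 4 * A 2%N).
have DD : D ^+ 2 = A 1%N ^+ 2 - 4 * A 2%N by rewrite sqrtCK.
pose u := (- A 1%N + D) / 2; pose v := (- A 1%N - D) / 2.
have sum_uv : A 1%N = - (u + v) by rewrite /u /v; field.
have mul_uv : A 2%N = u * v.
  apply: (mulfI (_ : 4 != 0 :> C)); first by rewrite pnatr_eq0.
  have -> : 4 * (u * v) = A 1%N ^+ 2 - D ^+ 2 by rewrite /u /v; field.
  by rewrite DD; ring.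
clearbody u v; clear D DD; exists u, v.
have S1 : S 1%N = - (u + v).
  by have := rec 1%N; rewrite big_nat1 subnn A0 mulr1 mul1r => <-.
have S2 : S 2%N = - (u ^+ 2 + v ^+ 2).
  have := rec 2%N; rewrite big_nat_recr //= big_nat1 subnn A0 S1 sum_uv mul_uv => e.
  have -> : S 2%N = 2 * (u * v) - - (u + v) * - (u + v) by rewrite e mulr1 addrAC subrr add0r.
  by ring.
have Srec n : S n.+3 = - (A 1%N * S n.+2 + A 2%N * S n.+1).
  have := rec n.+3; rewrite A3 // mulr0 big_nat_recr // big_nat_recr // big_nat_recr //=.
  rewrite big_nat_cond big1 ?add0r => [|j /andP[/andP[j1 jn] _]]; last first.
    by rewrite A3 ?mulr0 //; lia.
  have e1 : (n.+3 - n.+1 = 2)%N by lia.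
  have e2 : (n.+3 - n.+2 = 1)%N by lia.
  rewrite e1 e2 subnn A0 mulr1 => /esym/eqP; rewrite addrC addr_eq0 => /eqP ->.
  by rewrite addrC [S n.+2 * _]mulrC [S n.+1 * _]mulrC.
move=> n; elim/ltn_ind: n => -[|[|[|n]]] // IH _.
by rewrite Srec !IH // sum_uv mul_uv !exprS; ring.
Qed.

End PowerSums.

(** * The Weil bound *)

Section WeilBound.
Variables (F : finFieldType) (p : nat) (p_pr : prime p) (cardF : #|F| = p) (p2 : (2 < p)%N).
Variables (C : numClosedFieldType) (chi : F -> C).
Hypothesis archi : forall x : C, 0 <= x -> exists n : nat, x < n%:R.
Hypothesis chiM : forall a b, chi (a * b) = chi a * chi b.
Hypothesis chi_eq0 : forall a, (chi a == 0) = (a == 0).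
Variable r : F.
Hypotheses (r0 : r != 0) (chir : chi r != 1).
Variables a1 a2 a3 : F.

Lemma sum_chi_eq0 : \sum_a chi a = 0.
Proof.
have bij : bijective ( *%R r).
  by exists ( *%R r^-1) => x; rewrite mulrA ?mulVf ?mulfV // mul1r.
have : \sum_a chi a = chi r * \sum_a chi a.
  by rewrite {1}(reindex _ (onW_bij _ bij)) mulr_sumr; apply: eq_bigr => a _; rewrite chiM.
move/eqP; rewrite eq_sym -subr_eq0 -{2}[\sum_a _]mul1r -mulrBl mulf_eq0 subr_eq0.
by rewrite (negPf chir) => /eqP.
Qed.

(** For a nonzero, the conjugate is chi(1/a) and 1/a = a^(p-2); at a = 0 the exponent has to be
    positive, whence p > 2. The summand thus becomes chi of a polynomial in u, of degree p. *)
Lemma conj_chi a : (chi a)^* = chi (a ^+ (p - 2)).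
Proof.
have [->|a0] := eqVneq a 0.
  rewrite expr0n (chi0 chi_eq0) rmorph0 (_ : (p - 2 == 0)%N = false) ?(chi0 chi_eq0) //.
  by apply/eqP; lia.
apply: (mulfI (_ : chi a != 0)); first by rewrite chi_eq0.
rewrite -normCK (norm_chi p_pr cardF chiM chi_eq0 a0) expr1n -chiM -exprS.
rewrite (_ : a ^+ _ = 1) ?(chi1 chiM chi_eq0) //.
apply: (mulfI a0); rewrite -exprS mulr1 -[RHS]expf_card cardF; congr (_ ^+ _); lia.
Qed.

Variables (Om : closedFieldType) (iota : {rmorphism F -> Om}).
Let pOm := pcharOm p_pr cardF iota.
Local Notation rt := (frob_roots p Om).
Local Notation b1 := (iota a1).
Local Notation b2 := (iota a2).
Local Notation b3 := (iota a3).

Let f : {poly Om} := (b1%:P - 'X) * (b2%:P - 'X) * (b3%:P - 'X) ^+ (p - 2).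
Local Notation e n := (\sum_(i < n) p ^ i)%N.

Lemma size_CsubX (b : Om) : size (b%:P - 'X) = 2%N.
Proof. by rewrite -opprB size_polyN size_XsubC. Qed.

Lemma CsubX_neq0 (b : Om) : b%:P - 'X != 0.
Proof. by rewrite -size_poly_eq0 size_CsubX. Qed.

Lemma size_weil_poly : size f = p.+1.
Proof.
rewrite size_mul ?mulf_neq0 ?expf_neq0 ?CsubX_neq0 // size_mul ?CsubX_neq0 // !size_CsubX.
rewrite (polySpred (expf_neq0 (p - 2) (CsubX_neq0 b3))) size_exp size_CsubX; lia.
Qed.

Lemma horner_weil_poly x : f.[x] = (b1 - x) * (b2 - x) * (b3 - x) ^+ (p - 2).
Proof. by rewrite /f !hornerE. Qed.

(** Each factor a - x^(p^i) is a Frobenius image of a - x, so the product is the norm of a - x. *)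
Lemma horner_conjpoly n x a : x ^+ (p ^ n) = x ->
  (conjpoly p n x).[iota a] = (iota a - x) ^+ e n.
Proof.
move=> xn; rewrite /conjpoly horner_prod -prodrXr; apply: eq_bigr => i _.
by rewrite hornerXsubC (frobD p_pr cardF iota) (frobN p_pr cardF iota) (frob_iota cardF).
Qed.

Lemma norm_in_base n (z : Om) : (0 < n)%N -> z ^+ (p ^ n) = z -> exists a, z ^+ e n = iota a.
Proof.
move=> n0 zn; apply: (frob_fixed cardF); rewrite -exprM.
have dE : (p.-1 * e n = (p ^ n).-1)%N by rewrite [RHS]predn_exp.
have e0 : (0 < e n)%N by case: n n0 {zn dE} => // n _; rewrite big_ord_recl expn0.
have [->|z0] := eqVneq z 0; first by rewrite !expr0n muln_eq0 !gtn_eqF //; lia.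
have z1 : z ^+ (p ^ n).-1 = 1.
  by apply: (mulfI z0); rewrite -exprS prednK ?expn_gt0 ?prime_gt0 // mulr1.
by rewrite mulnC -(prednK (prime_gt0 p_pr)) mulSn prednK ?prime_gt0 // dE exprD z1 mulr1.
Qed.

Let V n (c : F) := count (fun x => f.[x] ^+ e n == iota c) (rt n).

Lemma Ssum_count n : (0 < n)%N ->
  Ssum p iota chi a1 a2 a3 (rt n) n = \sum_c chi c * (V n c)%:R.
Proof.
move=> n0; have [urt _ mrt] := frob_rootsP p_pr cardF iota n0.
transitivity (\sum_c \sum_(x <- rt n | f.[x] ^+ e n == iota c) chi c); last first.
  by apply: eq_bigr => c _; rewrite big_const_seq iter_addr_0 mulr_natr.
under [RHS]eq_bigr do rewrite big_mkcond.
rewrite exchange_big /Ssum; apply: eq_big_seq => x; rewrite mrt => /eqP xn /=.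
have zn a : (iota a - x) ^+ (p ^ n) = iota a - x.
  by rewrite (frobD p_pr cardF iota) (frobN p_pr cardF iota) (frob_iota cardF) xn.
have [c1 e1] := norm_in_base n0 (zn a1); have [c2 e2] := norm_in_base n0 (zn a2).
have [c3 e3] := norm_in_base n0 (zn a3).
have fx : f.[x] ^+ e n = iota (c1 * c2 * c3 ^+ (p - 2)).
  by rewrite horner_weil_poly !rmorphM rmorphXn /= -e1 -e2 -e3 !exprMn -!exprM [(_ * e n)%N]mulnC.
rewrite /xiO !horner_conjpoly // e1 e2 e3 !chiO_iota conj_chi -!chiM.
rewrite (bigD1 (c1 * c2 * c3 ^+ (p - 2))) //= fx eqxx big1 ?addr0 // => c cc.
by rewrite ifN // (inj_eq (fmorph_inj iota)) eq_sym.
Qed.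

Lemma sum_count n : (0 < n)%N -> (\sum_c V n c = p ^ n)%N.
Proof.
move=> n0; have [urt szrt mrt] := frob_rootsP p_pr cardF iota n0.
rewrite -[RHS]szrt -[RHS]sum1_size; under eq_bigr do rewrite /V -sum1_count big_mkcond.
rewrite exchange_big /=; apply: eq_big_seq => x; rewrite mrt => /eqP xn /=.
have zn : f.[x] ^+ (p ^ n) = f.[x].
  have za a : (iota a - x) ^+ (p ^ n) = iota a - x.
    by rewrite (frobD p_pr cardF iota) (frobN p_pr cardF iota) (frob_iota cardF) xn.
  by rewrite horner_weil_poly !exprMn -exprM [(_ * p ^ n)%N]mulnC exprM !za.
have [c fx] := norm_in_base n0 zn.
rewrite (bigD1 c) //= fx eqxx big1 ?addn0 // => c' cc.
by rewrite ifN // (inj_eq (fmorph_inj iota)) eq_sym.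
Qed.

Lemma count0_le n : (0 < n)%N -> (V n 0%R <= 3)%N.
Proof.
move=> n0; have [urt _ _] := frob_rootsP p_pr cardF iota n0.
rewrite /V -size_filter -[3%N]/(size [:: b1; b2; b3]); apply: uniq_leq_size; first exact: filter_uniq.
move=> x; rewrite mem_filter rmorph0 expf_eq0 horner_weil_poly => /andP[/andP[_ h] _].
move: h; rewrite !mulf_eq0 expf_eq0 !subr_eq0 !inE ![x == _]eq_sym -orbA.
by case/or3P=> [->|->|/andP[_ ->]]; rewrite ?orbT.
Qed.

(** Stepanov's bound with J - 1 = p^(k-2), divided by J - 1. The main term p^(2k) is what
    equidistribution over the p - 1 nonzero values predicts. [TJ] allows J up to about p^(2k)'s
    square root over p^(3/2); the even degree 2k makes a power of p available there. *)
Lemma count_le k c : (3 <= k)%N -> c != 0 ->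
  (p.-1 * V (2 * k) c <= p.-1 * p + p.-1 * p ^ (k + 2) + p ^ (2 * k))%N.
Proof.
move=> k3 c0; set n := (2 * k)%N.
have n0 : (0 < n)%N by rewrite /n; lia.
have [urt _ mrt] := frob_rootsP p_pr cardF iota n0.
have eE : e n = (e n).-1.+1.
  by rewrite prednK //; case: n n0 {urt mrt} => // n _; rewrite big_ord_recl expn0.
have TJ : ((p.-1 ^ 2 + 1) * (p ^ (k - 2)).+1 ^ 2 <= (e n).-1)%N.
  have -> : e n = (e n.-1 + p ^ n.-1)%N by rewrite -[in LHS](prednK n0) big_ord_recr.
  have : (0 < e n.-1)%N by rewrite /n (_ : (2 * k).-1 = (2 * k).-2.+1)%N ?big_ord_recl ?expn0 //; lia.
  set P := (p ^ (k - 2))%N.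
  have P3 : (3 <= P)%N by rewrite (leq_trans p2) // -{1}(expn1 p) leq_pexp2l //; lia.
  have -> : (p ^ n.-1 = p ^ 3 * (P ^ 2))%N by rewrite -expnM -expnD; congr (_ ^ _)%N; rewrite /n; lia.
  move=> e0; have {e0} : (p ^ 3 * P ^ 2 <= (e n.-1 + p ^ 3 * P ^ 2).-1)%N by lia.
  (* The factors are compared separately: 3 (P + 1) <= 4 P as P >= 3, and 16 ((p - 1)^2 + 1) <= 9
     p^3 as p >= 3. *)
  apply: leq_trans; rewrite -(@leq_pmul2l (9 * 16)) //.
  have h1 : (9 * P.+1 ^ 2 <= 16 * P ^ 2)%N by rewrite -!mulnn; nia.
  have h2 : (16 * (p.-1 ^ 2 + 1) <= 9 * p ^ 3)%N.
    have -> : p = p.-1.+1 by lia.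
    have : (2 <= p.-1)%N by lia.
    by move: (p.-1) => d d2; rewrite /= !expnS !expn0; nia.
  have := leq_mul h2 h1; rewrite !expnS !expn0; lia.
have := @stepanov_bound Om p pOm f n size_weil_poly (e n).-1 (p ^ (k - 2)).+1 (iota c)
  [seq x <- rt n | f.[x] ^+ e n == iota c] p2 eE _ TJ.
have P0 : (0 < p ^ (k - 2))%N by rewrite expn_gt0 prime_gt0.
rewrite ltnS P0 size_filter -/(V n c) => /(_ isT) H.
have {H} := H (filter_uniq _ urt) _ _; rewrite /=.
have nE : (p ^ n = p ^ (k - 2) * p ^ (k + 2))%N by rewrite -expnD /n; congr (_ ^ _)%N; lia.
rewrite [in (p.-1 * p ^ n)%N]nE => H.
rewrite -(leq_pmul2l P0) mulnA [(_ * p.-1)%N]mulnC.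
apply: leq_trans (H _ _) _.
- by move=> x; rewrite mem_filter mrt => /andP[_ /eqP].
- by move=> x; rewrite mem_filter => /andP[/eqP].
by rewrite !mulnDr; apply: eq_leq; congr (_ + _ + _)%N; lia.
Qed.

(** The counts may be centred because chi sums to 0. The centred counts x are only known to satisfy
    x <= B, but then |x| <= 2 B - x, and the sum of the x is -(p - 1) V(0), which is small. The
    constant may depend on p, as long as it does not depend on k. *)
Lemma Ssum_le k : (3 <= k)%N ->
  `|Ssum p iota chi a1 a2 a3 (rt (2 * k)) (2 * k)| <= (2 * p ^ 3 + 2 * p ^ 2 + 3)%:R * p%:R ^+ k.
Proof.
move=> k3; set n := (2 * k)%N; have n0 : (0 < n)%N by rewrite /n; lia.
rewrite Ssum_count //.
pose B := (p.-1 * p + p.-1 * p ^ (k + 2))%N.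
pose x c : C := (p.-1 * V n c)%:R - (p ^ n)%:R.
have xE : p.-1%:R * (\sum_c chi c * (V n c)%:R) = \sum_(c | c != 0) chi c * x c.
  transitivity (\sum_c chi c * x c).
    rewrite /x; under [RHS]eq_bigr do rewrite mulrBr natrM mulrCA.
    by rewrite big_split /= -mulr_sumr sumrN -mulr_suml sum_chi_eq0 mul0r oppr0 addr0.
  by rewrite (bigD1 0) //= (chi0 chi_eq0) mul0r add0r.
have xle c : c != 0 -> `|x c| <= 2 * B%:R - x c.
  move=> c0; have xB : x c <= B%:R by rewrite lerBlDr -natrD ler_nat count_le.
  have xr : x c \is Num.real by rewrite rpredB ?realn.
  have B0 : 0 <= B%:R :> C by [].
  case: (real_ge0P xr) => _; last by rewrite lerBrDr addNr mulr_ge0.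
  by rewrite lerBrDr (_ : 2 * B%:R = B%:R + B%:R) ?lerD //; ring.
have sumx : \sum_(c | c != 0) x c = - (p.-1 * V n 0%R)%:R.
  rewrite sumrB sumr_const -(natr_sum _ _ _ (fun c => p.-1 * V n c)%N) -big_distrr /=.
  rewrite (_ : #|_| = p.-1); last by rewrite -cardF -(cardC1 (0 : F)); apply: eq_card => c; rewrite !inE.
  have := sum_count n0; rewrite (bigD1 0) //= => <-.
  by rewrite -mulrnA [((_ + _) * _)%N]mulnC mulnDr natrD opprD addrCA subrr addr0.
have d0 : 0 < p.-1%:R :> C by rewrite ltr0n; lia.
rewrite -(ler_pM2l d0) -[X in X * `|_|](ger0_norm (ltW d0)) -normrM xE.
apply: (le_trans (ler_norm_sum _ _ _)).
apply: (@le_trans _ _ (\sum_(c : F | c != 0) (2 * B%:R - x c))).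
  by apply: ler_sum => c c0; rewrite normrM (norm_chi p_pr cardF chiM chi_eq0) // mul1r xle.
rewrite sumrB sumx opprK sumr_const.
rewrite (_ : #|_| = p.-1); last by rewrite -cardF -(cardC1 (0 : F)); apply: eq_card => c; rewrite !inE.
rewrite -natrX -!natrM -mulrnA -natrD ler_nat [(_ * p.-1)%N]mulnC -mulnDr leq_mul2l; apply/orP; right.
apply: (@leq_trans (2 * B + 3)); first by rewrite leq_add2l count0_le.
rewrite /B expnD.
have : (p.-1 * p <= p ^ 2 * p ^ k)%N.
  rewrite -mulnn -mulnA leq_mul ?leq_pred // leq_pmulr // expn_gt0; lia.
have : (p.-1 * (p ^ k * p ^ 2) <= p ^ 3 * p ^ k)%N.
  by rewrite (expnS p 2) [(p ^ k * _)%N]mulnC mulnA leq_mul2r leq_mul2r leq_pred !orbT.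
have : (1 <= p ^ k)%N by rewrite expn_gt0; lia.
lia.
Qed.

Lemma weil_bound_closed :
  `|\sum_u chi (a1 - u) * chi (a2 - u) * (chi (a3 - u))^*| <= 2 * sqrtC p%:R.
Proof.
have rtP j : (0 < j)%N -> _ := fun j0 => frob_rootsP p_pr cardF iota j0.
have [u [v uv]] : exists u v : C, forall n, (0 < n)%N ->
    Ssum p iota chi a1 a2 a3 (rt n) n = - (u ^+ n + v ^+ n).
  apply: (two_roots_of_recurrence (A := Asum chi a1 a2 a3)).
  - exact: Asum0.
  - by move=> k k3; apply: (Asum_ge3 p_pr cardF _ _ r0 chir).
  - move=> k; apply: (Ssum_recurrence p_pr cardF) => // j; first by case/rtP.
    by move=> x /rtP[].
have sq n : u ^+ (2 * n) + v ^+ (2 * n) = (u ^+ 2) ^+ n + (v ^+ 2) ^+ n by rewrite -!exprM.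
have p0 : 0 < p%:R :> C by rewrite ltr0n; lia.
(* Only even degrees are controlled, so the power sum argument is applied to u^2 and v^2 with bound
   p. *)
have bd k : (3 <= k)%N -> `|(u ^+ 2) ^+ k + (v ^+ 2) ^+ k| <= (2 * p ^ 3 + 2 * p ^ 2 + 3)%:R * p%:R ^+ k.
  by move=> k3; rewrite -sq -normrN -uv ?Ssum_le //; lia.
have root_le (w : C) : `|w ^+ 2| <= p%:R -> `|w| <= sqrtC p%:R.
  move=> h; have s0 : 0 <= sqrtC p%:R :> C by rewrite sqrtC_ge0 ltW.
  rewrite -(ler_pXn2r (n := 2)) ?nnegrE //; by rewrite sqrtCK -normrX.
have hu : `|u| <= sqrtC p%:R by apply/root_le/(norm_le_of_power_sum archi p0 bd).
have hv : `|v| <= sqrtC p%:R.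
  by apply/root_le/(norm_le_of_power_sum archi p0 (v := u ^+ 2)) => k /bd; rewrite addrC; exact.
have := uv 1%N isT; rewrite !expr1 => S1.
suff <- : Ssum p iota chi a1 a2 a3 (rt 1) 1 = \sum_u chi (a1 - u) * chi (a2 - u) * (chi (a3 - u))^*.
  by rewrite S1 normrN (le_trans (ler_normD _ _)) // mulr_natl mulr2n lerD.
rewrite /Ssum; have [urt szrt mrt] := rtP 1%N isT.
rewrite (perm_big [seq iota u | u <- index_enum F]) /=.
  rewrite big_map; apply: eq_bigr => w _.
  have -> : conjpoly p 1 (iota w) = map_poly iota ('X - w%:P).
    by rewrite /conjpoly big_ord1 expn0 expr1 rmorphB /= map_polyX map_polyC.
  by rewrite xiO_map /xi !hornerXsubC.
apply: uniq_perm => //; first by rewrite map_inj_uniq ?index_enum_uniq //; apply: fmorph_inj.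
move=> x; rewrite mrt expn1; apply/idP/mapP => [/eqP h|[a _ ->]]; last apply/eqP.
  have [a ->] := frob_fixed cardF iota h.
  by exists a; rewrite ?mem_index_enum.
by have := frob_iota cardF iota 1 a; rewrite expn1.
Qed.

End WeilBound.

Theorem weil_bound (F : finFieldType) (p : nat) (C : numClosedFieldType) (chi : F -> C)
    (r a1 a2 a3 : F) :
    prime p -> #|F| = p -> (2 < p)%N ->
    (forall x : C, 0 <= x -> exists n : nat, x < n%:R) ->
    (forall a b, chi (a * b) = chi a * chi b) ->
    (forall a, (chi a == 0) = (a == 0)) ->
    r != 0 -> chi r != 1 ->
  `|\sum_u chi (a1 - u) * chi (a2 - u) * (chi (a3 - u))^*| <= 2 * sqrtC p%:R.
Proof.
move=> p_pr cardF p2 archi chiM chi_eq0 r0 chir.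
have [Om [iota _]] := countable_algebraic_closure F.
exact: (weil_bound_closed p_pr cardF p2 archi chiM chi_eq0 r0 chir a1 a2 a3 iota).
Qed.

(** * Moments of short character sums *)

Section Moments.
Variables (F : finFieldType) (p : nat) (p_pr : prime p) (cardF : #|F| = p) (p2 : (2 < p)%N).
Variables (C : numClosedFieldType) (chi : F -> C).
Hypothesis archi : forall x : C, 0 <= x -> exists n : nat, x < n%:R.
Hypothesis chiM : forall a b, chi (a * b) = chi a * chi b.
Hypothesis chi_eq0 : forall a, (chi a == 0) = (a == 0).
Variable r : F.
Hypotheses (r0 : r != 0) (chir : chi r != 1).

Let nchi a : a != 0 -> `|chi a| = 1 := fun a0 => norm_chi p_pr cardF chiM chi_eq0 a0.

Lemma norm_chi_le1 a : `|chi a| <= 1.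
Proof. by have [->|/nchi ->//] := eqVneq a 0; rewrite (chi0 chi_eq0) normr0. Qed.

Lemma chi_neq0_mul_conj a : a != 0 -> chi a * (chi a)^* = 1.
Proof. by move=> a0; rewrite -normCK nchi // expr1n. Qed.

Lemma inv_shift_bij (c : F) : bijective (fun u : F => u^-1 - c).
Proof.
by exists (fun x => (x + c)^-1) => x; rewrite ?subrK ?invrK // addrK.
Qed.

Definition corr4 c1 c2 c3 c4 : C :=
  \sum_x chi (x + c1) * chi (x + c2) * ((chi (x + c3))^* * (chi (x + c4))^*).

(* The substitution x + c4 = 1 / u turns four factors into three. *)
Lemma corr4_unique c1 c2 c3 c4 : c4 != c1 -> c4 != c2 -> c4 != c3 ->
  `|corr4 c1 c2 c3 c4| <= 3 * sqrtC p%:R.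
Proof.
move=> h1 h2 h3.
have d0 c : c4 != c -> c - c4 != 0 by move=> h; rewrite subr_eq0 eq_sym.
pose a c := - (c - c4)^-1.
pose G u := chi (a c1 - u) * chi (a c2 - u) * (chi (a c3 - u))^*.
have shift c u : c4 != c -> u != 0 -> u^-1 - c4 + c = u^-1 * - (c - c4) * (a c - u).
  move=> /d0 hc hu; rewrite /a; field; by rewrite hu hc.
have -> : corr4 c1 c2 c3 c4 = chi (- (c1 - c4)) * chi (- (c2 - c4)) * (chi (- (c3 - c4)))^* *
    (\sum_u G u - G 0).
  rewrite (bigD1 0 (F := G)) //= [G 0 + _]addrC addrK mulr_sumr.
  rewrite /corr4 (reindex _ (onW_bij _ (inv_shift_bij c4))) (bigD1 0) //=.
  rewrite invr0 sub0r addNr (chi0 chi_eq0) rmorph0 !mulr0 add0r.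
  apply: eq_bigr => u u0; rewrite subrK !shift // !chiM !rmorphM /= /G.
  have e : chi u^-1 * (chi u^-1)^* = 1 by rewrite chi_neq0_mul_conj // invr_eq0.
  transitivity ((chi u^-1 * (chi u^-1)^*) ^+ 2 * (chi (- (c1 - c4)) * chi (- (c2 - c4)) *
      (chi (- (c3 - c4)))^* * (chi (a c1 - u) * chi (a c2 - u) * (chi (a c3 - u))^*))).
    by ring.
  by rewrite e expr1n mul1r.
have chiN c : c4 != c -> `|chi (- (c - c4))| = 1 by move=> /d0 h; rewrite nchi // oppr_eq0.
rewrite !normrM norm_conjC !chiN // !mul1r.
apply: (le_trans (ler_normB _ _)).
have -> : 3 * sqrtC p%:R = 2 * sqrtC p%:R + sqrtC p%:R :> C by ring.
apply: lerD; first exact: (weil_bound _ _ _ p_pr cardF p2 archi chiM chi_eq0 r0 chir).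
apply: (@le_trans _ _ 1).
  by rewrite /G !normrM norm_conjC !mulr_ile1 ?mulr_ge0 ?norm_chi_le1.
have : sqrtC 1 <= sqrtC p%:R :> C by rewrite ler_sqrtC ?qualifE /= ?ler0n ?ler01 // ler1n prime_gt0.
by rewrite sqrtC1.
Qed.

(** A shift different from the three others can be moved to the last place by symmetry and
    conjugation. If there is none, the shifts agree in pairs, and the last term covers the trivial
    bound p. *)
Lemma corr4_le c1 c2 c3 c4 : `|corr4 c1 c2 c3 c4| <= 3 * sqrtC p%:R +
   p%:R * ((c1 == c2) && (c3 == c4) + ((c1 == c3) && (c2 == c4)) + ((c1 == c4) && (c2 == c3)))%:R.
Proof.
have s0 : 0 <= 3 * sqrtC p%:R :> C by rewrite mulr_ge0 // sqrtC_ge0 ler0n.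
have sw34 a b c d : corr4 a b c d = corr4 a b d c.
  by apply: eq_bigr => x _; congr (_ * _); rewrite mulrC.
have sw12 a b c d : corr4 a b c d = corr4 b a c d.
  by apply: eq_bigr => x _; congr (_ * _); rewrite mulrC.
have cj a b c d : `|corr4 a b c d| = `|corr4 c d a b|.
  rewrite -[LHS]norm_conjC /corr4 rmorph_sum; congr `|_|; apply: eq_bigr => x _ /=.
  by rewrite !rmorphM /= !conjCK mulrC.
have triv : `|corr4 c1 c2 c3 c4| <= p%:R.
  apply: (le_trans (ler_norm_sum _ _ _)).
  rewrite -cardF -sum1_card natr_sum; apply: ler_sum => x _.
  by rewrite !normrM !norm_conjC !mulr_ile1 ?mulr_ge0 ?norm_chi_le1.
have dn (n : nat) : 0 <= p%:R * n%:R :> C by rewrite -natrM ler0n.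
have [u4|n4] := boolP [&& c4 != c1, c4 != c2 & c4 != c3].
  by case/and3P: u4 => ? ? ?; rewrite (le_trans (corr4_unique _ _ _)) // lerDl.
have [u3|n3] := boolP [&& c3 != c1, c3 != c2 & c3 != c4].
  by case/and3P: u3 => ? ? ?; rewrite sw34 (le_trans (corr4_unique _ _ _)) // lerDl.
have [u2|n2] := boolP [&& c2 != c1, c2 != c3 & c2 != c4].
  by case/and3P: u2 => ? ? ?; rewrite cj (le_trans (corr4_unique _ _ _)) // lerDl.
have [u1|n1] := boolP [&& c1 != c2, c1 != c3 & c1 != c4].
  by case/and3P: u1 => ? ? ?; rewrite sw12 cj (le_trans (corr4_unique _ _ _)) // lerDl.
apply: (le_trans triv); rewrite -[leLHS]add0r lerD // -natrM ler_nat leq_pmulr //.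
rewrite !addn_gt0 !lt0b; move: n1 n2 n3 n4; rewrite !negb_and !negbK.
by case/or3P=> /eqP e1; case/or3P=> /eqP e2; case/or3P=> /eqP e3; case/or3P=> /eqP e4;
  subst; rewrite ?eqxx ?andbT ?orbT.
Qed.

Variables (B : nat) (beta : 'I_B -> F).
Hypotheses (beta_inj : injective beta) (B0 : (0 < B)%N) (Bp : (p <= 16 * B ^ 4)%N).

(** The moment expands into B^4 correlations. The three pairings cost 3 B^2 p, and the bound 3 sqrt
    p on every quadruple costs 12 B^6, since sqrt p <= 4 B^2. The two balance for B near p^(1/4). *)
Lemma fourth_moment :
  \sum_x `|\sum_b chi (x + beta b)| ^+ 4 <= 3 * (B ^ 2)%:R * p%:R + 12 * (B ^ 6)%:R.
Proof.
pose E b1 b2 b3 b4 : C := corr4 (beta b1) (beta b2) (beta b3) (beta b4).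
have ge0_4 : 0 <= \sum_x `|\sum_b chi (x + beta b)| ^+ 4.
  by apply: sumr_ge0 => x _; rewrite exprn_ge0.
have E4 : \sum_x `|\sum_b chi (x + beta b)| ^+ 4 =
    \sum_b1 \sum_b2 \sum_b3 \sum_b4 E b1 b2 b3 b4.
  under [RHS]eq_bigr do under eq_bigr do under eq_bigr do rewrite /E /corr4 exchange_big.
  under [RHS]eq_bigr do under eq_bigr do rewrite exchange_big.
  under [RHS]eq_bigr do rewrite exchange_big.
  rewrite [RHS]exchange_big; apply: eq_bigr => x _.
  rewrite -[4%N]/(2 * 2)%N exprM normCK exprMn !expr2 !rmorph_sum /=.
  rewrite big_distrlr /= mulr_suml; apply: eq_bigr => b1 _; rewrite mulr_suml; apply: eq_bigr => b2 _.
  rewrite big_distrlr /= mulr_sumr; apply: eq_bigr => b3 _; rewrite mulr_sumr; apply: eq_bigr => b4 _.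
  by rewrite mulrA.
have delta (P : bool) (b0 : 'I_B) : (\sum_b (P && (b0 == b)) = P)%N.
  rewrite (bigD1 b0) //= eqxx andbT big1 ?addn0 // => b bb0.
  by rewrite eq_sym (negPf bb0) andbF.
have delta1 (b0 : 'I_B) : (\sum_b (b0 == b) = 1)%N by exact: (delta true).
have cardB (m : nat) : (\sum_(b < B) m = B * m)%N by rewrite sum_nat_const card_ord.
have bb (b b' : 'I_B) : (beta b == beta b') = (b == b') by apply: inj_eq.
have sqp : sqrtC p%:R <= 4 * (B ^ 2)%:R :> C.
  rewrite -(@ler_pXn2r _ 2) ?nnegrE ?sqrtC_ge0 ?mulr_ge0 ?ler0n // sqrtCK -natrM -natrX ler_nat.
  by apply: leq_trans Bp _; rewrite expnMn -expnM.
have count1 : (\sum_b1 \sum_b2 \sum_b3 \sum_b4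
    ((beta b1 == beta b2) && (beta b3 == beta b4)) = B ^ 2)%N.
  under eq_bigr => b1 _ do under eq_bigr => b2 _ do under eq_bigr => b3 _ do
    under eq_bigr => b4 _ do rewrite !bb.
  under eq_bigr => b1 _ do under eq_bigr => b2 _ do under eq_bigr => b3 _ do rewrite delta.
  under eq_bigr => b1 _ do under eq_bigr => b2 _ do rewrite cardB.
  under eq_bigr => b1 _ do rewrite -big_distrr /= delta1 muln1.
  by rewrite cardB mulnn.
have count2 : (\sum_b1 \sum_b2 \sum_b3 \sum_b4
    ((beta b1 == beta b3) && (beta b2 == beta b4)) = B ^ 2)%N.
  under eq_bigr => b1 _ do under eq_bigr => b2 _ do under eq_bigr => b3 _ do
    under eq_bigr => b4 _ do rewrite !bb.
  under eq_bigr => b1 _ do under eq_bigr => b2 _ do under eq_bigr => b3 _ do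
    rewrite delta -[(b1 == b3)]andTb.
  under eq_bigr => b1 _ do under eq_bigr => b2 _ do rewrite delta.
  by rewrite !cardB muln1 mulnn.
have count3 : (\sum_b1 \sum_b2 \sum_b3 \sum_b4
    ((beta b1 == beta b4) && (beta b2 == beta b3)) = B ^ 2)%N.
  under eq_bigr => b1 _ do under eq_bigr => b2 _ do under eq_bigr => b3 _ do
    under eq_bigr => b4 _ do rewrite !bb andbC.
  under eq_bigr => b1 _ do under eq_bigr => b2 _ do under eq_bigr => b3 _ do
    rewrite delta -[(b2 == b3)]andTb.
  under eq_bigr => b1 _ do under eq_bigr => b2 _ do rewrite delta.
  by rewrite !cardB muln1 mulnn.
rewrite -(ger0_norm ge0_4) E4 {E4 ge0_4}.
pose c b1 b2 b3 b4 := ((beta b1 == beta b2) && (beta b3 == beta b4)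
   + ((beta b1 == beta b3) && (beta b2 == beta b4)) + ((beta b1 == beta b4) && (beta b2 == beta b3)))%N.
apply: (@le_trans _ _ (\sum_b1 \sum_b2 \sum_b3 \sum_b4 (12 * (B ^ 2)%:R + p%:R * (c b1 b2 b3 b4)%:R))).
  apply: (le_trans (ler_norm_sum _ _ _)); apply: ler_sum => b1 _.
  apply: (le_trans (ler_norm_sum _ _ _)); apply: ler_sum => b2 _.
  apply: (le_trans (ler_norm_sum _ _ _)); apply: ler_sum => b3 _.
  apply: (le_trans (ler_norm_sum _ _ _)); apply: ler_sum => b4 _.
  apply: (le_trans (corr4_le _ _ _ _)); rewrite lerD // -[12]/((3 * 4)%:R) natrM -mulrA.
  by rewrite ler_wpM2l // ler0n.
have -> : \sum_b1 \sum_b2 \sum_b3 \sum_b4 (12 * (B ^ 2)%:R + p%:R * (c b1 b2 b3 b4)%:R) =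
   (\sum_(b1 < B) \sum_(b2 < B) \sum_(b3 < B) \sum_(b4 < B) (12 * B ^ 2))%:R
    + p%:R * (\sum_b1 \sum_b2 \sum_b3 \sum_b4 c b1 b2 b3 b4)%:R :> C.
  rewrite !natr_sum mulr_sumr -big_split; apply: eq_bigr => b1 _ /=.
  rewrite !natr_sum mulr_sumr -big_split; apply: eq_bigr => b2 _ /=.
  rewrite !natr_sum mulr_sumr -big_split; apply: eq_bigr => b3 _ /=.
  rewrite !natr_sum mulr_sumr -big_split; apply: eq_bigr => b4 _ /=.
  by rewrite natrM.
have -> : (\sum_b1 \sum_b2 \sum_b3 \sum_b4 c b1 b2 b3 b4 = 3 * B ^ 2)%N.
  rewrite /c; under eq_bigr => b1 _ do under eq_bigr => b2 _ do under eq_bigr => b3 _ do rewrite !big_split /=.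
  under eq_bigr => b1 _ do under eq_bigr => b2 _ do rewrite !big_split /=.
  under eq_bigr => b1 _ do rewrite !big_split /=.
  by rewrite !big_split /= count1 count2 count3; lia.
rewrite !cardB addrC; apply: lerD.
  by rewrite natrM mulrC.
by rewrite -natrM ler_nat; apply: eq_leq; rewrite !expnS !expn0; lia.
Qed.

(** No Weil bound enters: for distinct shifts, x + beta b' = 1 / u turns the correlation into the
    sum of chi(1 + d u) over nonzero u, which is -1. This gives p B + B^2, and B <= p. *)
Lemma second_moment : \sum_x `|\sum_b chi (x + beta b)| ^+ 2 <= 2 * (p * B)%:R.
Proof.
have off b b' : b != b' -> `|\sum_x chi (x + beta b) * (chi (x + beta b'))^*| <= 1.
  rewrite -(inj_eq beta_inj) => ne; set d := beta b - beta b'.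
  have d0 : d != 0 by rewrite subr_eq0.
  rewrite (reindex _ (onW_bij _ (inv_shift_bij (beta b')))) (bigD1 0) //=.
  rewrite invr0 sub0r addNr (chi0 chi_eq0) rmorph0 mulr0 add0r.
  have e u : u != 0 -> chi (u^-1 - beta b' + beta b) * (chi (u^-1 - beta b' + beta b'))^* = chi (1 + d * u).
    move=> u0; rewrite subrK (_ : u^-1 - _ + _ = u^-1 * (1 + d * u)); last by rewrite /d; field.
    by rewrite chiM mulrAC chi_neq0_mul_conj ?mul1r // invr_eq0.
  rewrite (eq_bigr _ (fun u u0 => e u u0)).
  have bij : bijective (fun u => 1 + d * u).
    exists (fun x => d^-1 * (x - 1)) => x; first by rewrite addrC addKr mulKf.
    by rewrite mulVKf // addrC subrK.
  have := sum_chi_eq0 chiM r0 chir; rewrite (reindex _ (onW_bij _ bij)) (bigD1 0) //=.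
  rewrite mulr0 addr0 (chi1 chiM chi_eq0) => /eqP; rewrite addrC addr_eq0 => /eqP ->.
  by rewrite normrN normr1.
have ge0 : 0 <= \sum_x `|\sum_b chi (x + beta b)| ^+ 2.
  by apply: sumr_ge0 => x _; rewrite exprn_ge0.
rewrite -(ger0_norm ge0).
have -> : \sum_x `|\sum_b chi (x + beta b)| ^+ 2 =
    \sum_b \sum_b' \sum_x chi (x + beta b) * (chi (x + beta b'))^*.
  under [RHS]eq_bigr do rewrite exchange_big.
  rewrite [RHS]exchange_big; apply: eq_bigr => x _ /=.
  by rewrite normCK rmorph_sum big_distrlr.
apply: (@le_trans _ _ (\sum_(b < B) ((p + B)%:R : C))).
  apply: (le_trans (ler_norm_sum _ _ _)); apply: ler_sum => b _.
  apply: (le_trans (ler_norm_sum _ _ _)).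
  rewrite (bigD1 b) //= natrD lerD //.
    apply: (le_trans (ler_norm_sum _ _ _)).
    rewrite -cardF -sum1_card natr_sum; apply: ler_sum => x _.
    by rewrite normrM norm_conjC mulr_ile1 ?norm_chi_le1.
  apply: (@le_trans _ _ (\sum_(b' < B | b' != b) (1 : C))).
    by apply: ler_sum => b' bb'; rewrite off // eq_sym.
  by rewrite sumr_const ler_nat -[leqRHS]card_ord max_card.
rewrite sumr_const card_ord -[_ *+ B]mulr_natr -!natrM ler_nat.
have BF : (B <= p)%N by rewrite -cardF -[B]card_ord; apply: leq_card beta_inj.
by rewrite mulnA leq_mul2r mul2n -addnn leq_add2l BF orbT.
Qed.

End Moments.

(** * Hoelder's inequality and the counting of congruences *)

Lemma cauchy_schwarz_sum (R : realDomainType) (I : finType) (u w : I -> R) :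
  (\sum_i u i * w i) ^+ 2 <= (\sum_i u i ^+ 2) * (\sum_i w i ^+ 2).
Proof.
rewrite -subr_ge0 -(pmulr_rge0 _ (ltr0n R 2)).
have -> : 2 * ((\sum_i u i ^+ 2) * (\sum_i w i ^+ 2) - (\sum_i u i * w i) ^+ 2) =
    \sum_i \sum_j (u i * w j - u j * w i) ^+ 2.
  have e1 : \sum_i \sum_j (u i ^+ 2 * w j ^+ 2) = (\sum_i u i ^+ 2) * (\sum_i w i ^+ 2).
    by rewrite big_distrlr.
  have e2 : \sum_i \sum_j (u j ^+ 2 * w i ^+ 2) = (\sum_i u i ^+ 2) * (\sum_i w i ^+ 2).
    by rewrite exchange_big big_distrlr.
  have e3 : \sum_i \sum_j ((u i * w i) * (u j * w j)) = (\sum_i u i * w i) ^+ 2.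
    by rewrite expr2 big_distrlr.
  rewrite mulrBr mulr2n mulrDl !mul1r -{1}e1 -e2 -e3 mulr_sumr -big_split -sumrB.
  apply: eq_bigr => i _ /=; rewrite mulr_sumr -big_split -sumrB.
  by apply: eq_bigr => j _ /=; ring.
by do 2![apply: sumr_ge0 => ? _]; rewrite sqr_ge0.
Qed.

(** Cauchy-Schwarz twice: over I, then over J after grouping the indices by their image. The squares
    of the multiplicities [v] add up to the number of coincidences of phi. *)
Lemma holder4_sum (R : realDomainType) (I J : finType) (phi : I -> J) (T : J -> R) :
  (forall x, 0 <= T x) ->
  (\sum_i T (phi i)) ^+ 4 <= #|I|%:R ^+ 2 *
    (#|[pred ij : I * I | phi ij.1 == phi ij.2]|%:R * \sum_x T x ^+ 4).
Proof.
move=> T0; pose v x : R := #|[pred i | phi i == x]|%:R.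
have reord (f : J -> R) : \sum_i f (phi i) = \sum_x v x * f x.
  rewrite (partition_big phi predT) //=; apply: eq_bigr => x _.
  by rewrite (eq_bigr (fun=> f x)) => [|i /eqP -> //]; rewrite sumr_const mulr_natl.
have -> : #|[pred ij : I * I | phi ij.1 == phi ij.2]|%:R = \sum_x v x ^+ 2.
  under eq_bigr do rewrite expr2.
  rewrite -reord /v -natr_sum; congr (_%:R).
  rewrite -sum1_card -(pair_big_dep predT (fun i j => phi i == phi j) (fun _ _ => 1%N)) /=.
  by apply: eq_bigr => i _; rewrite sum1_card; apply: eq_card => j; rewrite !inE eq_sym.
have h1 : (\sum_i T (phi i)) ^+ 2 <= #|I|%:R * \sum_i T (phi i) ^+ 2.
  have := cauchy_schwarz_sum (fun=> 1) (fun i => T (phi i)).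
  by under eq_bigr do rewrite mul1r; rewrite expr1n sumr_const.
rewrite -[4%N]/(2 * 2)%N exprM.
apply: (@le_trans _ _ ((#|I|%:R * \sum_i T (phi i) ^+ 2) ^+ 2)).
  by rewrite ler_pXn2r ?nnegrE ?sqr_ge0 // (le_trans _ h1) ?sqr_ge0.
rewrite exprMn ler_wpM2l ?sqr_ge0 // (reord (fun x => T x ^+ 2)).
apply: (le_trans (cauchy_schwarz_sum _ _)).
by under [X in _ * X]eq_bigr do rewrite -exprM.
Qed.

Lemma eqn_modMl_coprime (d k m n : nat) : coprime d k ->
  (k * m == k * n %[mod d])%N = (m == n %[mod d])%N.
Proof.
move=> dk; wlog nm : m n / (n <= m)%N => [H|].
  by case: (leqP n m) => [/H //|/ltnW/H e]; rewrite eq_sym e eq_sym.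
by rewrite !eqn_mod_dvd ?leq_mul2l ?nm ?orbT // -mulnBr Gauss_dvdr.
Qed.

(** Comparing two solutions eliminates m, and 2 A n <= p turns the resulting congruence into an
    equation between integers. It fixes the first coordinate modulo a1 / gcd(a1, a2), so the
    quotient by that number determines the solution. *)
Lemma card_residue_pairs (p n m a1 a2 A : nat) : (0 < a1)%N -> (a1 <= A)%N -> (0 < a2)%N -> (a2 <= A)%N ->
    (2 * (A * n) <= p)%N ->
  (#|[pred k : 'I_n * 'I_n | a1 * (m + k.2) == a2 * (m + k.1) %[mod p]]|
     <= (n %/ (a1 %/ gcdn a1 a2)).+1)%N.
Proof.
move=> a10 a1A a20 a2A Anp; set g := gcdn a1 a2; set al := (a1 %/ g)%N.
have g0 : (0 < g)%N by rewrite gcdn_gt0 a10.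
have al0 : (0 < al)%N by rewrite divn_gt0 // dvdn_leq // dvdn_gcdl.
have a1E : a1 = (al * g)%N by rewrite /al divnK // dvdn_gcdl.
have a2E : a2 = (a2 %/ g * g)%N by rewrite divnK // dvdn_gcdr.
have cop : coprime al (a2 %/ g).
  by rewrite /coprime -(eqn_pmul2r g0) mul1n muln_gcdl -a1E -a2E.
have bound (a : nat) (k : 'I_n) : (a <= A)%N -> (a * k <= A * n)%N.
  by move=> aA; rewrite leq_mul // ltnW.
have key (k l : 'I_n * 'I_n) : a1 * (m + k.2) = a2 * (m + k.1) %[mod p] ->
    a1 * (m + l.2) = a2 * (m + l.1) %[mod p] ->
    (a1 * k.2 + a2 * l.1 = a1 * l.2 + a2 * k.1)%N.
  move=> ek el.
  have e : (a1 * (m + k.2) + a2 * (m + l.1) = a1 * (m + l.2) + a2 * (m + k.1) %[mod p])%N.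
    by rewrite -modnDm ek -el modnDm addnC.
  have An0 : (0 < A * n)%N.
    by rewrite muln_gt0 (leq_trans a10 a1A) (leq_ltn_trans _ (ltn_ord k.1)).
  have lt (a : nat) (i : 'I_n) : (0 < a)%N -> (a <= A)%N -> (a * i < A * n)%N.
    move=> a0 aA; apply: (@leq_trans (a * n)); last by rewrite leq_mul2r aA orbT.
    by rewrite ltn_pmul2l.
  have s1 : (a1 * k.2 + a2 * l.1 < p)%N.
    by apply: leq_trans Anp; rewrite mul2n -addnn -addSn leq_add // ?lt // ltnW // lt.
  have s2 : (a1 * l.2 + a2 * k.1 < p)%N.
    by apply: leq_trans Anp; rewrite mul2n -addnn -addSn leq_add // ?lt // ltnW // lt.
  have q1 : (a1 * (m + k.2) + a2 * (m + l.1) = (a1 * m + a2 * m) + (a1 * k.2 + a2 * l.1))%N.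
    by rewrite !mulnDr addnACA.
  have q2 : (a1 * (m + l.2) + a2 * (m + k.1) = (a1 * m + a2 * m) + (a1 * l.2 + a2 * k.1))%N.
    by rewrite !mulnDr addnACA.
  by move: e; rewrite q1 q2 => /eqP; rewrite eqn_modDl (modn_small s1) (modn_small s2) => /eqP.
have inj : {in [pred k : 'I_n * 'I_n | a1 * (m + k.2) == a2 * (m + k.1) %[mod p]] &,
   injective (fun k : 'I_n * 'I_n => inord (k.1 %/ al) : 'I_(n %/ al).+1)}.
  move=> k l; rewrite !inE => /eqP ek /eqP el /(congr1 val) /=.
  rewrite !inordK ?ltnS ?leq_div2r ?(ltnW (ltn_ord _)) // => ed.
  have e : (al * k.2 + a2 %/ g * l.1 = al * l.2 + a2 %/ g * k.1)%N.
    apply/eqP; rewrite -(eqn_pmul2r g0) !mulnDl ![(_ * _ * g)%N]mulnAC -a1E -a2E.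
    by apply/eqP; exact: key.
  have e1 : k.1 = l.1.
    apply: val_inj; rewrite /= (divn_eq k.1 al) (divn_eq l.1 al) ed; congr (_ + _)%N.
    have : (a2 %/ g * l.1 == a2 %/ g * k.1 %[mod al])%N.
      have := congr1 (modn^~ al) e; rewrite /= ![(al * _)%N]mulnC !modnMDl => ->; exact: eqxx.
    by rewrite eqn_modMl_coprime // => /eqP.
  case: k l e e1 {ek el ed} => [k1 k2] [l1 l2] /= e e1; rewrite e1; congr (_, _).
  move: e; rewrite e1 => /addIn/eqP; rewrite eqn_pmul2l // => /eqP; exact: val_inj.
rewrite -(card_in_imset inj); apply: leq_trans (max_card _) _; by rewrite card_ord.
Qed.

Definition harm (R : fieldType) (n : nat) : R := \sum_(k < n) (k.+1%:R)^-1.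

Lemma harm_ge0 (R : realFieldType) n : 0 <= harm R n.
Proof. by apply: sumr_ge0 => k _; rewrite invr_ge0. Qed.

Lemma harm_ge1 (R : realFieldType) n : (0 < n)%N -> 1 <= harm R n.
Proof.
case: n => // n _; rewrite /harm big_ord_recl invr1 lerDl.
by apply: sumr_ge0 => k _; rewrite invr_ge0.
Qed.

Lemma harm_le (R : realFieldType) m n : (m <= n)%N -> harm R m <= harm R n.
Proof.
move=> mn; rewrite /harm -(subnKC mn) big_split_ord /= lerDl.
by apply: sumr_ge0 => k _; rewrite invr_ge0.
Qed.

Lemma sum_multiples_inv (R : realFieldType) (A g : nat) : (0 < g)%N ->
  \sum_(a < A | (g %| a.+1)%N) (a.+1%:R)^-1 <= harm R A / g%:R.
Proof.
move=> g0; apply: (@le_trans _ _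
   (\sum_(a < A) \sum_(c < A) (a.+1 == g * c.+1)%N%:R * ((c.+1%:R)^-1 / g%:R))).
  rewrite big_mkcond; apply: ler_sum => a _; case: ifP => ga; last first.
    by apply: sumr_ge0 => c _; rewrite mulr_ge0 // divr_ge0 ?invr_ge0.
  have [c e] := dvdnP ga.
  have c0 : (0 < c)%N by case: c e.
  have cA : (c.-1 < A)%N.
    apply: leq_ltn_trans (ltn_ord a); rewrite -ltnS prednK // e leq_pmulr //.
  rewrite (bigD1 (Ordinal cA)) //= prednK // e mulnC eqxx mul1r natrM invfM mulrC lerDl.
  by apply: sumr_ge0 => i _; rewrite mulr_ge0 // divr_ge0 ?invr_ge0.
rewrite exchange_big /harm mulr_suml; apply: ler_sum => c _ /=.
rewrite -mulr_suml -[leRHS]mul1r ler_wpM2r ?divr_ge0 ?invr_ge0 // -natr_sum lern1.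
case: (boolP [exists a : 'I_A, a.+1 == g * c.+1]%N) => [/existsP[a /eqP ea]|/existsPn H].
  rewrite (bigD1 a) //= ea eqxx big1 // => b ba.
  by rewrite -ea eqSS (negPf (_ : (b : nat) != a)).
by rewrite big1 // => a _; rewrite (negPf (H a)).
Qed.

Lemma sum_multiples_one (A g : nat) : (0 < g)%N ->
  (\sum_(a < A | (g %| a.+1)) 1 <= A %/ g)%N.
Proof.
move=> g0; have le : (g * (A %/ g) <= A)%N by rewrite mulnC leq_divM.
rewrite -[leqRHS](sum_dvdn g0 le) big_add1 big_mkord big_mkcond; apply: leq_sum => a _.
case: (boolP (g %| a.+1)%N) => //= ga.
by rewrite lt0b -(divnK ga) mulnC leq_mul2l leq_div2r ?orbT.
Qed.

(* gcd(a, b) is at most the sum of all common divisors of a and b. *)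
Lemma sum_gcd_div (R : realFieldType) (A : nat) :
  \sum_(a < A) \sum_(b < A) (gcdn a.+1 b.+1)%:R / a.+1%:R <= A%:R * harm R A ^+ 2.
Proof.
pose i (g a : 'I_A) : R := (g.+1 %| a.+1)%N%:R.
have i0 g a : 0 <= i g a by rewrite ler0n.
apply: (@le_trans _ _ (\sum_(a < A) \sum_(b < A) \sum_(g < A) i g a * i g b * (g.+1%:R / a.+1%:R))).
  apply: ler_sum => a _; apply: ler_sum => b _.
  have g0 : (0 < gcdn a.+1 b.+1)%N by rewrite gcdn_gt0.
  have gA : ((gcdn a.+1 b.+1).-1 < A)%N.
    by apply: leq_ltn_trans (ltn_ord a); rewrite -ltnS prednK // dvdn_leq // dvdn_gcdl.
  rewrite (bigD1 (Ordinal gA)) //= /i /= prednK // dvdn_gcdl dvdn_gcdr !mul1r lerDl.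
  by apply: sumr_ge0 => g _; rewrite !mulr_ge0 ?invr_ge0.
under eq_bigr do rewrite exchange_big.
rewrite exchange_big /= expr2 mulrCA mulr_suml; apply: ler_sum => g _.
have -> : \sum_a \sum_b i g a * i g b * (g.+1%:R / a.+1%:R) =
    g.+1%:R * ((\sum_a i g a * (a.+1%:R)^-1) * (\sum_b i g b)).
  rewrite big_distrlr mulr_sumr; apply: eq_bigr => a _; rewrite mulr_sumr.
  by apply: eq_bigr => b _ /=; ring.
have g0 : 0 < g.+1%:R :> R by rewrite ltr0n.
have h1 : \sum_a i g a * (a.+1%:R)^-1 <= harm R A / g.+1%:R.
  apply: le_trans (sum_multiples_inv R A (ltn0Sn g)); rewrite [leRHS]big_mkcond.
  by apply: ler_sum => a _; rewrite /i; case: ifP => _; rewrite ?mul1r ?mul0r.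
have h2 : \sum_b i g b <= A%:R / g.+1%:R.
  rewrite ler_pdivlMr // -natr_sum -natrM ler_nat.
  apply: (@leq_trans (A %/ g.+1 * g.+1)); last exact: leq_divM.
  rewrite leq_mul2r /=; apply: leq_trans (sum_multiples_one A (ltn0Sn g)).
  by rewrite [leqRHS]big_mkcond leq_sum // => b _; case: ifP.
apply: (le_trans (ler_wpM2l (ltW g0) (ler_pM _ _ h1 h2))).
- by apply: sumr_ge0 => a _; rewrite mulr_ge0 ?invr_ge0.
- by apply: sumr_ge0.
rewrite le_eqVlt; apply/orP; left; apply/eqP; field.
by rewrite addrC natr1 pnatr_eq0.
Qed.

Local Open Scope complex_scope.

(** * Burgess' bound *)

Section ComplexNorm.
Variable R : realType.
Local Notation normc := (@Normc.normc R).
Implicit Types z : R[i].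

Lemma normr_complex z : `|z| = (normc z)%:C. Proof. by []. Qed.

Lemma le_normc z (x : R) : (normc z <= x) = (`|z| <= x%:C).
Proof. by rewrite normr_complex lecR. Qed.

Lemma normc_ge0 z : 0 <= normc z.
Proof. by rewrite -lecR -normr_complex normr_ge0. Qed.

Lemma normc_real (x : R) : normc x%:C = `|x|.
Proof. by rewrite /= expr0n addr0 sqrtr_sqr. Qed.

Lemma normc_im (x : R) : normc (0 +i* x) = `|x|.
Proof. by rewrite /= expr0n add0r sqrtr_sqr. Qed.

Lemma normc_Re z : `|complex.Re z| <= normc z.
Proof.
case: z => x y /=; rewrite -sqrtr_sqr ler_wsqrtr // lerDl sqr_ge0 //.
Qed.

Lemma normc_Im z : `|complex.Im z| <= normc z.
Proof.
case: z => x y /=; rewrite -sqrtr_sqr ler_wsqrtr // lerDr sqr_ge0 //.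
Qed.

Lemma normc_le_ReIm z : normc z <= `|complex.Re z| + `|complex.Im z|.
Proof.
case: z => x y; have -> : x +i* y = x%:C + (0 +i* y) by simpc.
by rewrite (le_trans (le_normcD _ _)) // normc_real normc_im /= add0r addr0.
Qed.

Lemma normc_sub z w : normc (z - w) = normc (w - z).
Proof. by rewrite -opprB normcN. Qed.

Lemma complex_archi (x : R[i]) : 0 <= x -> exists n : nat, x < n%:R.
Proof.
move=> x0; have e : x = (normc x)%:C by rewrite -normr_complex ger0_norm.
exists (Num.bound (normc x)); rewrite [X in X < _]e -(rmorph_nat (real_complex R)) ltcR.
exact: archi_boundP (normc_ge0 x).
Qed.

Lemma normc_sum (I : Type) (r : seq I) (P : pred I) (f : I -> R[i]) :
  normc (\sum_(i <- r | P i) f i) <= \sum_(i <- r | P i) normc (f i).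
Proof.
elim/big_ind2: _ => [|x1 x2 y1 y2 h1 h2|//]; first by rewrite Normc.normc0.
by apply: (le_trans (le_normcD _ _)); apply: lerD.
Qed.

End ComplexNorm.

(** The quotient (m + k) / a, with a running from 1 to A. As chi(m + k + a b) = chi(a) chi((m + k) /
    a + b), shifts by a b lead to short sums at this point. *)
Definition frac (F : fieldType) (A n m : nat) (i : 'I_A * 'I_n) : F :=
  (m + i.2)%:R / i.1.+1%:R.

Section Coincidences.
Variables (F : fieldType) (p : nat) (pF : p \in [pchar F]).
Let p_pr := pcharf_prime pF.

Lemma eqr_nat_mod (x y : nat) : (x%:R == y%:R :> F) = (x == y %[mod p])%N.
Proof.
wlog xy : x y / (y <= x)%N => [H|].
  by case: (leqP y x) => [/H //|/ltnW/H e]; rewrite eq_sym e eq_sym.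
by rewrite eqn_mod_dvd // (dvdn_pcharf pF) natrB // subr_eq0.
Qed.

Lemma natF_neq0 a : (0 < a)%N -> (a < p)%N -> a%:R != 0 :> F.
Proof. by move=> a0 ap; rewrite -(dvdn_pcharf pF) gtnNdvd. Qed.

(** For given denominators a and b, the coincidences are solutions of a congruence, at most 1 + n
    gcd(a, b) / a of them. The summand 1 gives A^2, the rest the gcd sum. *)
Lemma card_coincidences (R : realFieldType) (A n m : nat) : (A < p)%N -> (2 * (A * n) <= p)%N ->
  #|[pred ij : ('I_A * 'I_n) * ('I_A * 'I_n) | frac F m ij.1 == frac F m ij.2]|%:R
    <= A%:R ^+ 2 + n%:R * (A%:R * harm R A ^+ 2).
Proof.
move=> Ap Anp; set phi := frac F m.
apply: (@le_trans _ _ (\sum_(a < A) \sum_(b < A) (1 + n%:R * ((gcdn a.+1 b.+1)%:R / a.+1%:R)))); last first.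
  under eq_bigr do rewrite big_split /= -mulr_sumr sumr_const card_ord.
  rewrite big_split /= -mulr_sumr sumr_const card_ord -mulrnA natrM -expr2 lerD //.
  by rewrite ler_wpM2l // sum_gcd_div.
have -> : #|[pred ij : ('I_A * 'I_n) * ('I_A * 'I_n) | phi ij.1 == phi ij.2]| =
    (\sum_(a < A) \sum_(b < A) #|[pred k : 'I_n * 'I_n | phi (a, k.1) == phi (b, k.2)]|)%N.
  rewrite -sum1_card big_mkcond /= -(pair_bigA _ (fun i j => if phi i == phi j then 1 else 0)%N) /=.
  rewrite -(pair_bigA _ (fun a k => \sum_j (if phi (a, k) == phi j then 1 else 0))%N) /=.
  apply: eq_bigr => a _.
  under eq_bigr => k _ do rewrite -(pair_bigA _ (fun b l => (if phi (a, k) == phi (b, l) then 1 else 0))%N) /=.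
  rewrite exchange_big; apply: eq_bigr => b _ /=.
  by rewrite pair_bigA /= -big_mkcond sum1_card.
rewrite natr_sum; apply: ler_sum => a _; rewrite natr_sum; apply: ler_sum => b _.
have -> : #|[pred k : 'I_n * 'I_n | phi (a, k.1) == phi (b, k.2)]| =
   #|[pred k : 'I_n * 'I_n | a.+1 * (m + k.2) == b.+1 * (m + k.1) %[mod p]]%N|.
  apply: eq_card => k; rewrite !inE /phi /frac /= -eqr_nat_mod !natrM.
  by rewrite eqr_div ?natF_neq0 ?(leq_ltn_trans _ Ap) // eq_sym ![_ * (m + _)%:R]mulrC.
have cr := card_residue_pairs m (ltn0Sn a) (ltn_ord a) (ltn0Sn b) (ltn_ord b) Anp.
apply: (@le_trans _ _ (n %/ (a.+1 %/ gcdn a.+1 b.+1)).+1%:R); first by rewrite ler_nat.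
have g0 : (0 < gcdn a.+1 b.+1)%N by rewrite gcdn_gt0.
rewrite -natr1 addrC lerD2l mulrA ler_pdivlMr ?ltr0n // -!natrM ler_nat.
have e : (a.+1 = a.+1 %/ gcdn a.+1 b.+1 * gcdn a.+1 b.+1)%N by rewrite divnK // dvdn_gcdl.
rewrite [X in (_ * X <= _)%N]e mulnA leq_mul2r leq_divM orbT //.
Qed.

End Coincidences.

Lemma sum_injective_le (R : realDomainType) (I J : finType) (h : I -> J) (f : J -> R) :
  injective h -> (forall j, 0 <= f j) -> \sum_i f (h i) <= \sum_j f j.
Proof.
move=> inj f0; rewrite [leRHS](bigID (mem (h @: [set: I]))) /=.
rewrite big_imset /=; last by move=> i j _ _; exact: inj.
rewrite [X in _ <= X + _](eq_bigl predT) => [|i]; last by rewrite inE.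
by rewrite lerDl sumr_ge0.
Qed.

Section Burgess.
Variables (R : realType).
Local Notation normc := (@Normc.normc R).
Variables (F : finFieldType) (p : nat) (p_pr : prime p) (cardF : #|F| = p) (p2 : (2 < p)%N).
Variables (chi : F -> R[i]).
Hypothesis chiM : forall a b, chi (a * b) = chi a * chi b.
Hypothesis chi_eq0 : forall a, (chi a == 0) = (a == 0).
Variable r : F.
Hypotheses (r0 : r != 0) (chir : chi r != 1).

Let pF : p \in [pchar F]. Proof. by apply: (card_finPcharP (n := 1)); rewrite ?expn1. Qed.

Definition chisum (m n : nat) : R := normc (\sum_(k < n) chi (m + k)%:R).

Definition shortsum B (x : F) : R := normc (\sum_(b < B) chi (x + b.+1%:R)).

(** A shift by h changes the sum only by two end pieces of length h, each at most E. This is added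
    up over the A B shifts h = a b, and [chi a] is taken out with absolute value 1, a being
    invertible as A < p. *)
Lemma shift_inequality (A B m n : nat) (E : R) : (A < p)%N ->
    (forall m' h, (h <= A * B)%N -> chisum m' h <= E) ->
  (A * B)%:R * chisum m n <=
    \sum_(i : 'I_A * 'I_n) shortsum B (frac F m i) + (A * B)%:R * (2 * E).
Proof.
move=> Ap hE.
pose s m n := \sum_(k < n) chi (m + k)%:R.
have sD m' n1 n2 : s m' (n1 + n2)%N = s m' n1 + s (m' + n1)%N n2.
  rewrite /s big_split_ord /=; congr (_ + _); apply: eq_bigr => k _; by rewrite addnA.
have shift h : s m n = s (m + h)%N n + (s m h - s (m + n)%N h).
  have e : s m n + s (m + n)%N h = s m h + s (m + h)%N n by rewrite -!sD addnC.
  by rewrite addrA [s (m + h)%N n + _]addrC -e addrK.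
have ab0 (a : 'I_A) (b : 'I_B) : (a.+1 * b.+1 <= A * B)%N by rewrite leq_mul.
have key : (A * B)%:R * s m n = \sum_(a < A) \sum_(b < B) s (m + a.+1 * b.+1)%N n +
   \sum_(a < A) \sum_(b < B) (s m (a.+1 * b.+1)%N - s (m + n)%N (a.+1 * b.+1)%N).
  rewrite -big_split /= (eq_bigr (fun=> B%:R * s m n)) => [|a _].
    by rewrite sumr_const card_ord -[RHS]mulr_natl mulrA -natrM.
  rewrite -big_split /= (eq_bigr (fun=> s m n)) => [|b _].
    by rewrite sumr_const card_ord mulr_natl.
  by rewrite -shift.
have nE (c : nat) z : c%:R * normc z = normc (c%:R * z).
  by rewrite Normc.normcM -(rmorph_nat (real_complex R)) /= expr0n /= addr0 sqrtr_sqr normr_nat.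
have sumconst (q : nat) (y : R) : \sum_(i < q) y = q%:R * y.
  by rewrite sumr_const card_ord mulr_natl.
rewrite /chisum -/(s m n) nE key.
apply: (le_trans (le_normcD _ _)); apply: lerD; last first.
  apply: (le_trans (normc_sum _ _ _)).
  rewrite natrM -mulrA -(sumconst A); apply: ler_sum => a _.
  apply: (le_trans (normc_sum _ _ _)).
  rewrite -(sumconst B); apply: ler_sum => b _.
  apply: (le_trans (le_normcD _ _)); rewrite mulr2n mulrDl !mul1r; apply: lerD; first exact: hE.
  by rewrite normcN; exact: hE.
have -> : \sum_(a < A) \sum_(b < B) s (m + a.+1 * b.+1)%N n =
    \sum_(i : 'I_A * 'I_n) \sum_(b < B) chi (m + i.1.+1 * b.+1 + i.2)%:R.
  rewrite -(pair_bigA _ (fun (a : 'I_A) (k : 'I_n) => \sum_(b < B) chi (m + a.+1 * b.+1 + k)%:R)) /=.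
  by apply: eq_bigr => a _; rewrite exchange_big.
apply: (le_trans (normc_sum _ _ _)); apply: ler_sum => -[a k] _ /=.
have a0 : (a.+1)%:R != 0 :> F by rewrite (natF_neq0 pF) // (leq_ltn_trans (ltn_ord a)).
have nchi1 : normc (chi (a.+1)%:R) = 1.
  by apply: complexI; rewrite -normr_complex (norm_chi p_pr cardF chiM chi_eq0).
rewrite -[leRHS]mul1r -nchi1 /shortsum -Normc.normcM mulr_sumr le_eqVlt; apply/orP; left; apply/eqP.
congr normc; apply: eq_bigr => b _; rewrite -chiM; congr chi.
by rewrite /frac /= mulrDr mulrCA mulfV // mulr1 !natrD natrM; ring.
Qed.

Variables (B : nat) (B0 : (0 < B)%N) (Bp : (B ^ 4 <= p)%N) (pB : (p <= 16 * B ^ 4)%N).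

Lemma shortsum_ge0 b x : 0 <= shortsum b x. Proof. exact: normc_ge0. Qed.

Lemma beta_inj b : (b < p)%N -> injective (fun i : 'I_b => (i.+1)%:R : F).
Proof.
move=> bp i j /eqP; rewrite (eqr_nat_mod pF) !modn_small ?(leq_ltn_trans (ltn_ord _) bp) //.
by rewrite eqSS => /eqP; exact: val_inj.
Qed.

Lemma shortsum_fourth_moment : \sum_x shortsum B x ^+ 4 <= (60 * B ^ 6)%:R.
Proof.
have Bltp : (B < p)%N.
  case: (leqP B 1) => B1; first by apply: leq_ltn_trans B1 _; apply: ltn_trans p2.
  apply: leq_trans Bp; rewrite -{1}(expn1 B) ltn_exp2l //.
rewrite -lecR rmorph_sum /=; under eq_bigr do rewrite rmorphXn /=.
apply: (le_trans (fourth_moment p_pr cardF p2 (@complex_archi R) chiM chi_eq0 r0 chir (beta_inj Bltp) B0 pB)).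
rewrite rmorph_nat -!natrM -natrD ler_nat.
(* 3 B^2 p <= 48 B^6, and 60 = 48 + 12. *)
have := leq_mul (leqnn (3 * B ^ 2)%N) pB; rewrite !expnS !expn0; lia.
Qed.

Lemma shortsum_second_moment b : (b < p)%N -> \sum_x shortsum b x ^+ 2 <= (2 * (p * b))%:R.
Proof.
move=> bp; rewrite -lecR rmorph_sum /=; under eq_bigr do rewrite rmorphXn /=.
apply: (le_trans (second_moment p_pr cardF chiM chi_eq0 r0 chir (beta_inj bp))).
by rewrite rmorph_nat -natrM.
Qed.

Local Notation H := (harm R p).

(** The factor 2^24 is what [main_term_high] uses: 2^2 from the second moment, 2^8 from p <= 16 B^4,
    2^10 from n <= 32 b and 2^4 from halving [X n]. *)
Variables (Y : R) (Y0 : 0 <= Y) (Y4 : Y ^+ 4 = 2 ^+ 24 * (B ^ 3)%:R * H ^+ 2).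

Let X n := Y * Num.sqrt n%:R.

Lemma X_ge0 n : 0 <= X n. Proof. by rewrite mulr_ge0 ?sqrtr_ge0. Qed.

Lemma X4 n : X n ^+ 4 = 2 ^+ 24 * (B ^ 3)%:R * H ^+ 2 * n%:R ^+ 2.
Proof.
by rewrite exprMn Y4 (_ : Num.sqrt n%:R ^+ 4 = n%:R ^+ 2) // -[4%N]/(2 * 2)%N exprM sqr_sqrtr.
Qed.

(** The two end pieces of length at most n / 16 thus cost X n / 2 together, which leaves X n / 2 to
    the main term. *)
Lemma X_quarter h n : (16 * h <= n)%N -> X h <= X n / 4.
Proof.
move=> hn; rewrite -mulrA ler_wpM2l // ler_pdivlMr //.
rewrite -(@ler_pXn2r _ 2) ?nnegrE ?mulr_ge0 ?sqrtr_ge0 // exprMn !sqr_sqrtr //.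
by rewrite -natrX -natrM ler_nat mulnC.
Qed.

Lemma H_ge1 : 1 <= H. Proof. by rewrite harm_ge1 ?prime_gt0. Qed.

(** [holder4_sum] with the fourth moment. As 16 A B <= n, the condition n^2 <= B^5 keeps 16 A n
    below B^4 <= p, as the count of coincidences demands. *)
Lemma main_term_mid A n m : (0 < A)%N -> (16 * A * B <= n)%N -> (n <= 32 * A * B)%N -> (n ^ 2 <= B ^ 5)%N ->
  \sum_(i : 'I_A * 'I_n) shortsum B (frac F m i) <= (A * B)%:R * (X n / 2).
Proof.
move=> A0 An nA nB; have n0 : (0 < n)%N by apply: leq_trans An; rewrite !muln_gt0 A0 B0.
have nonneg : 0 <= \sum_(i : 'I_A * 'I_n) shortsum B (frac F m i).
  by apply: sumr_ge0 => i _; exact: shortsum_ge0.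
have Anp : (16 * (A * n) <= B ^ 4)%N.
  rewrite -(leq_pmul2r B0) -expnSr; apply: leq_trans nB.
  by rewrite -mulnn; have := leq_mul An (leqnn n); lia.
have Ap : (A < p)%N.
  apply: leq_trans Bp; apply: leq_trans Anp; nia.
have A2n : (2 * (A * n) <= p)%N by apply: leq_trans Bp; apply: leq_trans Anp; rewrite leq_mul2r orbT.
rewrite -(@ler_pXn2r _ 4) ?nnegrE ?mulr_ge0 ?sqrtr_ge0 ?invr_ge0 //.
apply: (le_trans (holder4_sum _ (shortsum_ge0 B))).
rewrite card_prod !card_ord.
have co := card_coincidences pF R m Ap A2n.
have HA : harm R A ^+ 2 <= H ^+ 2.
  by rewrite ler_pXn2r ?nnegrE ?harm_ge0 // harm_le // ltnW.
have H1 : 1 <= H ^+ 2 by rewrite expr_ge1 // ?H_ge1 // (le_trans ler01 H_ge1).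
(* A <= n and H >= 1, so each of the two terms of the coincidence count is at most n A H^2. *)
apply: (@le_trans _ _ ((A * n)%:R ^+ 2 * ((2 * (n * A)%:R * H ^+ 2) * (60 * B ^ 6)%:R))).
  rewrite ler_wpM2l ?sqr_ge0 //; apply: ler_pM => //; last exact: shortsum_fourth_moment.
    by apply: sumr_ge0 => x _; rewrite exprn_ge0 // shortsum_ge0.
  apply: (le_trans co); rewrite (_ : 2 * (n * A)%:R * H ^+ 2 = (n * A)%:R * H ^+ 2 + (n * A)%:R * H ^+ 2); last by ring.
  apply: lerD; last by rewrite natrM -mulrA !ler_wpM2l.
  rewrite -[leLHS]mulr1; apply: ler_pM => //; rewrite ?sqr_ge0 // -natrX ler_nat -mulnn leq_mul2r.
  apply/orP; right; apply: leq_trans An; by rewrite -mulnA mulnCA leq_pmulr // muln_gt0 B0.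
rewrite [leRHS]exprMn [(X n / 2) ^+ 4]exprMn X4.
have -> : (2^-1) ^+ 4 = 16^-1 :> R by rewrite exprVn -natrX.
rewrite !(natrX, natrM).
have nr : n%:R <= 32 * A%:R * B%:R :> R by rewrite -!natrM ler_nat.
have -> : (A%:R * n%:R) ^+ 2 * (2 * (n%:R * A%:R) * H ^+ 2 * (60 * B%:R ^+ 6)) =
   (120 * H ^+ 2 * A%:R ^+ 3 * n%:R ^+ 2 * B%:R ^+ 6) * n%:R :> R by ring.
apply: (@le_trans _ _ ((120 * H ^+ 2 * A%:R ^+ 3 * n%:R ^+ 2 * B%:R ^+ 6) * (32 * A%:R * B%:R))).
  by rewrite ler_wpM2l // !mulr_ge0 // ?exprn_ge0 ?harm_ge0.
rewrite -subr_ge0.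
have -> : (A%:R * B%:R) ^+ 4 * (2 ^+ 24 * B%:R ^+ 3 * H ^+ 2 * n%:R ^+ 2 / 16) -
  120 * H ^+ 2 * A%:R ^+ 3 * n%:R ^+ 2 * B%:R ^+ 6 * (32 * A%:R * B%:R) =
  (2 ^+ 20 - 3840) * (H ^+ 2 * A%:R ^+ 4 * n%:R ^+ 2 * B%:R ^+ 7) :> R by field.
have c : 0 <= 2 ^+ 20 - 3840 :> R.
  by rewrite subr_ge0 -natrX ler_nat (@leq_trans (2 ^ 12)) // leq_pexp2l.
by apply: (mulr_ge0 c); rewrite !mulr_ge0 ?exprn_ge0 ?harm_ge0.
Qed.

(** With 1 as the only denominator the points are distinct, so Cauchy-Schwarz and the second moment
    bound the square by 2 n p b. After division by b this is of order sqrt p, which [X n] dominates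
    once n^2 >= B^5. *)
Lemma main_term_high n m b : (0 < b)%N -> (n <= p)%N -> (16 * b <= n)%N -> (n <= 32 * b)%N -> (B ^ 5 <= n ^ 2)%N ->
  \sum_(i : 'I_1 * 'I_n) shortsum b (frac F m i) <= b%:R * (X n / 2).
Proof.
move=> b0 np bn nb nB; have n0 : (0 < n)%N by lia.
have nonneg : 0 <= \sum_(i : 'I_1 * 'I_n) shortsum b (frac F m i).
  by apply: sumr_ge0 => i _; exact: shortsum_ge0.
have bp : (b < p)%N by lia.
rewrite -(@ler_pXn2r _ 4) ?nnegrE ?mulr_ge0 ?sqrtr_ge0 ?invr_ge0 //.
have sq : (\sum_(i : 'I_1 * 'I_n) shortsum b (frac F m i)) ^+ 2 <= (n * (2 * (p * b)))%:R.
  have := cauchy_schwarz_sum (fun=> 1) (fun i : 'I_1 * 'I_n => shortsum b (frac F m i)).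
  under eq_bigr do rewrite mul1r; rewrite expr1n sumr_const card_prod !card_ord mul1n => h.
  apply: (le_trans h); rewrite natrM ler_wpM2l //.
  apply: le_trans (shortsum_second_moment bp).
  have inj : injective (fun i : 'I_1 * 'I_n => frac F m i).
    move=> [i1 i2] [j1 j2]; rewrite /frac !ord1 /= !divr1 => /eqP.
    rewrite (eqr_nat_mod pF) eqn_modDl !modn_small ?(leq_trans (ltn_ord _) np) // => /eqP e.
    by congr (_, _); apply: val_inj.
  by apply: (sum_injective_le inj) => x; rewrite sqr_ge0.
rewrite -[4%N]/(2 * 2)%N exprM; apply: (@le_trans _ _ ((n * (2 * (p * b)))%:R ^+ 2)).
  by rewrite ler_pXn2r ?nnegrE ?sqr_ge0.
rewrite -[(2 * 2)%N]/4%N exprMn [(X n / 2) ^+ 4]exprMn X4.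
have -> : (2^-1) ^+ 4 = 16^-1 :> R by rewrite exprVn -natrX.
have H1 : 1 <= H ^+ 2 by rewrite expr_ge1 // ?H_ge1 // (le_trans ler01 H_ge1).
apply: (@le_trans _ _ (b%:R ^+ 4 * (2 ^+ 24 * (B ^ 3)%:R * 1 * n%:R ^+ 2 / 16))); last first.
  rewrite ler_wpM2l ?exprn_ge0 // ler_wpM2r ?invr_ge0 // ler_wpM2r ?sqr_ge0 //.
  by rewrite ler_wpM2l ?mulr_ge0 ?exprn_ge0.
have -> : b%:R ^+ 4 * (2 ^+ 24 * (B ^ 3)%:R * 1 * n%:R ^+ 2 / 16) = (b ^ 4 * (2 ^ 20 * B ^ 3 * n ^ 2))%:R :> R.
  by rewrite !(natrX, natrM); field.
rewrite -natrX ler_nat.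
have h1 : (p ^ 2 <= 256 * B ^ 8)%N.
  by rewrite (_ : 256 * B ^ 8 = (16 * B ^ 4) ^ 2)%N ?leq_exp2r // expnMn -expnM.
have h2 : (B ^ 5 <= 1024 * b ^ 2)%N.
  by apply: leq_trans nB _; rewrite (_ : 1024 * b ^ 2 = (32 * b) ^ 2)%N ?leq_exp2r // expnMn.
have -> : ((n * (2 * (p * b))) ^ 2 = n ^ 2 * (4 * (p ^ 2 * b ^ 2)))%N by rewrite !expnMn.
have -> : (b ^ 4 = b ^ 2 * b ^ 2)%N by rewrite -expnD.
have h3 : (B ^ 8 = B ^ 3 * B ^ 5)%N by rewrite -expnD.
have h4 : (2 ^ 20 = 2 ^ 10 * 2 ^ 10)%N by rewrite -expnD.
have h5 : (2 ^ 10 = 1024)%N by [].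
rewrite h4 h5; rewrite h3 in h1; clear h3 h4 h5.
move: (n ^ 2)%N (b ^ 2)%N (B ^ 3)%N (B ^ 5)%N (p ^ 2)%N h1 h2 => x y z w q h1 h2.
rewrite [(y * y * _)%N](_ : _ = x * (4 * ((256 * (z * (1024 * y))) * y)))%N; last by lia.
by rewrite !leq_mul // (leq_trans h1) // !leq_mul.
Qed.

(* Lengths below 64 B are trivial.  For n^2 <= B^5 shift by the products a b with
   a <= A = n / (16 B) and b <= B and use the fourth moment; beyond, shift by
   b <= n / 16 only and use the second moment. *)
Theorem burgess n m : (n <= p)%N -> chisum m n <= X n.
Proof.
elim/ltn_ind: n m => n IH m np.
have [n0|n0] := posnP n.
  by rewrite n0 /chisum big_ord0 Normc.normc0 X_ge0.
have triv : chisum m n <= n%:R.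
  apply: (le_trans (normc_sum _ _ _)).
  rewrite -[leRHS]mul1r mulr_natr -[X in _ *+ X]card_ord -sumr_const; apply: ler_sum => k _.
  by rewrite le_normc rmorph1 (norm_chi_le1 p_pr cardF chiM chi_eq0).
have [low|high] := leqP n (64 * B).
  apply: (le_trans triv); rewrite -(@ler_pXn2r _ 4) ?nnegrE ?mulr_ge0 ?sqrtr_ge0 //.
  rewrite X4 -[4%N]/(2 + 2)%N exprD ler_wpM2r ?sqr_ge0 //.
  have H1 : 1 <= H ^+ 2 by rewrite expr_ge1 // ?H_ge1 // (le_trans ler01 H_ge1).
  apply: (@le_trans _ _ (2 ^+ 24 * (B ^ 3)%:R * 1)); last by rewrite ler_wpM2l ?mulr_ge0 ?exprn_ge0.
  rewrite mulr1 -!natrX -natrM ler_nat.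
  apply: (@leq_trans ((64 * B) ^ 2)); first by rewrite leq_exp2r.
  rewrite expnMn leq_mul // ?leq_pexp2l // (_ : 64 = 2 ^ 6)%N // -expnM leq_pexp2l //.
(* Common to both ranges: the end pieces have length at most n / 16, so the induction hypothesis
   applies to them. *)
have step A b : (0 < A)%N -> (0 < b)%N -> (16 * (A * b) <= n)%N ->
    \sum_(i : 'I_A * 'I_n) shortsum b (frac F m i) <= (A * b)%:R * (X n / 2) ->
    chisum m n <= X n.
  move=> A0 b0 Ab main.
  have Ab0 : (0 < A * b)%N by rewrite muln_gt0 A0.
  have Ap : (A < p)%N.
    apply: leq_trans np; apply: leq_trans Ab; rewrite mulnCA -[X in (X < _)%N]muln1 ltn_pmul2l //.
    by apply: (@leq_trans 16); rewrite // leq_pmulr.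
  have err m' h : (h <= A * b)%N -> chisum m' h <= X n / 4.
    move=> hAb; have hn : (16 * h <= n)%N by apply: leq_trans Ab; rewrite leq_mul2l hAb orbT.
    apply: le_trans (X_quarter hn); apply: IH; last by apply: leq_trans np; lia.
    by lia.
  have := le_trans (shift_inequality m n Ap err) (lerD main (lexx _)).
  rewrite -mulrDr ler_pM2l ?ltr0n // => h; apply: (le_trans h).
  by rewrite le_eqVlt; apply/orP; left; apply/eqP; field.
have [mid|hi] := leqP (n ^ 2) (B ^ 5).
  pose A := (n %/ (16 * B))%N.
  have B16 : (0 < 16 * B)%N by rewrite muln_gt0 B0.
  have A0 : (0 < A)%N by rewrite divn_gt0 //; lia.
  have An : (16 * A * B <= n)%N by rewrite [(16 * A)%N]mulnC -mulnA leq_divM.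
  apply: (step A B) => //; first by rewrite mulnA.
  apply: main_term_mid => //.
  have := ltn_ceil n B16; rewrite -/A; have := leq_pmull (16 * B) A0; lia.
pose b := (n %/ 16)%N.
have b0 : (0 < b)%N by rewrite divn_gt0 //; lia.
have bn : (16 * b <= n)%N by rewrite mulnC leq_divM.
apply: (step 1%N b) => //; first by rewrite mul1n.
rewrite mul1n; apply: main_term_high => //; last exact: ltnW.
by have := ltn_ceil n (isT : (0 < 16)%N); rewrite -/b; lia.
Qed.

End Burgess.

Local Open Scope classical_set_scope.
Local Open Scope ring_scope.
Local Open Scope complex_scope.

(** * Complex line integrals *)

Section RealIntegral.
Variable R : realType.
Implicit Types (f g : R -> R) (a b : R).

Definition ri f a b : R := \int[lebesgue_measure]_(t in `[a, b]) f t.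

Lemma ri_integrable f a b : {within `[a, b], continuous f} ->
  lebesgue_measure.-integrable `[a, b] (EFin \o f).
Proof. by move=> cf; apply: continuous_compact_integrable => //; exact: segment_compact. Qed.

Lemma within_sub f a b c d : {within `[a, b], continuous f} -> a <= c -> d <= b ->
  {within `[c, d], continuous f}.
Proof.
move=> cf ac db; apply: continuous_subspaceW cf.
by apply: subset_itv; rewrite bnd_simp.
Qed.

Lemma ri_split f a m b : a <= m -> m <= b -> {within `[a, b], continuous f} ->
  ri f a b = ri f a m + ri f m b.
Proof.
move=> am mb cf; have := @Rintegral_itvB R f (BLeft a) (BRight b) m (ri_integrable cf).
rewrite !bnd_simp => /(_ am mb) /eqP; rewrite subr_eq => /eqP e.
rewrite /ri e addrC; congr (_ + _); apply: Rintegral_itv_obnd_cbnd.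
apply: integrableS (ri_integrable (within_sub cf am (lexx b))) => //.
by apply: subset_itv; rewrite bnd_simp.
Qed.

Lemma ri_cst c a b : a <= b -> ri (fun=> c) a b = c * (b - a).
Proof.
move=> ab; rewrite /ri Rintegral_cst //= lebesgue_measure_itv /= lte_fin.
by move: ab; rewrite le_eqVlt => /orP[/eqP ->|->] //=; rewrite ltxx subrr.
Qed.

Lemma riD f g a b : {within `[a, b], continuous f} -> {within `[a, b], continuous g} ->
  ri (fun t => f t + g t) a b = ri f a b + ri g a b.
Proof. by move=> cf cg; rewrite /ri RintegralD //; exact: ri_integrable. Qed.

Lemma riZ c f a b : {within `[a, b], continuous f} ->
  ri (fun t => c * f t) a b = c * ri f a b.
Proof. by move=> cf; rewrite /ri RintegralZl //; exact: ri_integrable. Qed.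

Lemma ri_le f g a b : {within `[a, b], continuous f} -> {within `[a, b], continuous g} ->
  (forall t, a <= t <= b -> f t <= g t) -> ri f a b <= ri g a b.
Proof.
move=> cf cg fg; apply: le_Rintegral; rewrite ?measurable_itv //; try exact: ri_integrable.
Qed.

Lemma ri_bound f a b M : a <= b -> {within `[a, b], continuous f} ->
  (forall t, a <= t <= b -> `|f t| <= M) -> `|ri f a b| <= M * (b - a).
Proof.
move=> ab cf fM; have cc (c : R) : {within `[a, b], continuous (fun=> c)}.
  by apply: continuous_subspaceT => x; exact: cst_continuous.
rewrite ler_norml -mulNr -!ri_cst //; apply/andP; split; apply: ri_le => // t /fM;
  by rewrite ler_norml => /andP[].
Qed.

End RealIntegral.

Section ComplexIntegral.
Variable R : realType.
Local Notation normc := (@Normc.normc R).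
Implicit Types (f g : R[i] -> R[i]) (z : R[i]).

Definition ccont f z := forall e : R, 0 < e ->
  exists2 d : R, 0 < d & forall s, normc (s - z) < d -> normc (f s - f z) < e.

(** Stated with real e and d, whereas the filters behind [derivable] use positive elements of R[i];
    the linear error is the form that Goursat's argument consumes. *)
Definition cdiff f z := exists l : R[i], forall e : R, 0 < e ->
  exists2 d : R, 0 < d & forall s, normc (s - z) < d ->
    normc (f s - f z - l * (s - z)) <= e * normc (s - z).

Lemma cdiff_cont f z : cdiff f z -> ccont f z.
Proof.
case=> l fl e e0; have [d d0 fd] := fl 1 ltr01.
pose c := normc l + 1.
have c0 : 0 < c by rewrite ltr_wpDl // normc_ge0.
exists (Num.min d (e / c)); first by rewrite lt_min d0 divr_gt0.
move=> s; rewrite lt_min => /andP[sd se].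
have -> : f s - f z = (f s - f z - l * (s - z)) + l * (s - z) by rewrite subrK.
apply: (le_lt_trans (le_normcD _ _)); rewrite Normc.normcM.
apply: (le_lt_trans (lerD (fd s sd) (lexx _))).
by rewrite -mulrDl addrC -/c mulrC -ltr_pdivlMr.
Qed.

Definition hpath (y t : R) : R[i] := t +i* y.
Definition vpath (x t : R) : R[i] := x +i* t.

Lemma normc_hpath y t t' : normc (hpath y t - hpath y t') = `|t - t'|.
Proof. by rewrite /hpath; simpc; rewrite normc_real. Qed.

Lemma normc_vpath y t t' : normc (vpath y t - vpath y t') = `|t - t'|.
Proof. by rewrite /vpath; simpc; rewrite normc_im. Qed.

Definition pcont (g : R -> R[i]) a b :=
  {within `[a, b], continuous (fun t => complex.Re (g t))} /\
  {within `[a, b], continuous (fun t => complex.Im (g t))}.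

Lemma pcont_path (gam : R -> R[i]) f a b :
  (forall t t', normc (gam t - gam t') = `|t - t'|) ->
  (forall t, a <= t <= b -> ccont f (gam t)) -> pcont (f \o gam) a b.
Proof.
move=> gE fc; split; apply: continuous_in_subspaceT => t /set_mem /=; rewrite in_itv /= => /fc ct.
  apply/cvgrPdist_lt => e e0; have [d d0 H] := ct e e0.
  near=> t'; apply: (@le_lt_trans _ _ (normc (f (gam t') - f (gam t)))).
    by rewrite distrC -raddfB normc_Re.
  apply: H; rewrite gE distrC; near: t'; exact: cvgr_dist_lt.
apply/cvgrPdist_lt => e e0; have [d d0 H] := ct e e0.
near=> t'; apply: (@le_lt_trans _ _ (normc (f (gam t') - f (gam t)))).
  by rewrite distrC -raddfB normc_Im.
apply: H; rewrite gE distrC; near: t'; exact: cvgr_dist_lt.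
Unshelve. all: by end_near. Qed.

Definition cint (g : R -> R[i]) a b : R[i] :=
  ri (fun t => complex.Re (g t)) a b +i* ri (fun t => complex.Im (g t)) a b.

Lemma cint_split (g : R -> R[i]) a m b : a <= m -> m <= b -> pcont g a b ->
  cint g a b = cint g a m + cint g m b.
Proof. by move=> am mb [cr ci]; rewrite /cint !(ri_split am mb) //; simpc. Qed.

Lemma cint_bound (g : R -> R[i]) a b M : a <= b -> pcont g a b ->
  (forall t, a <= t <= b -> normc (g t) <= M) -> normc (cint g a b) <= 2 * M * (b - a).
Proof.
move=> ab [cr ci] gM; apply: (le_trans (normc_le_ReIm _)) => /=.
rewrite -mulrA mulr2n mulrDl !mul1r; apply: lerD; apply: ri_bound => // t /gM; apply: le_trans.
  exact: normc_Re.
exact: normc_Im.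
Qed.

Lemma cintD (g h : R -> R[i]) a b : pcont g a b -> pcont h a b ->
  cint (fun t => g t + h t) a b = cint g a b + cint h a b.
Proof.
move=> [cr ci] [dr di]; rewrite /cint; simpc; rewrite -!riD //.
by congr (_ +i* _); congr (ri _ a b); apply: funext => t; case: (g t) => ? ?; case: (h t).
Qed.

Lemma wcZ (c : R) (f : R -> R) a b : {within `[a, b], continuous f} ->
  {within `[a, b], continuous (fun t => c * f t)}.
Proof. by move=> cf x; apply: cvgM; [exact: cvg_cst | exact: cf]. Qed.

Lemma cintZ c (g : R -> R[i]) a b : pcont g a b -> cint (fun t => c * g t) a b = c * cint g a b.
Proof.
case: c => x y [cr ci]; rewrite /cint.
have -> : (fun t => complex.Re ((x +i* y) * g t)) =
   (fun t => x * complex.Re (g t) + (- y) * complex.Im (g t)).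
  by apply: funext => t; case: (g t) => u v; simpc.
have -> : (fun t => complex.Im ((x +i* y) * g t)) =
   (fun t => x * complex.Im (g t) + y * complex.Re (g t)).
  by apply: funext => t; case: (g t) => u v; simpc; rewrite /= addrC.
rewrite !riD ?riZ //; try exact: wcZ.
by simpc.
Qed.

Lemma pcont_cst c a b : pcont (fun=> c) a b.
Proof. by split; apply: continuous_subspaceT => x; exact: cst_continuous. Qed.

Lemma cint_cst c a b : a <= b -> cint (fun=> c) a b = c * (b - a)%:C.
Proof. by move=> ab; rewrite /cint !ri_cst //; case: c => x y; simpc. Qed.

(* The integral of f around the rectangle [x, x + w] x [y, y + h]. *)
Definition box f (x y w h : R) : R[i] :=
  cint (f \o hpath y) x (x + w) + 'i * cint (f \o vpath (x + w)) y (y + h)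
  - cint (f \o hpath (y + h)) x (x + w) - 'i * cint (f \o vpath x) y (y + h).

Definition in_box (x y w h : R) z :=
  (x <= complex.Re z <= x + w) && (y <= complex.Im z <= y + h).

Definition on_bd (x y w h : R) z :=
  in_box x y w h z && [|| complex.Re z == x, complex.Re z == x + w, complex.Im z == y | complex.Im z == y + h].

Section Box.
Variables (f : R[i] -> R[i]).

Lemma pcont_h x w y : (forall t, x <= t <= x + w -> ccont f (hpath y t)) ->
  pcont (f \o hpath y) x (x + w).
Proof. by apply: pcont_path => t t'; exact: normc_hpath. Qed.

Lemma pcont_v x y h : (forall t, y <= t <= y + h -> ccont f (vpath x t)) ->
  pcont (f \o vpath x) y (y + h).
Proof. by apply: pcont_path => t t'; exact: normc_vpath. Qed.

Lemma box_hsplit x y w1 w2 h : 0 <= w1 -> 0 <= w2 -> 0 <= h ->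
  (forall z, in_box x y (w1 + w2) h z -> ccont f z) ->
  box f x y (w1 + w2) h = box f x y w1 h + box f (x + w1) y w2 h.
Proof.
move=> w10 w20 h0 fc.
have sp y' : y <= y' <= y + h -> cint (f \o hpath y') x (x + (w1 + w2)) =
    cint (f \o hpath y') x (x + w1) + cint (f \o hpath y') (x + w1) (x + (w1 + w2)).
  move=> yy; apply: cint_split; rewrite ?lerDl ?lerD2l ?lerDl //.
  by apply: pcont_h => t tt; apply: fc; rewrite /in_box /= tt yy.
rewrite /box !sp ?lexx ?lerDl ?andbT ?addr_ge0 // !addrA; ring.
Qed.

Lemma box_vsplit x y w h1 h2 : 0 <= w -> 0 <= h1 -> 0 <= h2 ->
  (forall z, in_box x y w (h1 + h2) z -> ccont f z) ->
  box f x y w (h1 + h2) = box f x y w h1 + box f x (y + h1) w h2.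
Proof.
move=> w0 h10 h20 fc.
have sp x' : x <= x' <= x + w -> cint (f \o vpath x') y (y + (h1 + h2)) =
    cint (f \o vpath x') y (y + h1) + cint (f \o vpath x') (y + h1) (y + (h1 + h2)).
  move=> xx; apply: cint_split; rewrite ?lerDl ?lerD2l ?lerDl //.
  by apply: pcont_v => t tt; apply: fc; rewrite /in_box /= tt xx.
rewrite /box !sp ?lexx ?lerDl ?andbT ?addr_ge0 // !addrA; ring.
Qed.

Lemma box_bound x y w h M : 0 <= w -> 0 <= h ->
  (forall z, on_bd x y w h z -> ccont f z) ->
  (forall t, x <= t <= x + w -> normc (f (hpath y t)) <= M) ->
  (forall t, x <= t <= x + w -> normc (f (hpath (y + h) t)) <= M) ->
  (forall t, y <= t <= y + h -> normc (f (vpath x t)) <= M) ->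
  (forall t, y <= t <= y + h -> normc (f (vpath (x + w) t)) <= M) ->
  normc (box f x y w h) <= 4 * M * (w + h).
Proof.
move=> w0 h0 fc b1 b2 b3 b4.
have xw : x <= x + w by rewrite lerDl.
have yh : y <= y + h by rewrite lerDl.
have ni z : normc ('i * z) = normc z.
  by rewrite Normc.normcM normc_im normr1 mul1r.
have yy1 : y <= y <= y + h by rewrite lexx.
have yy2 : y <= y + h <= y + h by rewrite lexx yh.
have xx1 : x <= x <= x + w by rewrite lexx.
have xx2 : x <= x + w <= x + w by rewrite lexx xw.
have B y' : y <= y' <= y + h -> (y' == y) || (y' == y + h) -> (forall t, x <= t <= x + w -> normc (f (hpath y' t)) <= M) ->
    normc (cint (f \o hpath y') x (x + w)) <= 2 * M * w.
  move=> yy yo bb; have pc : pcont (f \o hpath y') x (x + w).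
    by apply: pcont_h => t tt; apply: fc; rewrite /on_bd /in_box /= tt yy /= yo !orbT.
  by have := cint_bound xw pc bb; rewrite (_ : x + w - x = w) //; ring.
have V x' : x <= x' <= x + w -> (x' == x) || (x' == x + w) -> (forall t, y <= t <= y + h -> normc (f (vpath x' t)) <= M) ->
    normc ('i * cint (f \o vpath x') y (y + h)) <= 2 * M * h.
  move=> xx xo bb; rewrite ni; have pc : pcont (f \o vpath x') y (y + h).
    by apply: pcont_v => t tt; apply: fc; rewrite /on_bd /in_box /= tt xx /= orbA xo.
  by have := cint_bound yh pc bb; rewrite (_ : y + h - y = h) //; ring.
have -> : 4 * M * (w + h) = 2 * M * w + 2 * M * h + 2 * M * w + 2 * M * h by ring.
rewrite /box; apply: (le_trans (le_normcD _ _)); rewrite normcN; apply: lerD; last first.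
  by apply: V => //; rewrite eqxx.
apply: (le_trans (le_normcD _ _)); rewrite normcN; apply: lerD; last first.
  by apply: B => //; rewrite eqxx orbT.
apply: (le_trans (le_normcD _ _)); apply: lerD.
  by apply: B => //; rewrite eqxx.
by apply: V => //; rewrite eqxx orbT.
Qed.

End Box.

Lemma boxD f g x y w h : 0 <= w -> 0 <= h ->
  (forall z, on_bd x y w h z -> ccont f z) -> (forall z, on_bd x y w h z -> ccont g z) ->
  box (fun z => f z + g z) x y w h = box f x y w h + box g x y w h.
Proof.
move=> w0 h0 fc gc.
have xw : x <= x + w by rewrite lerDl.
have yh : y <= y + h by rewrite lerDl.
have yy1 : y <= y <= y + h by rewrite lexx.
have yy2 : y <= y + h <= y + h by rewrite lexx yh.
have xx1 : x <= x <= x + w by rewrite lexx.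
have xx2 : x <= x + w <= x + w by rewrite lexx xw.
have B y' : y <= y' <= y + h -> (y' == y) || (y' == y + h) -> cint ((fun z => f z + g z) \o hpath y') x (x + w) =
    cint (f \o hpath y') x (x + w) + cint (g \o hpath y') x (x + w).
  move=> yy yo; rewrite -cintD //; apply: pcont_h => t tt.
    by apply: fc; rewrite /on_bd /in_box /= tt yy /= yo !orbT.
  by apply: gc; rewrite /on_bd /in_box /= tt yy /= yo !orbT.
have V x' : x <= x' <= x + w -> (x' == x) || (x' == x + w) -> cint ((fun z => f z + g z) \o vpath x') y (y + h) =
    cint (f \o vpath x') y (y + h) + cint (g \o vpath x') y (y + h).
  move=> yy yo; rewrite -cintD //; apply: pcont_v => t tt.
    by apply: fc; rewrite /on_bd /in_box /= tt yy /= orbA yo.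
  by apply: gc; rewrite /on_bd /in_box /= tt yy /= orbA yo.
rewrite /box !B ?V ?eqxx ?orbT ?xx1 ?xx2 ?yy1 ?yy2 //; ring.
Qed.

Lemma boxZ c f x y w h : 0 <= w -> 0 <= h ->
  (forall z, on_bd x y w h z -> ccont f z) ->
  box (fun z => c * f z) x y w h = c * box f x y w h.
Proof.
move=> w0 h0 fc.
have xw : x <= x + w by rewrite lerDl.
have yh : y <= y + h by rewrite lerDl.
have yy1 : y <= y <= y + h by rewrite lexx.
have yy2 : y <= y + h <= y + h by rewrite lexx yh.
have xx1 : x <= x <= x + w by rewrite lexx.
have xx2 : x <= x + w <= x + w by rewrite lexx xw.
have B y' : y <= y' <= y + h -> (y' == y) || (y' == y + h) -> cint ((fun z => c * f z) \o hpath y') x (x + w) =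
    c * cint (f \o hpath y') x (x + w).
  by move=> yy yo; rewrite -cintZ //; apply: pcont_h => t tt; apply: fc; rewrite /on_bd /in_box /= tt yy /= yo !orbT.
have V x' : x <= x' <= x + w -> (x' == x) || (x' == x + w) -> cint ((fun z => c * f z) \o vpath x') y (y + h) =
    c * cint (f \o vpath x') y (y + h).
  by move=> yy yo; rewrite -cintZ //; apply: pcont_v => t tt; apply: fc; rewrite /on_bd /in_box /= tt yy /= orbA yo.
rewrite /box !B ?V ?eqxx ?orbT ?xx1 ?xx2 ?yy1 ?yy2 //; ring.
Qed.

Lemma eq_box f g x y w h : 0 <= w -> 0 <= h -> (forall z, on_bd x y w h z -> f z = g z) ->
  box f x y w h = box g x y w h.
Proof.
move=> w0 h0 fg; have xw : x <= x + w by rewrite lerDl.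
have yh : y <= y + h by rewrite lerDl.
have E (u v : R -> R[i]) a b : (forall t, a <= t <= b -> u t = v t) -> cint u a b = cint v a b.
  move=> uv; rewrite /cint /ri; congr (_ +i* _); apply: eq_Rintegral => t;
    by rewrite inE /= in_itv /= => /uv ->.
rewrite /box; congr (_ + _ - _ - _); [|congr (_ * _)| |congr (_ * _)]; apply: E => t ht /=;
  by apply: fg; rewrite /on_bd /in_box /= ht ?eqxx ?orbT ?lexx ?xw ?yh.
Qed.

Lemma ccont_cst c z : ccont (fun=> c) z.
Proof. by move=> e e0; exists 1 => // s _; rewrite subrr Normc.normc0. Qed.

Lemma ccont_id z : ccont id z.
Proof. by move=> e e0; exists e. Qed.

Lemma box_cst c x y w h : 0 <= w -> 0 <= h -> box (fun=> c) x y w h = 0.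
Proof.
move=> w0 h0; have xw : x <= x + w by rewrite lerDl.
have yh : y <= y + h by rewrite lerDl.
by rewrite /box -!/(cint (fun=> c) _ _) !cint_cst //; ring.
Qed.

(** On opposite sides the integrands differ by a constant, so no antiderivative is called for. *)
Lemma box_id x y w h : 0 <= w -> 0 <= h -> box id x y w h = 0.
Proof.
move=> w0 h0; have xw : x <= x + w by rewrite lerDl.
have yh : y <= y + h by rewrite lerDl.
have hE y' : cint (id \o hpath y') x (x + w) = cint (hpath 0) x (x + w) + 'i * y'%:C * w%:C.
  have -> : w%:C = (x + w - x)%:C by rewrite addrC addKr.
  rewrite -cint_cst // -cintD; last exact: pcont_cst; last first.
    by apply: (@pcont_path (hpath 0) id) => // t t'; [exact: normc_hpath | exact: ccont_id].
  by congr (cint _ _ _); apply: funext => t; rewrite /hpath /=; simpc.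
have vE x' : cint (id \o vpath x') y (y + h) = cint (vpath 0) y (y + h) + x'%:C * h%:C.
  have -> : h%:C = (y + h - y)%:C by rewrite addrC addKr.
  rewrite -cint_cst // -cintD; last exact: pcont_cst; last first.
    by apply: (@pcont_path (vpath 0) id) => // t t'; [exact: normc_vpath | exact: ccont_id].
  by congr (cint _ _ _); apply: funext => t; rewrite /vpath /=; simpc.
have key (A B I X Y W H : R[i]) :
    (A + I * Y * W) + I * (B + (X + W) * H) - (A + I * (Y + H) * W) - I * (B + X * H) = 0.
  by ring.
by rewrite /box (hE y) (vE (x + w)) (hE (y + h)) (vE x) !(rmorphD (real_complex R)) key.
Qed.

End ComplexIntegral.

(** * Goursat's theorem *)

Section Goursat.
Variable R : realType.
Local Notation normc := (@Normc.normc R).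
Implicit Types (f g : R[i] -> R[i]) (z : R[i]).

Lemma ccontD f g z : ccont f z -> ccont g z -> ccont (fun s => f s + g s) z.
Proof.
move=> fc gc e e0; have e2 : 0 < e / 2 by rewrite divr_gt0.
have [d d0 fd] := fc _ e2; have [d' d'0 gd] := gc _ e2.
exists (Num.min d d'); first by rewrite lt_min d0.
move=> s; rewrite lt_min => /andP[/fd h1 /gd h2].
rewrite opprD addrACA (le_lt_trans (le_normcD _ _)) //.
by rewrite (splitr e) ltrD.
Qed.

Lemma ccontZ c f z : ccont f z -> ccont (fun s => c * f s) z.
Proof.
move=> fc e e0; have c0 : 0 < normc c + 1 by rewrite ltr_wpDl // normc_ge0.
have [d d0 fd] := fc _ (divr_gt0 e0 c0); exists d => // s /fd h.
rewrite -mulrBr Normc.normcM.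
apply: (@le_lt_trans _ _ ((normc c + 1) * normc (f s - f z))).
  by rewrite ler_wpM2r ?normc_ge0 // lerDl.
by rewrite mulrC -ltr_pdivlMr.
Qed.

Lemma in_box_sub x y w h x' y' w' h' z : x <= x' -> x' + w' <= x + w -> y <= y' -> y' + h' <= y + h ->
  in_box x' y' w' h' z -> in_box x y w h z.
Proof.
move=> h1 h2 h3 h4 /andP[/andP[a1 a2] /andP[a3 a4]]; apply/andP; split; apply/andP; split.
- exact: le_trans a1.
- exact: le_trans h2.
- exact: le_trans a3.
- exact: le_trans h4.
Qed.

Lemma box_quarter f x y u v : 0 <= u -> 0 <= v ->
  (forall z, in_box x y (u + u) (v + v) z -> ccont f z) ->
  exists x' y', [/\ x <= x' <= x + u, y <= y' <= y + v &
    normc (box f x y (u + u) (v + v)) <= 4 * normc (box f x' y' u v)].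
Proof.
move=> u0 v0 fc.
have xu : x <= x + u by rewrite lerDl.
have yv : y <= y + v by rewrite lerDl.
have c1 z : in_box x y u (v + v) z -> ccont f z.
  by move=> hz; apply: fc; apply: in_box_sub hz; rewrite ?lexx // addrA lerDl.
have c2 z : in_box (x + u) y u (v + v) z -> ccont f z.
  by move=> hz; apply: fc; apply: in_box_sub hz; rewrite ?lexx // addrA.
have E : box f x y (u + u) (v + v) = box f x y u v + box f x (y + v) u v +
    (box f (x + u) y u v + box f (x + u) (y + v) u v).
  by rewrite box_hsplit ?addr_ge0 // !box_vsplit.
set B := normc (box f x y (u + u) (v + v)).
have [h1|h1] := leP B (4 * normc (box f x y u v)).
  by exists x, y; split; rewrite ?lexx.
have [h2|h2] := leP B (4 * normc (box f x (y + v) u v)).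
  by exists x, (y + v); split; rewrite ?lexx ?yv.
have [h3|h3] := leP B (4 * normc (box f (x + u) y u v)).
  by exists (x + u), y; split; rewrite ?lexx ?xu.
have [h4|h4] := leP B (4 * normc (box f (x + u) (y + v) u v)).
  by exists (x + u), (y + v); split; rewrite ?lexx ?xu ?yv.
have : B <= normc (box f x y u v) + normc (box f x (y + v) u v) +
    (normc (box f (x + u) y u v) + normc (box f (x + u) (y + v) u v)).
  by rewrite /B E (le_trans (le_normcD _ _)) // lerD // le_normcD.
move: h1 h2 h3 h4; move: B (normc _) (normc _) (normc _) (normc _) => *; lra.
Qed.

(** Bisection: a nonzero integral N yields nested boxes whose n-th integral is at least N / 4^n. At
    their common point f is affine up to e times the distance, affine functions integrate to 0, and
    what remains is at most 4 e (w + h)^2 / 4^n. *)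
Lemma goursat f x y w h : 0 <= w -> 0 <= h ->
  (forall z, in_box x y w h z -> cdiff f z) -> box f x y w h = 0.
Proof.
move=> w0 h0 fd; have fc z : in_box x y w h z -> ccont f z by move/fd/cdiff_cont.
apply: Normc.eq0_normc; apply/eqP; rewrite eq_le normc_ge0 andbT leNgt; apply/negP => N0.
set N := normc (box f x y w h) in N0.
pose W n := w / 2 ^+ n; pose V n := h / 2 ^+ n.
have W0 n : 0 <= W n by rewrite divr_ge0 ?exprn_ge0.
have V0 n : 0 <= V n by rewrite divr_ge0 ?exprn_ge0.
have WS n : W n = W n.+1 + W n.+1.
  by rewrite /W exprS; field; rewrite expf_neq0.
have VS n : V n = V n.+1 + V n.+1.
  by rewrite /V exprS; field; rewrite expf_neq0.
pose Inv n (q : R * R) := [/\ x <= q.1, q.1 + W n <= x + w, y <= q.2, q.2 + V n <= y + h &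
   N <= 4 ^+ n * normc (box f q.1 q.2 (W n) (V n))].
(* The invariant stands under the existential so that [choice] yields a total function. *)
have H (nq : nat * (R * R)) : exists q', Inv nq.1 nq.2 ->
   [/\ Inv nq.1.+1 q', nq.2.1 <= q'.1 <= nq.2.1 + W nq.1.+1 &
       nq.2.2 <= q'.2 <= nq.2.2 + V nq.1.+1].
  case: nq => n [a b] /=.
  have [inv|ninv] := pselect (Inv n (a, b)); last by exists (a, b).
  case: inv => /= h1 h2 h3 h4 h5.
  have cc z : in_box a b (W n.+1 + W n.+1) (V n.+1 + V n.+1) z -> ccont f z.
    by rewrite -WS -VS => hz; apply: fc; apply: in_box_sub hz.
  have [a' [b' [/andP[ha1 ha2] /andP[hb1 hb2] hB]]] := box_quarter (W0 n.+1) (V0 n.+1) cc.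
  exists (a', b') => _; split; rewrite /= ?ha1 ?ha2 ?hb1 ?hb2 //.
  rewrite -WS -VS in hB; split => /=.
  - exact: le_trans ha1.
  - by apply: le_trans h2; rewrite [W n]WS addrA lerD2r.
  - exact: le_trans hb1.
  - by apply: le_trans h4; rewrite [V n]VS addrA lerD2r.
  - by apply: (le_trans h5); rewrite (exprSr 4 n) -mulrA ler_wpM2l ?exprn_ge0.
have [nx nxP] := choice H.
pose q := fix q n := if n is n'.+1 then nx (n', q n') else (x, y).
have qI n : Inv n (q n).
  elim: n => [|n IH] /=; last by have [] := nxP (n, q n) IH.
  by split; rewrite /= /W /V ?expr0 ?invr1 ?mulr1 // mul1r.
have q1S n : (q n).1 <= (q n.+1).1 <= (q n).1 + W n.+1 by have [_ h1 _] := nxP (n, q n) (qI n).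
have q2S n : (q n).2 <= (q n.+1).2 <= (q n).2 + V n.+1 by have [_ _ h2] := nxP (n, q n) (qI n).
have nest (u : nat -> R) (L : nat -> R) : (forall n, 0 <= L n) -> (forall n, L n = L n.+1 + L n.+1) ->
    (forall n, u n <= u n.+1 <= u n + L n.+1) -> exists c, forall n, u n <= c <= u n + L n.
  move=> L0 LS uS.
  have mono m n : u n <= u (n + m)%N.
    elim: m => [|m IH]; first by rewrite addn0.
    by rewrite addnS (le_trans IH) //; case/andP: (uS (n + m)%N).
  have up m n : u (n + m)%N + L (n + m)%N <= u n + L n.
    elim: m => [|m IH]; first by rewrite addn0.
    rewrite addnS; apply: le_trans IH; rewrite [L (n + m)%N]LS addrA lerD2r.
    by case/andP: (uS (n + m)%N).
  have le m n : u m <= u n + L n.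
    have [mn|/ltnW nm] := leqP m n.
      have := mono (n - m)%N m; rewrite subnKC // => hu; apply: (le_trans hu).
      by rewrite lerDl.
    have := up (m - n)%N n; rewrite subnKC // => hu; apply: le_trans hu.
    by rewrite lerDl.
  exists (sup (range u)) => n; apply/andP; split.
    apply: sup_upper_bound; last by exists n.
    split; first by exists (u 0%N); exists 0%N.
    by exists (u 0%N + L 0%N) => _ [m _ <-].
  by apply: ge_sup => [|_ [m _ <-]]; [exists (u 0%N); exists 0%N | exact: le].
have [cx cxP] := nest (fun n => (q n).1) W W0 WS q1S.
have [cy cyP] := nest (fun n => (q n).2) V V0 VS q2S.
have zin n : in_box (q n).1 (q n).2 (W n) (V n) (cx +i* cy) by rewrite /in_box /= cxP cyP.
have [l fl] : cdiff f (cx +i* cy).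
  apply: fd; have := zin 0%N; rewrite /= /W /V expr0 invr1 !mulr1; exact.
pose c := w + h; have c0 : 0 <= c by rewrite addr_ge0.
(* Makes 4 e c^2 less than N / 2; the 1 guards against c = 0. *)
pose e := N / (8 * (c ^+ 2 + 1)).
have e0 : 0 < e by rewrite divr_gt0 // mulr_gt0 // ltr_wpDl // sqr_ge0.
have [d d0 fl'] := fl e e0.
have [n nd] : exists n : nat, c / 2 ^+ n < d.
  exists (Num.bound (c / d)); rewrite ltr_pdivrMr ?exprn_gt0 // mulrC -ltr_pdivrMr //.
  apply: (lt_trans (archi_boundP (divr_ge0 c0 (ltW d0)))).
  by rewrite -natrX ltr_nat ltn_expl.
have [i1 i2 i3 i4 i5] := qI n.
pose z0 := cx +i* cy; pose k := - (f z0 - l * z0).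
pose r s := f s + ((- l) * id s + k).
have rE s : r s = f s - f z0 - l * (s - z0) by rewrite /r /k; ring.
have close z : in_box (q n).1 (q n).2 (W n) (V n) z -> normc (z - z0) <= c / 2 ^+ n.
  move=> /andP[/andP[a1 a2] /andP[a3 a4]].
  have /andP[/andP[b1 b2] /andP[b3 b4]] := zin n.
  apply: (le_trans (normc_le_ReIm _)); rewrite !raddfB /= /c mulrDl -/(W n) -/(V n).
  move: a1 a2 a3 a4 b1 b2 b3 b4 => /= a1 a2 a3 a4 b1 b2 b3 b4.
  by apply: lerD; rewrite ler_norml; apply/andP; split; lra.
have fcn z : in_box (q n).1 (q n).2 (W n) (V n) z -> ccont f z.
  by move=> hz; apply: fc; apply: in_box_sub hz.
have fcb z : on_bd (q n).1 (q n).2 (W n) (V n) z -> ccont f z by case/andP => /fcn.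
have rc z : on_bd (q n).1 (q n).2 (W n) (V n) z -> ccont r z.
  move=> /andP[hz _]; apply: ccontD; first exact: fcn.
  by apply: ccontD; [apply: ccontZ; exact: ccont_id | exact: ccont_cst].
have boxr : box r (q n).1 (q n).2 (W n) (V n) = box f (q n).1 (q n).2 (W n) (V n).
  rewrite /r boxD //; last first.
    by move=> z _; apply: ccontD; [apply: ccontZ; exact: ccont_id | exact: ccont_cst].
  rewrite boxD //; [|by move=> z _; apply: ccontZ; exact: ccont_id|by move=> z _; exact: ccont_cst].
  rewrite boxZ //; last by move=> z _; exact: ccont_id.
  by rewrite box_id // box_cst // mulr0 !addr0.
have rb z : in_box (q n).1 (q n).2 (W n) (V n) z -> normc (r z) <= e * (c / 2 ^+ n).
  move=> hz; rewrite rE; apply: (le_trans (fl' _ (le_lt_trans (close _ hz) nd))).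
  by rewrite ler_wpM2l ?(ltW e0) ?close.
have bound : normc (box r (q n).1 (q n).2 (W n) (V n)) <= 4 * (e * (c / 2 ^+ n)) * (W n + V n).
  apply: box_bound => // t ht; apply: rb; rewrite /in_box /= ?ht ?lexx ?lerDl ?W0 ?V0 //.
rewrite boxr in bound.
have W4 : W n + V n = c / 2 ^+ n by rewrite /c mulrDl.
have : N <= 4 * e * c ^+ 2.
  apply: (le_trans i5); apply: (le_trans (ler_wpM2l _ bound)); first by rewrite exprn_ge0.
  rewrite W4 le_eqVlt; apply/orP; left; apply/eqP.
  have -> : 4 ^+ n = 2 ^+ n * 2 ^+ n :> R by rewrite -exprMn; congr (_ ^+ n); lra.
  by field; rewrite expf_neq0.
apply/negP; rewrite -ltNge /e.
rewrite (_ : 4 * (N / (8 * (c ^+ 2 + 1))) * c ^+ 2 = N * (c ^+ 2 / (2 * (c ^+ 2 + 1)))); last first.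
  by field; rewrite gt_eqF // ltr_wpDl // sqr_ge0.
rewrite -[ltRHS]mulr1 ltr_pM2l // ltr_pdivrMr ?mul1r; have := sqr_ge0 c; lra.
Qed.

End Goursat.

(** * Cauchy's estimate *)

Section Cauchy.
Variable R : realType.
Local Notation normc := (@Normc.normc R).
Implicit Types (f g : R[i] -> R[i]) (z : R[i]).

Lemma gt0_complex (e : R[i]) : 0 < e -> e = (complex.Re e)%:C /\ 0 < complex.Re e.
Proof. by case: e => a b; rewrite ltcE /= => /andP[/eqP -> ->]. Qed.

Lemma derivable_cdiff f z : derivable (f : R[i]^o -> R[i]^o) z 1 -> cdiff f z.
Proof.
move=> /cvg_ex[l fl]; exists l => e e0.
have eC : 0 < e%:C by rewrite ltcR.
have := fl; move/cvgrPdist_le/(_ _ eC); rewrite /prop_near1 => -[d /= d0 H].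
have [dE dR] := gt0_complex d0.
exists (complex.Re d) => // s sd.
have [->|sz] := eqVneq s z; first by rewrite !subrr mulr0 subr0 Normc.normc0 mulr0.
have := H (s - z); rewrite /= sub0r normrN => H1.
have {H1} : `|l - (s - z)^-1 *: (f ((s - z) *: 1 + z) - f z)| <= e%:C.
  apply: H1; last by rewrite subr_eq0.
  by rewrite dE normr_complex ltcR.
rewrite [_ *: 1]mulr1 subrK => le.
rewrite -lecR rmorphM /= -!normr_complex.
have -> : f s - f z - l * (s - z) = - (l - (s - z)^-1 *: (f s - f z)) * (s - z).
  rewrite opprB mulrBl; congr (_ - _).
  by rewrite [_ *: _]mulrC -mulrA mulVf ?mulr1 // subr_eq0.
by rewrite normrM normrN ler_wpM2r.
Qed.

Lemma cdiff_near f g z : cdiff f z -> (exists2 d : R, 0 < d & forall s, normc (s - z) < d -> g s = f s) ->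
  cdiff g z.
Proof.
move=> [l fl] [d d0 fg]; exists l => e /fl[d' d'0 H].
exists (Num.min d d'); first by rewrite lt_min d0.
move=> s; rewrite lt_min => /andP[h1 h2]; rewrite fg // (fg z) ?H //.
by rewrite subrr Normc.normc0.
Qed.

Lemma derivable_quotient f z0 z : derivable (f : R[i]^o -> R[i]^o) z 1 -> z != z0 ->
  cdiff (fun s => (f s - f z0) * (s - z0)^-1) z.
Proof.
move=> fd zz; apply: derivable_cdiff; apply/derivable1_diffP.
apply: (@differentiableM R[i] R[i]^o (fun s => f s - f z0) (fun s => (s - z0)^-1)).
  by apply: differentiableB; [apply/derivable1_diffP | exact: differentiable_cst].
apply: (@differentiableV R[i] R[i]^o (fun s => s - z0)); last by rewrite subr_eq0.
by apply: differentiableB; [apply/derivable1_diffP; exact: derivable_id | exact: differentiable_cst].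
Qed.

Section Estimate.
Variables (f : R[i] -> R[i]) (x y w h m : R) (z0 : R[i]).
Hypotheses (m0 : 0 < m)
  (mx1 : x + m <= complex.Re z0) (mx2 : complex.Re z0 + m <= x + w)
  (my1 : y + m <= complex.Im z0) (my2 : complex.Im z0 + m <= y + h)
  (fd : forall z, in_box x y w h z -> derivable (f : R[i]^o -> R[i]^o) z 1).

Let w0 : 0 <= w. Proof. by move: m0 mx1 mx2 => *; lra. Qed.
Let h0 : 0 <= h. Proof. by move: m0 my1 my2 => *; lra. Qed.
Let z0in : in_box x y w h z0.
Proof.
by move: m0 mx1 mx2 my1 my2 => *; rewrite /in_box; apply/andP; split; apply/andP; split; lra.
Qed.

Let K s := (s - z0)^-1.

(** The difference quotient, with the derivative as its value at z0, is continuous there and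
    differentiable elsewhere. Goursat's theorem shrinks the rectangle to a small square around z0,
    on which the boundedness of G makes the integral arbitrarily small. *)
Lemma box_quotient0 : exists G : R[i] -> R[i],
  (forall s, s != z0 -> G s = (f s - f z0) * K s) /\ box G x y w h = 0.
Proof.
have [l fl] := derivable_cdiff (fd z0in).
pose G s := if s == z0 then l else (f s - f z0) * K s.
exists G; split; first by move=> s sz; rewrite /G (negPf sz).
have Gd z : in_box x y w h z -> z != z0 -> cdiff G z.
  move=> hz zz; apply: (cdiff_near (derivable_quotient (fd hz) zz)).
  exists (normc (z - z0)).
    rewrite lt_neqAle normc_ge0 andbT eq_sym; apply: contra zz => /eqP/Normc.eq0_normc/eqP.
    by rewrite subr_eq0.
  move=> s sz; rewrite /G; case: eqVneq sz => // ->; by rewrite normc_sub ltxx.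
have Gb : exists2 d : R, 0 < d & forall s, normc (s - z0) < d -> normc (G s) <= normc l + 1.
  have [d d0 H] := fl 1 ltr01; exists d => // s /H.
  rewrite /G; have [_ _|sz] := eqVneq s z0; first by rewrite lerDl.
  rewrite mul1r => le1.
  have -> : (f s - f z0) * K s = l + (f s - f z0 - l * (s - z0)) * K s.
    by rewrite /K; field; rewrite subr_eq0.
  apply: (le_trans (le_normcD _ _)); rewrite lerD2l Normc.normcM Normc.normcV.
  rewrite ler_pdivrMr ?mul1r // lt_neqAle normc_ge0 andbT eq_sym.
  by apply: contra sz => /eqP/Normc.eq0_normc/eqP; rewrite subr_eq0.
have Gc z : in_box x y w h z -> ccont G z.
  move=> hz; have [->|zz] := eqVneq z z0; last exact: cdiff_cont (Gd z hz zz).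
  move=> e e0; have [d d0 H] := fl _ (divr_gt0 e0 (ltr0n R 2)); exists d => // s /H.
  have GE : G z0 = l by rewrite /G eqxx.
  have [->|sz] := eqVneq s z0; first by move=> _; rewrite subrr Normc.normc0.
  rewrite GE /G (negPf sz).
  have n0 : 0 < normc (s - z0).
    rewrite lt_neqAle normc_ge0 andbT eq_sym.
    by apply: contra sz => /eqP/Normc.eq0_normc/eqP; rewrite subr_eq0.
  have -> : (f s - f z0) * K s - l = (f s - f z0 - l * (s - z0)) * K s.
    by rewrite /K; field; rewrite subr_eq0.
  rewrite Normc.normcM Normc.normcV -ler_pdivrMr // => le.
  by apply: (le_lt_trans le); rewrite ltr_pdivrMr // mulr2n mulrDr mulr1 ltrDl.
pose x0 := complex.Re z0; pose y0 := complex.Im z0.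
(* The rectangles to the left, right, below and above the square avoid z0 and are cut off one by
   one. *)
have small t : 0 < t -> t <= m -> box G x y w h = box G (x0 - t) (y0 - t) (t + t) (t + t).
  move=> t0 tm.
  have wE : w = (x0 - t - x) + ((t + t) + (x + w - x0 - t)) by ring.
  have hE : h = (y0 - t - y) + ((t + t) + (y + h - y0 - t)) by ring.
  have ne z : (complex.Re z != x0) || (complex.Im z != y0) -> z != z0.
    by apply: contraTneq => ->; rewrite !eqxx.
  have Gc' a b w' h' z : x <= a -> a + w' <= x + w -> y <= b -> b + h' <= y + h -> in_box a b w' h' z -> ccont G z.
    by move=> *; apply: Gc; apply: in_box_sub; eassumption.
  have x1 : x + m <= x0 by []. have x2 : x0 + m <= x + w by [].
  have y1 : y + m <= y0 by []. have y2 : y0 + m <= y + h by [].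
  rewrite {1}wE (box_hsplit (w1 := x0 - t - x)); [|lra|lra|lra|by move=> z; rewrite -wE; exact: Gc].
  rewrite (goursat (x := x)); [|lra|lra|]; last first.
    move=> z hz; apply: Gd; first by apply: in_box_sub hz; lra.
    by apply: ne; move: hz => /andP[/andP[_ hz] _]; rewrite lt_eqF //; lra.
  rewrite add0r (_ : x + (x0 - t - x) = x0 - t); last by ring.
  rewrite (box_hsplit (w1 := t + t)); [|lra|lra|lra|by move=> z; apply: Gc'; lra].
  rewrite (goursat (x := x0 - t + (t + t))); [|lra|lra|]; last first.
    move=> z hz; apply: Gd; first by apply: in_box_sub hz; lra.
    by apply: ne; move: hz => /andP[/andP[hz _] _]; rewrite gt_eqF //; lra.
  rewrite addr0 {1}hE (box_vsplit (h1 := y0 - t - y)); [|lra|lra|lra|by move=> z; rewrite -hE; apply: Gc'; lra].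
  rewrite (goursat (y := y)); [|lra|lra|]; last first.
    move=> z hz; apply: Gd; first by apply: in_box_sub hz; lra.
    by apply: ne; move: hz => /andP[_ /andP[_ hz]]; apply/orP; right; rewrite lt_eqF //; lra.
  rewrite add0r (_ : y + (y0 - t - y) = y0 - t); last by ring.
  rewrite (box_vsplit (h1 := t + t)); [|lra|lra|lra|by move=> z; apply: Gc'; lra].
  rewrite (goursat (y := y0 - t + (t + t))); [|lra|lra|]; last first.
    move=> z hz; apply: Gd; first by apply: in_box_sub hz; lra.
    by apply: ne; move: hz => /andP[_ /andP[hz _]]; apply/orP; right; rewrite gt_eqF //; lra.
  by rewrite addr0.
have [d d0 Gd1] := Gb.
apply: Normc.eq0_normc; apply/eqP; rewrite eq_le normc_ge0 andbT leNgt; apply/negP => N0.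
set N := normc (box G x y w h) in N0.
pose B := normc l + 1; have B0 : 0 < B by rewrite ltr_wpDl ?normc_ge0.
(* The square must fit into the rectangle, lie where G is bounded by B, and satisfy 16 B t <= N /
   2. *)
pose t := Num.min (Num.min m (d / 8)) (N / (32 * B)).
have t0 : 0 < t by rewrite !lt_min m0 !divr_gt0 // mulr_gt0.
have tm : t <= m by rewrite !ge_min lexx.
have td : t <= d / 8 by rewrite !ge_min lexx orbT.
have tN : t <= N / (32 * B) by rewrite !ge_min lexx orbT.
have bd z : on_bd (x0 - t) (y0 - t) (t + t) (t + t) z -> normc (G z) <= B.
  move=> /andP[/andP[/andP[h1 h2] /andP[h3 h4]] _]; apply: Gd1.
  apply: (le_lt_trans (normc_le_ReIm _)); rewrite !raddfB /= -/x0 -/y0.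
  have k1 : `|complex.Re z - x0| <= t by rewrite ler_norml; apply/andP; split; lra.
  have k2 : `|complex.Im z - y0| <= t by rewrite ler_norml; apply/andP; split; lra.
  lra.
have : N <= 4 * B * ((t + t) + (t + t)).
  rewrite /N (small t) //; have tt0 : 0 <= t + t by rewrite addr_ge0 // ltW.
  apply: box_bound => //.
  - move=> z /andP[hz _]; apply: Gc; apply: in_box_sub hz; move: mx1 mx2 my1 my2 => k1 k2 k3 k4; rewrite /x0 /y0; lra.
  - by move=> s hs; apply: bd; rewrite /on_bd /in_box /= hs ?lexx ?eqxx ?orbT // lerDl tt0.
  - by move=> s hs; apply: bd; rewrite /on_bd /in_box /= hs ?lexx ?eqxx ?orbT // lerDl tt0.
  - by move=> s hs; apply: bd; rewrite /on_bd /in_box /= hs ?lexx ?eqxx ?orbT // lerDl tt0.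
  - by move=> s hs; apply: bd; rewrite /on_bd /in_box /= hs ?lexx ?eqxx ?orbT // lerDl tt0.
move: tN; rewrite ler_pdivlMr ?mulr_gt0 // => tN.
have -> : 4 * B * (t + t + (t + t)) = t * (32 * B) / 2 by field.
move=> h1; have : N <= N / 2 by apply: (le_trans h1); rewrite ler_wpM2r.
lra.
Qed.

(** On each side, the component of 1 / (s - z0) that enters here is, up to the orientation, the
    distance from z0 to that side divided by |s - z0|^2, hence at least m / D. *)
Lemma gt0_box_inv : 0 < complex.Im (box K x y w h).
Proof.
move: m0 mx1 mx2 my1 my2 => m0' k1 k2 k3 k4.
pose x0 := complex.Re z0; pose y0 := complex.Im z0.
pose D := (w + h) ^+ 2.
have wh : 0 < w + h by lra.
have D0 : 0 < D by rewrite exprn_gt0.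
have KE s : K s = ((complex.Re s - x0) / ((complex.Re s - x0) ^+ 2 + (complex.Im s - y0) ^+ 2)) +i*
    ((y0 - complex.Im s) / ((complex.Re s - x0) ^+ 2 + (complex.Im s - y0) ^+ 2)).
  rewrite /K /x0 /y0; case: s => a b; case: (z0) => c d; simpc.
  by congr (_ +i* _); rewrite -mulNr opprB.
have Kc s : on_bd x y w h s -> ccont K s.
  move=> /andP[hs bs]; apply: cdiff_cont; apply: derivable_cdiff; apply/derivable1_diffP.
  apply: (@differentiableV R[i] R[i]^o (fun s => s - z0)).
    by apply: differentiableB; [apply/derivable1_diffP; exact: derivable_id | exact: differentiable_cst].
  rewrite subr_eq0; apply: contraTneq bs => ->; rewrite !negb_or.
  apply/and4P; split; [rewrite gt_eqF | rewrite lt_eqF | rewrite gt_eqF | rewrite lt_eqF] => //; lra.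
have den a b : x <= a <= x + w -> y <= b <= y + h -> (m <= `|a - x0|) || (m <= `|b - y0|) ->
    0 < (a - x0) ^+ 2 + (b - y0) ^+ 2 <= D.
  move=> /andP[a1 a2] /andP[b1 b2] far; apply/andP; split.
    have m2 : 0 < m ^+ 2 by rewrite exprn_gt0.
    case/orP: far => far.
      apply: (lt_le_trans m2); rewrite -[X in X + _]real_normK ?num_real //.
      by rewrite -[leLHS]addr0 lerD ?sqr_ge0 // ler_pXn2r ?nnegrE // ltW.
    apply: (lt_le_trans m2); rewrite -[X in _ + X]real_normK ?num_real //.
    by rewrite -[leLHS]add0r lerD ?sqr_ge0 // ler_pXn2r ?nnegrE // ltW.
  have e1 : (a - x0) ^+ 2 <= w ^+ 2.
    rewrite -real_normK ?num_real // ler_pXn2r ?nnegrE ?w0 //.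
    by rewrite ler_norml; apply/andP; split; rewrite /x0; lra.
  have e2 : (b - y0) ^+ 2 <= h ^+ 2.
    rewrite -real_normK ?num_real // ler_pXn2r ?nnegrE ?h0 //.
    by rewrite ler_norml; apply/andP; split; rewrite /y0; lra.
  have : 0 <= w * h by rewrite mulr_ge0 //; lra.
  rewrite /D sqrrD; lra.
have quo a c : m <= a -> 0 < c <= D -> m / D <= a / c.
  move=> ma /andP[c0 cD]; rewrite ler_pdivrMr // mulrAC ler_pdivlMr //.
  by apply: ler_pM => //; rewrite ltW.
have mD : 0 < m / D by rewrite divr_gt0.
have cc (c : R) a b : {within `[a, b], continuous (fun=> c)}.
  by apply: continuous_subspaceT => t; exact: cst_continuous.
have xw : x <= x + w by rewrite lerDl.
have yh : y <= y + h by rewrite lerDl.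
have bdh y' t : (y' == y) || (y' == y + h) -> x <= t <= x + w -> on_bd x y w h (hpath y' t).
  by move=> /orP[] /eqP -> ht; rewrite /on_bd /in_box /= ht ?lexx ?yh ?eqxx ?orbT.
have bdv x' t : (x' == x) || (x' == x + w) -> y <= t <= y + h -> on_bd x y w h (vpath x' t).
  by move=> /orP[] /eqP -> ht; rewrite /on_bd /in_box /= ht ?lexx ?xw ?eqxx ?orbT.
have ph y' : (y' == y) || (y' == y + h) -> pcont (K \o hpath y') x (x + w).
  by move=> hy; apply: pcont_h => t ht; apply: Kc; exact: bdh.
have pv x' : (x' == x) || (x' == x + w) -> pcont (K \o vpath x') y (y + h).
  by move=> hx; apply: pcont_v => t ht; apply: Kc; exact: bdv.
have I1 : m / D * w <= complex.Im (cint (K \o hpath y) x (x + w)).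
  have -> : m / D * w = ri (fun=> m / D) x (x + w) by rewrite ri_cst //; ring.
  apply: ri_le => //; first by case: (ph y); rewrite ?eqxx.
  move=> t ht; rewrite /= KE /=; apply: quo; first by rewrite /y0; lra.
  by apply: den => //; rewrite ?lexx //; apply/orP; right; rewrite ler_normr /y0; apply/orP; right; lra.
have I2 : m / D * h <= complex.Re (cint (K \o vpath (x + w)) y (y + h)).
  have -> : m / D * h = ri (fun=> m / D) y (y + h) by rewrite ri_cst //; ring.
  apply: ri_le => //; first by case: (pv (x + w)); rewrite ?eqxx ?orbT.
  move=> t ht; rewrite /= KE /=; apply: quo; first by rewrite /x0; lra.
  by apply: den => //; rewrite ?lexx ?xw //; apply/orP; left; rewrite ler_normr /x0; apply/orP; left; lra.
have neg (g : R -> R) a b : {within `[a, b], continuous g} -> - ri g a b = ri (fun t => - 1 * g t) a b.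
  by move=> gc; rewrite riZ // mulN1r.
have I3 : m / D * w <= - complex.Im (cint (K \o hpath (y + h)) x (x + w)).
  have [_ pc] : pcont (K \o hpath (y + h)) x (x + w) by apply: ph; rewrite eqxx orbT.
  have -> : m / D * w = ri (fun=> m / D) x (x + w) by rewrite ri_cst //; ring.
  rewrite /= neg //; apply: ri_le => //; first exact: wcZ.
  move=> t ht; rewrite /= KE /= mulN1r -mulNr; apply: quo; first by rewrite /y0; lra.
  by apply: den => //; rewrite ?lexx ?yh //; apply/orP; right; rewrite ler_normr /y0; apply/orP; left; lra.
have I4 : m / D * h <= - complex.Re (cint (K \o vpath x) y (y + h)).
  have [pc _] : pcont (K \o vpath x) y (y + h) by apply: pv; rewrite eqxx.
  have -> : m / D * h = ri (fun=> m / D) y (y + h) by rewrite ri_cst //; ring.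
  rewrite /= neg //; apply: ri_le => //; first exact: wcZ.
  move=> t ht; rewrite /= KE /= mulN1r -mulNr; apply: quo; first by rewrite /x0; lra.
  by apply: den => //; rewrite ?lexx //; apply/orP; left; rewrite ler_normr /x0; apply/orP; right; lra.
rewrite /box.
have -> (A B C E : R[i]) : complex.Im (A + 'i * B - C - 'i * E) =
    complex.Im A + complex.Re B + - complex.Im C + - complex.Re E.
  by case: A B C E => [? ?] [? ?] [? ?] [? ?]; simpc.
have w1 : 0 < w by lra.
have : 0 < m / D * w by rewrite mulr_gt0.
have : 0 <= m / D * h by rewrite mulr_ge0 ?ltW //; lra.
move: I1 I2 I3 I4.
move: (complex.Im (cint (K \o hpath y) x (x + w))) (complex.Re (cint (K \o vpath (x + w)) y (y + h))) => A B.
move: (complex.Im (cint (K \o hpath (y + h)) x (x + w))) (complex.Re (cint (K \o vpath x) y (y + h))) => A' B'.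
by move: (m / D * w) (m / D * h) => *; lra.
Qed.

(* Only the positivity of the integral of 1 / (s - z0) is needed, not its value
   2 i pi. *)
Lemma cauchy_estimate M : (forall z, on_bd x y w h z -> normc (f z) <= M) ->
  normc (f z0) * complex.Im (box K x y w h) <= 4 * (M / m) * (w + h).
Proof.
move=> fM; have [G [GE G0]] := box_quotient0.
move: m0 mx1 mx2 my1 my2 => m0' k1 k2 k3 k4.
have far z : on_bd x y w h z -> m <= normc (z - z0).
  move=> /andP[/andP[/andP[h1 h2] /andP[h3 h4]] /or4P[]/eqP e].
  - apply: le_trans (normc_Re _); rewrite raddfB /= e ler_normr; apply/orP; right; lra.
  - apply: le_trans (normc_Re _); rewrite raddfB /= e ler_normr; apply/orP; left; lra.
  - apply: le_trans (normc_Im _); rewrite raddfB /= e ler_normr; apply/orP; right; lra.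
  - apply: le_trans (normc_Im _); rewrite raddfB /= e ler_normr; apply/orP; left; lra.
have ne z : on_bd x y w h z -> z != z0.
  by move=> /far; apply: contraTneq => ->; rewrite subrr Normc.normc0 -ltNge.
have Kc s : on_bd x y w h s -> ccont K s.
  move=> /ne sz; apply: cdiff_cont; apply: derivable_cdiff; apply/derivable1_diffP.
  apply: (@differentiableV R[i] R[i]^o (fun s => s - z0)); last by rewrite subr_eq0.
  by apply: differentiableB; [apply/derivable1_diffP; exact: derivable_id | exact: differentiable_cst].
pose g s := f s * K s.
have gc s : on_bd x y w h s -> ccont g s.
  move=> hs; apply: cdiff_cont; apply: derivable_cdiff; apply/derivable1_diffP.
  apply: (@differentiableM R[i] R[i]^o f K).
    by apply/derivable1_diffP; apply: fd; case/andP: hs.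
  apply: (@differentiableV R[i] R[i]^o (fun s => s - z0)); last by rewrite subr_eq0 ne.
  by apply: differentiableB; [apply/derivable1_diffP; exact: derivable_id | exact: differentiable_cst].
(* On the boundary g - f(z0) K is G, whose integral is 0. *)
have e : box g x y w h = f z0 * box K x y w h.
  apply/eqP; rewrite -subr_eq0 -mulNr -boxZ //.
  rewrite -boxD //; last by move=> z hz; apply: ccontZ; exact: Kc.
  rewrite -[X in _ == X]G0; apply/eqP; apply: eq_box => // z hz.
  by rewrite GE ?ne // /g mulrBl mulNr.
have gM z : on_bd x y w h z -> normc (g z) <= M / m.
  move=> hz; rewrite Normc.normcM Normc.normcV; apply: ler_pM => //; rewrite ?normc_ge0 ?invr_ge0 ?normc_ge0 //.
    exact: fM.
  by rewrite lef_pV2 ?posrE ?far // (lt_le_trans m0') ?far.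
have xw : x <= x + w by rewrite lerDl.
have yh : y <= y + h by rewrite lerDl.
have bb : normc (box g x y w h) <= 4 * (M / m) * (w + h).
  apply: box_bound => // t ht; apply: gM; rewrite /on_bd /in_box /= ht ?lexx ?xw ?yh ?eqxx ?orbT //.
apply: le_trans bb; rewrite e Normc.normcM ler_wpM2l ?normc_ge0 //.
by apply: le_trans (normc_Im _); exact: ler_norm.
Qed.

End Estimate.
End Cauchy.

(** * The complex exponential *)

Section Exponential.
Variable R : realType.
Local Notation normc := (@Normc.normc R).
Implicit Types (x y : R) (s z : R[i]).

Lemma normc_cexp z : normc (cexp z) = expR (complex.Re z).
Proof.
rewrite /cexp Normc.normcM normc_real ger0_norm ?expR_ge0 //=.
by rewrite cos2Dsin2 sqrtr1 mulr1.
Qed.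

Lemma cexpD z s : cexp (z + s) = cexp z * cexp s.
Proof.
rewrite /cexp !raddfD /= expRD cosD sinD rmorphM /=; case: z s => a b [c d] /=.
by rewrite mulrACA; congr (_ * _); simpc; congr (_ +i* _); rewrite addrC.
Qed.

Lemma cexp0 : cexp (0 : R[i]) = 1.
Proof. by rewrite /cexp /= expR0 cos0 sin0 mul1r. Qed.

Lemma le_norm_sin y : `|sin y| <= `|y|.
Proof.
wlog y0 : y / 0 <= y => [H|].
  by case: (leP 0 y) => [/H //|/ltW y0]; rewrite -normrN -sinN -[leRHS]normrN H // oppr_ge0.
have [c _] := @MVT_segment R sin cos 0 y y0 (fun x _ => is_derive_sin x)
  (continuous_subspaceT (@continuous_sin R)).
rewrite sin0 !subr0 => ->; rewrite normrM -[leRHS]mul1r ler_wpM2r //.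
exact: cos_max.
Qed.

Lemma cos_sub1 y : `|cos y - 1| <= y ^+ 2 / 2.
Proof.
have -> : cos y - 1 = - (2 * sin (y / 2) ^+ 2).
  have {1}-> : y = y / 2 + y / 2 by field.
  by rewrite cosD -!expr2 cos2sin2; ring.
have s2 : 0 <= sin (y / 2) ^+ 2 := sqr_ge0 _.
rewrite normrN ger0_norm; last lra.
have : sin (y / 2) ^+ 2 <= (y / 2) ^+ 2.
  by rewrite -real_normK ?num_real // -[leRHS]real_normK ?num_real // ler_pXn2r ?nnegrE ?le_norm_sin.
have -> : (y / 2) ^+ 2 = y ^+ 2 / 4 by field.
by lra.
Qed.

Lemma sin_subr y : `|y| <= 1 -> `|sin y - y| <= y ^+ 2.
Proof.
wlog y0 : y / 0 <= y => [H|].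
  case: (leP 0 y) => [/H //|/ltW y0]; rewrite -normrN => y1.
  rewrite -normrN opprD -sinN -sqrrN H // oppr_ge0 //.
move=> y1; have [c] := @MVT_segment R sin cos 0 y y0 (fun x _ => is_derive_sin x)
  (continuous_subspaceT (@continuous_sin R)).
rewrite in_itv /= => /andP[c0 cy]; rewrite sin0 !subr0 => ->.
have -> : cos c * y - y = (cos c - 1) * y by ring.
rewrite normrM expr2 [`|y|]ger0_norm // ler_wpM2r //.
rewrite ger0_norm // in y1.
apply: (le_trans (cos_sub1 c)).
have : c * c <= 1 * y by apply: ler_pM => //; apply: le_trans y1.
by rewrite expr2; lra.
Qed.

Lemma expR_sub1 x : `|x| <= 1 / 2 -> `|expR x - 1 - x| <= 2 * x ^+ 2.
Proof.
rewrite ler_norml => /andP[x1 x2]; have := expR_ge1Dx x; have := expR_ge1Dx (- x).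
have e0 := expR_gt0 x; rewrite expRN => h1 h2.
have h3 : (1 - x) * expR x <= 1 by rewrite -ler_pdivlMr // mul1r.
rewrite ger0_norm; last lra.
(* By [h3] the left side is at most 1 - (1 + x) (1 - x) = x^2, and 1 <= 2 (1 - x) as x <= 1/2. *)
have : (expR x - 1 - x) * (1 - x) <= 2 * x ^+ 2 * (1 - x); last by rewrite ler_pM2r //; lra.
have : 0 <= x ^+ 2 * (1 - 2 * x) by rewrite mulr_ge0 ?sqr_ge0 //; lra.
by move: h3; rewrite expr2 => h3; nra.
Qed.

(** Gives the derivative of [cexp] and, through [normc_cexp_sub1_le], the variation of n^(-s) with
    n. *)
Lemma normc_cexp_sub1 s : normc s <= 1 / 2 -> normc (cexp s - 1 - s) <= 8 * normc s ^+ 2.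
Proof.
move=> s1; set r := normc s in s1 *.
have r0 : 0 <= r by exact: normc_ge0.
have xr : `|complex.Re s| <= r by exact: normc_Re.
have yr : `|complex.Im s| <= r by exact: normc_Im.
apply: (le_trans (normc_le_ReIm _)).
move: r s1 r0 xr yr; case: s => x y r s1 r0 /= xr yr; rewrite !subr0 ?mul0r !subr0 addr0.
have xE := expR_sub1 (le_trans xr s1); have cE := cos_sub1 y.
have sE : `|sin y - y| <= y ^+ 2 by apply: sin_subr; apply: (le_trans yr); lra.
have x2 : x ^+ 2 <= r ^+ 2 by rewrite -real_normK ?num_real // ler_pXn2r ?nnegrE.
have y2 : y ^+ 2 <= r ^+ 2 by rewrite -real_normK ?num_real // ler_pXn2r ?nnegrE.
have r2 : r ^+ 2 <= r / 2 by rewrite expr2; nra.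
have E1 : `|expR x - 1| <= 2 * r.
  rewrite (_ : expR x - 1 = (expR x - 1 - x) + x); last by ring.
  by apply: (le_trans (ler_normD _ _)); lra.
have E0 := expR_gt0 x.
have E2 : `|expR x| <= 2 by move: E1; rewrite ler_norml (gtr0_norm E0); lra.
have -> : expR x * cos y - 1 - x = expR x * (cos y - 1) + (expR x - 1 - x) by ring.
have -> : expR x * sin y - y = expR x * (sin y - y) + (expR x - 1) * y by ring.
have a1 : `|expR x * (cos y - 1)| <= 2 * (y ^+ 2 / 2) by rewrite normrM; apply: ler_pM.
have a2 : `|expR x * (sin y - y)| <= 2 * y ^+ 2 by rewrite normrM; apply: ler_pM.
have a3 : `|(expR x - 1) * y| <= 2 * r * r by rewrite normrM; apply: ler_pM.
apply: (le_trans (lerD (ler_normD _ _) (ler_normD _ _))).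
by move: a3 (sqr_ge0 r); rewrite -mulrA -expr2; lra.
Qed.

Lemma normc_cexp_sub1_le s : normc s <= 1 / 2 -> normc (cexp s - 1) <= 5 * normc s.
Proof.
move=> s1; have h := normc_cexp_sub1 s1.
have -> : cexp s - 1 = (cexp s - 1 - s) + s by rewrite subrK.
apply: (le_trans (le_normcD _ _)).
have : normc s * normc s <= 1 / 2 * normc s by rewrite ler_wpM2r ?normc_ge0.
by move: h; rewrite expr2; lra.
Qed.

Lemma cdiff_derivable (f : R[i] -> R[i]) z : cdiff f z -> derivable (f : R[i]^o -> R[i]^o) z 1.
Proof.
case=> l fl; apply/cvg_ex; exists l; apply/cvgrPdist_le => e e0.
have [eE eR] := gt0_complex e0; have [d d0 H] := fl _ eR.
exists d%:C => /=; first by rewrite ltcR.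
move=> h /=; rewrite sub0r normrN => hd h0.
rewrite [_ *: 1]mulr1 [_ *: _]mulrC.
have := H (h + z); rewrite addrK -ltcR -normr_complex => /(_ hd).
rewrite -lecR rmorphM /= -!normr_complex -eE => le.
have -> : l - (f (h + z) - f z) * h^-1 = - (f (h + z) - f z - l * h) * h^-1.
  by rewrite opprB [RHS]mulrBl mulfK.
by rewrite normrM normrN normfV ler_pdivrMr // normr_gt0.
Qed.

Lemma derivable_cexp z : derivable (@cexp R : R[i]^o -> R[i]^o) z 1.
Proof.
apply: cdiff_derivable; exists (cexp z) => e e0.
pose c := normc (cexp z); have c0 : 0 < c by rewrite /c normc_cexp expR_gt0.
exists (Num.min (1 / 2) (e / (8 * c))); first by rewrite lt_min !divr_gt0 // mulr_gt0.
move=> s; rewrite lt_min => /andP[s1 s2].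
have -> : cexp s - cexp z - cexp z * (s - z) = cexp z * (cexp (s - z) - 1 - (s - z)).
  by rewrite !mulrBr mulr1 -cexpD (addrC z) subrK.
rewrite Normc.normcM -/c.
have := normc_cexp_sub1 (ltW s1); rewrite -(ler_pM2l c0) => h; apply: (le_trans h).
rewrite expr2 !mulrA ler_wpM2r ?normc_ge0 //.
by move: s2; rewrite ltr_pdivlMr ?mulr_gt0 // => s2; nra.
Qed.

End Exponential.

(** * Dirichlet series *)

Lemma sum_by_parts (T : comNzRingType) (a b : nat -> T) m n : (m <= n)%N ->
  \sum_(m <= k < n) a k * b k = (\sum_(m <= k < n) a k) * b n +
    \sum_(m <= k < n) (\sum_(m <= j < k.+1) a j) * (b k - b k.+1).
Proof.
move/subnKC <-; elim: (n - m)%N => [|d IH]; first by rewrite addn0 !big_geq // mul0r addr0.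
rewrite addnS !big_nat_recr ?leq_addr //= IH; ring.
Qed.

Section DirichletSeries.
Variable R : realType.
Local Notation normc := (@Normc.normc R).
Implicit Types (s z : R[i]).

(** Partial summation against a complex sequence b whose size and increments are dominated by those
    of a real g; the increments of g telescope. *)
Lemma abel_bound (a b : nat -> R[i]) (g : nat -> R) (P K : R) m n : (m <= n)%N ->
  0 <= P -> 1 <= K ->
  (forall k, (m <= k)%N -> normc (b k) <= g k) ->
  (forall k, (m <= k)%N -> normc (b k - b k.+1) <= K * (g k - g k.+1)) ->
  (forall k, normc (\sum_(m <= j < k) a j) <= P) ->
  normc (\sum_(m <= k < n) a k * b k) <= P * K * g m.
Proof.
move=> mn P0 K1 bg bd aP; rewrite sum_by_parts //; apply: (le_trans (le_normcD _ _)).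
have gE : \sum_(m <= k < n) (g k - g k.+1) = g m - g n.
  rewrite (@telescope_sumr_eq _ _ _ (fun k => - g k)) //; first by ring.
  by move=> k _; ring.
have -> : P * K * g m = P * (K * g n) + P * (K * (g m - g n)) by ring.
rewrite -gE; apply: lerD.
  rewrite Normc.normcM; apply: ler_pM; rewrite ?normc_ge0 //.
  by apply: (le_trans (bg _ mn)); rewrite ler_peMl // (le_trans (normc_ge0 (b n))) // bg.
apply: (le_trans (normc_sum _ _ _)); rewrite !mulr_sumr.
rewrite big_nat_cond [leRHS]big_nat_cond; apply: ler_sum => k /andP[/andP[mk _] _].
by rewrite Normc.normcM; apply: ler_pM; rewrite ?normc_ge0 ?bd.
Qed.

Lemma normc_natpowc n s : normc (natpowc n s) = expR (complex.Re s * ln n%:R).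
Proof.
by rewrite /natpowc normc_cexp; case: s => x y /=; rewrite mulr0 subr0.
Qed.

Let derivable_comp_cexp (f : R[i] -> R[i]) z : derivable (f : R[i]^o -> R[i]^o) z 1 ->
  derivable ((fun s => cexp (f s)) : R[i]^o -> R[i]^o) z 1.
Proof.
move=> /derivable1_diffP fd; apply/derivable1_diffP.
have /derivable1_diffP ed := @derivable_cexp R (f z).
exact: (@differentiable_comp _ R[i]^o R[i]^o R[i]^o f (@cexp R) z fd ed).
Qed.

Lemma derivable_natpowc n z : derivable ((fun s => natpowc n (- s)) : R[i]^o -> R[i]^o) z 1.
Proof.
apply: (derivable_comp_cexp (f := fun s => - s * (ln n%:R)%:C)).
apply/derivable1_diffP; apply: (@differentiableM R[i] R[i]^o (fun s => - s) (fun=> (ln n%:R)%:C)).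
  by apply: differentiableN; apply/derivable1_diffP; exact: derivable_id.
exact: differentiable_cst.
Qed.

Lemma derivable_dirichlet_sum (chi : int -> R[i]) n z :
  derivable ((fun s => \sum_(1 <= k < n) chi k%:Z * natpowc k (- s)) : R[i]^o -> R[i]^o) z 1.
Proof.
elim: n => [|n IH].
  have -> : (fun s => \sum_(1 <= k < 0) chi k%:Z * natpowc k (- s)) = (fun=> 0).
    by apply: funext => s; rewrite big_geq.
  exact: derivable_cst.
case: n IH => [|n] IH.
  have -> : (fun s => \sum_(1 <= k < 1) chi k%:Z * natpowc k (- s)) = (fun=> 0).
    by apply: funext => s; rewrite big_geq.
  exact: derivable_cst.
have -> : (fun s => \sum_(1 <= k < n.+2) chi k%:Z * natpowc k (- s)) =
  (fun s => (\sum_(1 <= k < n.+1) chi k%:Z * natpowc k (- s)) + chi n.+1%:Z * natpowc n.+1 (- s)).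
  by apply: funext => s; rewrite big_nat_recr.
apply/derivable1_diffP; apply: differentiableD; first exact/derivable1_diffP.
apply: (@differentiableM R[i] R[i]^o (fun=> chi n.+1%:Z) (fun s => natpowc n.+1 (- s))).
  exact: differentiable_cst.
apply/derivable1_diffP; exact: derivable_natpowc.
Qed.

Lemma derivable_weight (K : R[i]) z :
  derivable ((fun s => cexp (K * (s * s - 1 / 4))) : R[i]^o -> R[i]^o) z 1.
Proof.
apply: (derivable_comp_cexp (f := fun s => K * (s * s - 1 / 4))).
apply/derivable1_diffP; apply: (@differentiableM R[i] R[i]^o (fun=> K) (fun s => s * s - 1 / 4)).
  exact: differentiable_cst.
apply: differentiableB; last exact: differentiable_cst.
by apply: (@differentiableM R[i] R[i]^o id id); apply/derivable1_diffP; exact: derivable_id.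
Qed.

(** n^(-1/4), a majorant of |n^(-s)| for Re s >= 1/4. *)
Definition quarter_pow (n : nat) : R := expR (- (ln n%:R / 4)).

Lemma ln_natS_bound n : (0 < n)%N -> ln n%:R <= ln n.+1%:R :> R /\ ln n.+1%:R - ln n%:R <= n%:R^-1 :> R.
Proof.
move=> n0; have n0' : 0 < n%:R :> R by rewrite ltr0n.
split; first by rewrite ler_ln ?posrE ?ltr0n // ler_nat.
rewrite -ln_div ?posrE ?ltr0n // -natr1 mulrDl divff ?gt_eqF // mul1r.
by apply: le_ln1Dx; rewrite (lt_trans (ltrN10 R)) // invr_gt0.
Qed.

Lemma ln_nat_ge0 n : (0 < n)%N -> 0 <= ln n%:R :> R.
Proof. by move=> n0; rewrite ln_ge0 // ler1n. Qed.

(** Put t = log(n + 1) - log n <= 1/8. Then |s t| <= 1/2, so |exp(-s t) - 1| <= 5 |s| t <= 20 t,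
    while 1 - exp(-t/4) >= t/8; the ratio is 160. *)
Lemma natpowc_sub n s : (8 <= n)%N -> 1 / 4 <= complex.Re s -> normc s <= 4 ->
  normc (natpowc n (- s) - natpowc n.+1 (- s)) <= 160 * (quarter_pow n - quarter_pow n.+1).
Proof.
move=> n8 sr s4; have n0 : (0 < n)%N by apply: leq_trans n8.
have [le1 le2] := ln_natS_bound n0.
have u0 := ln_nat_ge0 n0.
pose u : R := ln n%:R; pose t : R := ln n.+1%:R - u.
have t0 : 0 <= t by rewrite subr_ge0.
have t8 : t <= 1 / 8.
  apply: (le_trans le2); rewrite mul1r lef_pV2 ?posrE ?ltr0n // (ler_nat _ 8 n) //.
have -> : natpowc n.+1 (- s) = natpowc n (- s) * cexp (- s * t%:C).
  rewrite /natpowc -cexpD -mulrDr -rmorphD /= /t addrC subrK //.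
have -> : natpowc n (- s) - natpowc n (- s) * cexp (- s * t%:C) =
   - (natpowc n (- s) * (cexp (- s * t%:C) - 1)) by ring.
have -> : quarter_pow n.+1 = quarter_pow n * expR (- (t / 4)).
  by rewrite /quarter_pow -expRD /t /u; congr expR; ring.
rewrite normcN Normc.normcM normc_natpowc.
have st : normc (- s * t%:C) = normc s * t by rewrite Normc.normcM normcN normc_real ger0_norm.
have h1 : normc (- s * t%:C) <= 1 / 2.
  rewrite st; have -> : 1 / 2 = 4 * (1 / 8) :> R by field.
  by apply: ler_pM => //; exact: normc_ge0.
have h2 := normc_cexp_sub1_le h1.
have h3 : expR (complex.Re (- s) * ln n%:R) <= quarter_pow n.
  rewrite /quarter_pow ler_expR raddfN /= mulNr lerN2 mulrC.
  by rewrite -[4^-1]mul1r ler_wpM2r.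
have h4 : t / 8 <= 1 - expR (- (t / 4)).
  have e1 := expR_ge1Dx (t / 4).
  have e0 : 0 < 1 + t / 4 by lra.
  rewrite expRN; have : (expR (t / 4))^-1 <= (1 + t / 4)^-1 by rewrite lef_pV2 ?posrE ?expR_gt0.
  have : (1 + t / 4)^-1 <= 1 - t / 8; last by lra.
  rewrite -[leLHS]mul1r ler_pdivrMr //.
  have : t * t <= 1 / 8 * t by rewrite ler_wpM2r.
  nra.
have g0 : 0 < quarter_pow n by exact: expR_gt0.
have -> : 160 * (quarter_pow n - quarter_pow n * expR (- (t / 4))) =
   quarter_pow n * (160 * (1 - expR (- (t / 4)))) by ring.
apply: ler_pM; rewrite ?expR_ge0 ?normc_ge0 //.
apply: (le_trans h2); rewrite st.
have : normc s * t <= 4 * t by rewrite ler_wpM2r.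
lra.
Qed.

End DirichletSeries.

(** * From bounds on the partial sums to a bound on L(1/2) *)

Section Limit.
Variable R : realType.
Local Notation normc := (@Normc.normc R).
Implicit Types (s z : R[i]).

Lemma within_bounded (u : R -> R) a b : a <= b -> {within `[a, b], continuous u} ->
  exists M, forall t, a <= t <= b -> `|u t| <= M.
Proof.
move=> ab cu; have [c _ cM] := EVT_max ab cu; have [d _ dM] := EVT_min ab cu.
exists (`|u c| + `|u d|) => t tab; have tin : t \in `[a, b] by rewrite in_itv.
rewrite ler_norml; have := cM t tin; have := dM t tin.
have := ler_norm (u c); have := ler_norm (- u d); rewrite normrN.
by have := normr_ge0 (u c); have := normr_ge0 (u d); lra.
Qed.

Lemma pcont_bounded (g : R -> R[i]) a b : a <= b -> pcont g a b ->
  exists M, forall t, a <= t <= b -> normc (g t) <= M.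
Proof.
move=> ab [/(within_bounded ab)[M1 h1] /(within_bounded ab)[M2 h2]].
exists (M1 + M2) => t tab; apply: (le_trans (normc_le_ReIm _)); apply: lerD; [exact: h1|exact: h2].
Qed.

Lemma bounded_on_bd (f : R[i] -> R[i]) x y w h : 0 <= w -> 0 <= h ->
  (forall z, ccont f z) -> exists M, forall z, on_bd x y w h z -> normc (f z) <= M.
Proof.
move=> w0 h0 fc.
have xw : x <= x + w by rewrite lerDl.
have yh : y <= y + h by rewrite lerDl.
have [M1 b1] := pcont_bounded xw (pcont_h (f := f) (y := y) (fun t _ => fc _)).
have [M2 b2] := pcont_bounded xw (pcont_h (f := f) (y := y + h) (fun t _ => fc _)).
have [M3 b3] := pcont_bounded yh (pcont_v (f := f) (x := x) (fun t _ => fc _)).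
have [M4 b4] := pcont_bounded yh (pcont_v (f := f) (x := x + w) (fun t _ => fc _)).
exists (Num.max (Num.max M1 M2) (Num.max M3 M4)) => z /andP[/andP[hx hy] hb]; rewrite !le_max.
case: z hx hy hb => a b /= hx hy /or4P[]/eqP e; subst.
- by rewrite b3 ?orbT.
- by rewrite b4 ?orbT.
- by rewrite b1 ?orbT.
- by rewrite b2 ?orbT.
Qed.

Lemma quarter_pow_lim (e : R) : 0 < e -> exists2 n, (8 <= n)%N & quarter_pow R n <= e.
Proof.
move=> e0; pose x : R := expR (- (4 * ln e)).
have [n xn] : exists n : nat, x <= n%:R.
  by exists (Num.Def.archi_bound x); rewrite ltW // archi_boundP // expR_ge0.
exists (n + 8)%N; first by rewrite leq_addl.
rewrite /quarter_pow -[leRHS]lnK ?posrE // ler_expR.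
have : ln x <= ln (n + 8)%:R.
  rewrite ler_ln ?posrE ?expR_gt0 ?ltr0n ?addn_gt0 ?orbT //.
  by apply: (le_trans xn); rewrite ler_nat leq_addr.
rewrite /x expRK; lra.
Qed.

Variables (chi : int -> R[i]) (P : R).
Hypothesis chiP : forall m n, normc (\sum_(m <= k < n) chi k%:Z) <= P.

Definition dsum n s := \sum_(1 <= k < n) chi k%:Z * natpowc k (- s).

Let P0 : 0 <= P.
Proof. by have := chiP 1 1; rewrite big_geq // Normc.normc0. Qed.

Lemma dsum_tail m n s : (8 <= m)%N -> (m <= n)%N -> 1 / 4 <= complex.Re s -> normc s <= 4 ->
  normc (dsum n s - dsum m s) <= P * 160 * quarter_pow R m.
Proof.
move=> m8 mn sr s4; have m1 : (1 <= m)%N by apply: leq_trans m8.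
rewrite /dsum (big_cat_nat (n := m)) //= [X in X - _]addrC addrK.
apply: abel_bound => //; first by rewrite (ler_nat _ 1 160).
  move=> k mk; have k0 : (0 < k)%N by apply: leq_trans mk.
  rewrite normc_natpowc /quarter_pow ler_expR raddfN /= mulNr lerN2 mulrC -[4^-1]mul1r.
  by rewrite ler_wpM2r ?ln_nat_ge0.
by move=> k mk; apply: natpowc_sub => //; exact: leq_trans mk.
Qed.

Variable L : R[i] -> R[i].
Hypothesis HL : is_dirichlet_L chi L.

(** The limit of [dsum_tail]; the hypothesis on L identifies it with the sum of the series only for
    Re s > 1. *)
Lemma L_dsum_tail m s : (8 <= m)%N -> 1 < complex.Re s -> normc s <= 4 ->
  normc (L s - dsum m s) <= P * 160 * quarter_pow R m.
Proof.
move=> m8 s1 s4; apply/ler_addgt0Pr => e e0.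
have eC : 0 < e%:C by rewrite ltcR.
have [_ /(_ s s1)] := HL; move/cvgrPdist_le/(_ _ eC); rewrite /prop_near1 => -[N _ H].
have := H (maxn m N) (leq_maxr _ _); rewrite -/(dsum _ s) normr_complex lecR => h.
have -> : L s - dsum m s = (dsum (maxn m N) s - dsum m s) + (L s - dsum (maxn m N) s) by ring.
apply: (le_trans (le_normcD _ _)); apply: lerD => //; apply: dsum_tail => //; first exact: leq_maxl.
lra.
Qed.

Let half_complex (k : nat) : 1 / k%:R = (1 / k%:R)%:C :> R[i].
Proof. by rewrite fmorph_div rmorph1 rmorph_nat. Qed.

(* The rectangle is [1/4, 2] x [-2, 2].  Where Re s > 1 the weight is at most
   exp (4 K); on the rest of the boundary Re (s^2 - 1/4) <= -3/16. *)
Lemma normc_half_le Y : (forall n, normc (dsum n (1 / 2)) <= Y) -> normc (L (1 / 2)) <= Y.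
Proof.
move=> dY.
have Le : entire L by case: HL.
pose x : R := 1 / 4; pose y : R := - 2; pose w : R := 7 / 4; pose h : R := 4; pose m : R := 1 / 4.
pose z0 : R[i] := 1 / 2.
have z0E : z0 = (1 / 2)%:C by exact: half_complex.
have w0 : 0 <= w by rewrite /w; lra.
have h0 : 0 <= h by rewrite /h; lra.
have m0 : 0 < m by rewrite /m; lra.
have g1 : x + m <= complex.Re z0 by rewrite z0E /x /m /=; lra.
have g2 : complex.Re z0 + m <= x + w by rewrite z0E /x /m /w /=; lra.
have g3 : y + m <= complex.Im z0 by rewrite z0E /y /m /=; lra.
have g4 : complex.Im z0 + m <= y + h by rewrite z0E /y /m /h /=; lra.
have I0 := gt0_box_inv m0 g1 g2 g3 g4.
set I := complex.Im _ in I0.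
have dL n z : derivable ((fun s => L s - dsum n s) : R[i]^o -> R[i]^o) z 1.
  apply/derivable1_diffP; apply: differentiableB; apply/derivable1_diffP; first exact: Le.
  exact: derivable_dirichlet_sum.
have [M0 hM0] : exists M, forall z, on_bd x y w h z -> normc (L z - dsum 8 z) <= M.
  by apply: bounded_on_bd => // z; apply: cdiff_cont; apply: derivable_cdiff.
pose c0 := 4 * (w + h) / m / I.
have c00 : 0 <= c0.
  apply: divr_ge0; last exact: ltW.
  by apply: divr_ge0; [rewrite mulr_ge0 // addr_ge0 | exact: ltW].
have q8 n : 0 < quarter_pow R n by exact: expR_gt0.
pose C := P * 160; have C0 : 0 <= C by rewrite /C mulr_ge0.
(* Bounds L - dsum n for all n >= 8 on the boundary: by continuity for n = 8, then by the tail from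
   8. *)
pose M1 := Num.max M0 0 + C * quarter_pow R 8.
have M10 : 0 <= M1.
  by apply: addr_ge0; [rewrite le_max lexx orbT | apply: mulr_ge0 => //; exact: ltW].
have key (K : nat) n : (8 <= n)%N -> normc (L z0 - dsum n z0) <=
   c0 * (C * quarter_pow R n * expR (4 * K%:R) + M1 * expR (- (3 / 16 * K%:R))).
  move=> n8; set B := (X in c0 * X).
  pose F s := (L s - dsum n s) * cexp (K%:R%:C * (s * s - 1 / 4)).
  have Fd z : derivable (F : R[i]^o -> R[i]^o) z 1.
    apply/derivable1_diffP.
    apply: (@differentiableM R[i] R[i]^o (fun s => L s - dsum n s)
       (fun s => cexp (K%:R%:C * (s * s - 1 / 4)))); apply/derivable1_diffP => //.
    exact: derivable_weight.
  have Fz0 : F z0 = L z0 - dsum n z0.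
    rewrite /F (_ : z0 * z0 - 1 / 4 = 0); first by rewrite mulr0 cexp0 mulr1.
    by rewrite /z0; field.
  have B1 : 0 <= C * quarter_pow R n * expR (4 * K%:R) by apply: mulr_ge0; [apply: mulr_ge0 => //; exact: ltW | exact: expR_ge0].
  have B2 : 0 <= M1 * expR (- (3 / 16 * K%:R)) by rewrite mulr_ge0 ?expR_ge0.
  have bd z : on_bd x y w h z -> normc (F z) <= B.
    move=> hz; have /andP[/andP[/andP[a1 a2] /andP[a3 a4]] a5] := hz.
    have z4 : normc z <= 4.
      apply: (le_trans (normc_le_ReIm _)); move: a1 a2 a3 a4; rewrite /x /y /w /h => *.
      have : `|complex.Re z| <= 2 by rewrite ler_norml; apply/andP; split; lra.
      have : `|complex.Im z| <= 2 by rewrite ler_norml; apply/andP; split; lra.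
      lra.
    have ReE : complex.Re (K%:R%:C * (z * z - 1 / 4)) =
       K%:R * (complex.Re z ^+ 2 - complex.Im z ^+ 2 - 1 / 4).
      by rewrite half_complex; case: (z) => a b; simpc => /=; rewrite !expr2 ?mul0r ?subr0; ring.
    rewrite /F Normc.normcM normc_cexp ReE.
    have K0 : 0 <= K%:R :> R by rewrite ler0n.
    have [s1|s1] := ltP 1 (complex.Re z).
      apply: (@le_trans _ _ (C * quarter_pow R n * expR (4 * K%:R))); last by rewrite /B lerDl.
      apply: ler_pM; rewrite ?normc_ge0 ?expR_ge0 //; first exact: L_dsum_tail.
      rewrite ler_expR mulrC ler_wpM2r //.
      have : complex.Re z ^+ 2 <= 4.
        by move: a2; rewrite /x /w expr2 => a2; nra.
      have := sqr_ge0 (complex.Im z); lra.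
    apply: (@le_trans _ _ (M1 * expR (- (3 / 16 * K%:R)))); last by rewrite /B lerDr.
    apply: ler_pM; rewrite ?normc_ge0 ?expR_ge0 //.
      have -> : L z - dsum n z = (L z - dsum 8 z) - (dsum n z - dsum 8 z) by ring.
      apply: (le_trans (le_normcD _ _)); rewrite normcN; apply: lerD.
        by rewrite le_max hM0.
      by apply: dsum_tail.
    rewrite ler_expR (_ : - (3 / 16 * K%:R) = K%:R * - (3 / 16)) ?ler_wpM2l //; last by ring.
    have Im4 : complex.Im z = - 2 \/ complex.Im z = 2 -> complex.Im z ^+ 2 = 4.
      by case=> ->; ring.
    have R1 : complex.Re z ^+ 2 <= 1 by move: a1; rewrite /x expr2 => a1; nra.
    (* On the left side (1/4)^2 - 1/4 = -3/16. The right side, Re z = 2, is excluded by [s1]. On the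
       horizontal sides (Re z)^2 <= 1 and (Im z)^2 = 4. *)
    case/or4P: a5 => /eqP e.
    - by rewrite e; have := sqr_ge0 (complex.Im z); rewrite /x; lra.
    - by move: e s1; rewrite /x /w; lra.
    - by rewrite Im4; [lra | left; rewrite e].
    - by rewrite Im4; [lra | right; rewrite e /y /h; lra].
  have := cauchy_estimate m0 g1 g2 g3 g4 (fun z _ => Fd z) bd.
  rewrite Fz0 -/I -ler_pdivlMr // => le; apply: (le_trans le).
  by rewrite le_eqVlt; apply/orP; left; apply/eqP; rewrite /c0; field; rewrite !gt_eqF.
apply/ler_addgt0Pr => e e0.
have e2 : 0 < e / (2 * (c0 + 1)) by rewrite divr_gt0 // mulr_gt0 // ltr_wpDl.
(* K comes first, as M1 does not depend on n; n is then taken large enough to beat exp(4 K). *)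
have [K hK] : exists K : nat, M1 * expR (- (3 / 16 * K%:R)) <= e / (2 * (c0 + 1)).
  move: e2; set d := e / _ => d0; pose t := 16 / 3 * (M1 / d).
  have t0 : 0 <= t by apply: mulr_ge0; [lra | apply: divr_ge0 => //; exact: ltW].
  exists (Num.Def.archi_bound t); have := archi_boundP t0.
  set K := (Num.Def.archi_bound t)%:R => /ltW tK.
  have K0 : 0 <= K by rewrite ler0n.
  have e1 := expR_ge1Dx (3 / 16 * K).
  rewrite expRN ler_pdivrMr ?expR_gt0 //.
  apply: (@le_trans _ _ (d * (1 + 3 / 16 * K))); last by rewrite ler_wpM2l // ltW.
  have : d * (3 / 16 * t) <= d * (3 / 16 * K) by rewrite (ler_wpM2l (ltW d0)) // ler_wpM2l.
  have -> : d * (3 / 16 * t) = M1 by rewrite /t; field; rewrite gt_eqF.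
  by move: d0; lra.
have E4 := expR_gt0 (4 * K%:R : R).
have [n n8 hn] := @quarter_pow_lim (e / (2 * (c0 + 1)) / ((C + 1) * expR (4 * K%:R)))
   (divr_gt0 e2 (mulr_gt0 (ltr_wpDl C0 ltr01) E4)).
have -> : L (1 / 2) = dsum n z0 + (L z0 - dsum n z0) by rewrite addrC subrK.
apply: (le_trans (le_normcD _ _)); apply: lerD; first exact: dY.
apply: (le_trans (key K n n8)).
have : C * quarter_pow R n * expR (4 * K%:R) <= e / (2 * (c0 + 1)).
  move: hn; rewrite ler_pdivlMr ?mulr_gt0 ?ltr_wpDl //.
  apply: le_trans; rewrite mulrA ler_wpM2r ?expR_ge0 // mulrC ler_wpM2l ?lerDl //.
  by rewrite ltW.
move=> h1.
apply: (@le_trans _ _ (c0 * (e / (2 * (c0 + 1)) + e / (2 * (c0 + 1))))).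
  by rewrite ler_wpM2l // lerD.
have -> : c0 * (e / (2 * (c0 + 1)) + e / (2 * (c0 + 1))) = c0 / (c0 + 1) * e.
  by field; rewrite gt_eqF // ltr_wpDl.
by apply: ler_piMl; [exact: ltW | rewrite ler_pdivrMr ?ltr_wpDl // mul1r lerDl].
Qed.
End Limit.

(** * The value at 1/2 *)

Section Residues.
Variables (R : realType) (M : nat) (chi : int -> R[i]).
Hypotheses (M_pr : prime M) (chiD : dirichlet_character M chi).

Definition residue_char (a : 'F_M) : R[i] := chi (a : nat)%:Z.

Lemma chi_addM (a : int) (k : nat) : chi (a + k%:Z * M%:Z) = chi a.
Proof.
case: chiD => per _ _; elim: k => [|k IH]; first by rewrite mul0r addr0.
by rewrite -addn1 PoszD mulrDl mul1r addrA per IH.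
Qed.

Lemma chi_modz (a : int) : chi (a %% M%:Z)%Z = chi a.
Proof.
rewrite {2}(divz_eq a M%:Z) addrC; case: (a %/ M%:Z)%Z => k; first by rewrite chi_addM.
by rewrite -[LHS](@chi_addM _ 0) NegzE; rewrite -[RHS](chi_addM _ k.+1) mulNr subrK mul0r addr0.
Qed.

Lemma chi_modn (n : nat) : chi (n %% M)%N%:Z = chi n%:Z.
Proof. by rewrite -modz_nat chi_modz. Qed.

Lemma residue_char_nat (n : nat) : residue_char n%:R = chi n%:Z.
Proof. by rewrite /residue_char val_Fp_nat // chi_modn. Qed.

Lemma residue_charM (a b : 'F_M) : residue_char (a * b) = residue_char a * residue_char b.
Proof.
case: chiD => _ mul _; rewrite -[in LHS](natr_Zp a) -[in LHS](natr_Zp b) -natrM residue_char_nat PoszM mul //.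
Qed.

Lemma residue_char_eq0 (a : 'F_M) : (residue_char a == 0) = (a == 0).
Proof.
case: chiD => _ _ c0; apply/negb_inj; rewrite [LHS]c0 coprimezE /= coprime_sym prime_coprime //.
congr negb; have aM : ((a : nat) < M)%N by rewrite -[X in (_ < X)%N](Fp_cast M_pr) ltn_ord.
rewrite -[RHS](inj_eq val_inj) /=; case: (a : nat) aM => [|k] kM; first by rewrite dvdn0.
by rewrite gtnNdvd.
Qed.

(** Otherwise chi would agree, on the integers prime to M, with the constant 1, which is a character
    modulo 1 < M. *)
Lemma residue_char_nontrivial :
  (~ exists (d : nat) (psi : int -> R[i]),
      [/\ (d %| M)%N, (d < M)%N, dirichlet_character d psi
        & forall a : int, coprimez a M%:Z -> chi a = psi a]) ->
  exists2 r, r != 0 & residue_char r != 1.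
Proof.
move=> prim; have [/existsP[r /andP[r0 r1]]|/existsPn H] :=
  boolP [exists r : 'F_M, (r != 0) && (residue_char r != 1)].
  by exists r.
exfalso; apply: prim; exists 1%N, (fun=> 1); split; rewrite ?dvd1n ?prime_gt1 //.
  split => // [a b|a]; first by rewrite mulr1.
  by rewrite oner_eq0 /coprimez gcdz1.
move=> a aM; have [_ _ c0] := chiD.
have a0 : chi a != 0 by rewrite c0.
have M0 : M%:Z != 0 by rewrite eqz_nat -lt0n prime_gt0.
have := chi_modz a; have := modz_ge0 a M0.
case: (a %% M%:Z)%Z => // n _; rewrite -residue_char_nat => E.
have := H n%:R; rewrite negb_and !negbK -residue_char_eq0 E (negbTE a0) /=.
by move/eqP.
Qed.

Lemma residue_char_odd r : r != 0 -> residue_char r != 1 -> (2 < M)%N.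
Proof.
move=> r0 r1; rewrite ltn_neqAle prime_gt1 // andbT; apply: contraNneq r1 => M2.
have rM : ((r : nat) < M)%N by rewrite -[X in (_ < X)%N](Fp_cast M_pr) ltn_ord.
have rM2 : ((r : nat) < 2)%N by rewrite (leq_trans rM) // -M2.
have -> : r = 1.
  move: r0; rewrite -(natr_Zp r).
  by case: (r : nat) rM2 => [|[|k]] //; rewrite eqxx.
by rewrite (chi1 residue_charM residue_char_eq0).
Qed.

End Residues.

Section HalfSum.
Variables (R : realType) (p : nat) (Y : R).
Hypotheses (p_pr : prime p) (Y0 : 0 <= Y).
Local Notation normc := (@Normc.normc R).

Lemma sum_shift (V : nmodType) (f : nat -> V) (m n : nat) :
  \sum_(m <= k < m + n) f k = \sum_(k < n) f (m + k)%N.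
Proof.
by rewrite -{1}[m]add0n big_addn addKn big_mkord; apply: eq_bigr => k _; rewrite addnC.
Qed.

Definition invsqrt (k : nat) : R := (Num.sqrt k%:R)^-1.

Lemma natpowc_half k : (0 < k)%N -> natpowc k (- (1 / 2)) = (invsqrt k)%:C.
Proof.
move=> k0; have k0' : 0 < k%:R :> R by rewrite ltr0n.
have -> : - (1 / 2) = (- (1 / 2))%:C :> R[i].
  by rewrite rmorphN fmorph_div rmorph1 rmorph_nat.
rewrite /natpowc -rmorphM /cexp /= cos0 sin0 mulr1; congr (_ %:C).
rewrite mulNr expRN; congr _^-1; apply/eqP.
rewrite -(@eqrXn2 _ 2) ?expR_ge0 ?sqrtr_ge0 // sqr_sqrtr ?ler0n //.
by rewrite -expRM_natr mul1r mulrC mulrA divff // mul1r lnK.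
Qed.

Lemma invsqrt_step k : (0 < k)%N -> 0 <= invsqrt k - invsqrt k.+1 /\
  Num.sqrt k%:R * (invsqrt k - invsqrt k.+1) <= k%:R^-1.
Proof.
move=> k0; have s0 : 0 < Num.sqrt k%:R :> R by rewrite sqrtr_gt0 ltr0n.
have s1 : 0 < Num.sqrt k.+1%:R :> R by rewrite sqrtr_gt0 ltr0n.
have le : Num.sqrt k%:R <= Num.sqrt k.+1%:R :> R by rewrite ler_wsqrtr // ler_nat.
split; first by rewrite subr_ge0 lef_pV2.
rewrite /invsqrt mulrBr divff ?gt_eqF //.
set a := Num.sqrt k%:R in s0 le *; set b := Num.sqrt _ in s1 le *.
have a2 : a * a = k%:R by rewrite -expr2 sqr_sqrtr ?ler0n.
have b2 : b * b = a * a + 1 by rewrite a2 natr1 -expr2 sqr_sqrtr ?ler0n.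
have -> : 1 - a / b = (b - a) / b by field; rewrite gt_eqF.
rewrite -a2 ler_pdivrMr // ler_pdivlMl ?mulr_gt0 //.
have : (b - a) * (b + a) = 1 by rewrite mulrDr !mulrBl; lra.
have : 0 <= (b - a) * b by rewrite mulr_ge0 ?subr_ge0 // ltW.
rewrite mulrDr => h1 h2; have h3 : a * (b - a) <= 1 by rewrite mulrC; lra.
by rewrite -mulrA (le_trans _ le) // -[leRHS]mulr1 ler_wpM2l // ltW.
Qed.

Let weighted_sum_small n : (n <= p)%N ->
  \sum_(1 <= k < n.+1) Num.sqrt (minn k p)%:R * (invsqrt k - invsqrt k.+1) <= harm R n.
Proof.
elim: n => [|n IH] np; first by rewrite big_geq // harm_ge0.
rewrite big_nat_recr //= /harm big_ord_recr /=; apply: lerD; first exact: IH (ltnW np).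
by rewrite (minn_idPl np); case: (@invsqrt_step n.+1).
Qed.

Let weighted_sum_large j :
  \sum_(1 <= k < (p + j).+1) Num.sqrt (minn k p)%:R * (invsqrt k - invsqrt k.+1) <=
    harm R p + (1 - Num.sqrt p%:R * invsqrt (p + j).+1).
Proof.
have p0 : 0 < Num.sqrt p%:R :> R by rewrite sqrtr_gt0 ltr0n prime_gt0.
elim: j => [|j IH].
  rewrite addn0; apply: (le_trans (weighted_sum_small (leqnn p))); rewrite lerDl subr_ge0.
  by rewrite /invsqrt ler_pdivrMr ?sqrtr_gt0 ?ltr0n // mul1r ler_wsqrtr // ler_nat.
rewrite addnS big_nat_recr //= (minn_idPr _); last by rewrite -addnS leq_addr.
apply: (le_trans (lerD IH (lexx _))); lra.
Qed.

(** Up to p each term is at most 1/k, whence the harmonic sum. Beyond p the weight sqrt p is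
    constant, and the telescoping differences contribute at most 1. *)
Lemma weighted_sum_le n :
  \sum_(1 <= k < n) Num.sqrt (minn k p)%:R * (invsqrt k - invsqrt k.+1) <= harm R p + 1.
Proof.
case: n => [|n]; first by rewrite big_geq // addr_ge0 ?harm_ge0.
have [np|/ltnW/subnKC <-] := leqP n p.
  by apply: (le_trans (weighted_sum_small np)); apply: (le_trans (harm_le _ np)); rewrite lerDl.
apply: (le_trans (weighted_sum_large _)); rewrite lerD2l gerDl oppr_le0.
by rewrite mulr_ge0 ?invr_ge0 ?sqrtr_ge0.
Qed.

Lemma dsum_half_le (chi : int -> R[i]) :
  (forall n, normc (\sum_(k < n) chi (1 + k)%N%:Z) <= Y * Num.sqrt (minn n p)%:R) ->
  forall n, normc (dsum chi n (1 / 2)) <= Y * (2 + harm R p).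
Proof.
move=> cY n; case: n => [|n].
  by rewrite /dsum big_geq // Normc.normc0 mulr_ge0 // addr_ge0 // harm_ge0.
have -> : dsum chi n.+1 (1 / 2) = \sum_(1 <= k < n.+1) chi k%:Z * (invsqrt k)%:C.
  by apply: eq_big_nat => k /andP[k0 _]; rewrite natpowc_half.
have SE m : normc (\sum_(1 <= k < m.+1) chi k%:Z) <= Y * Num.sqrt (minn m p)%:R.
  by rewrite -add1n sum_shift.
have is0 k : 0 <= invsqrt k by rewrite invr_ge0 sqrtr_ge0.
rewrite sum_by_parts //; apply: (le_trans (le_normcD _ _)).
have -> : Y * (2 + harm R p) = Y + Y * (harm R p + 1) by ring.
apply: lerD.
  rewrite Normc.normcM normc_real ger0_norm //.
  apply: (le_trans (ler_wpM2r (is0 _) (SE n))); rewrite -mulrA -[leRHS]mulr1 ler_wpM2l //.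
  rewrite /invsqrt ler_pdivrMr ?sqrtr_gt0 ?ltr0n // mul1r ler_wsqrtr // ler_nat.
  by rewrite (leq_trans (geq_minl _ _)).
apply: (le_trans (normc_sum _ _ _)).
apply: le_trans (ler_wpM2l Y0 (weighted_sum_le n.+1)); rewrite mulr_sumr.
rewrite big_nat_cond [leRHS]big_nat_cond; apply: ler_sum => k /andP[/andP[k0 _] _].
have [d0 _] := invsqrt_step k0.
rewrite -rmorphB Normc.normcM normc_real ger0_norm // mulrA ler_wpM2r //.
Qed.

End HalfSum.

Section PartialSums.
Variables (R : realType) (p : nat) (chi : int -> R[i]) (Y : R).
Hypotheses (p_pr : prime p) (chiD : dirichlet_character p chi).
Variable r : 'F_p.
Hypotheses (r0 : r != 0) (chir : residue_char chi r != 1) (Y0 : 0 <= Y).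
Hypothesis cY : forall n m, (n <= p)%N -> chisum (@residue_char R p chi) m n <= Y * Num.sqrt n%:R.
Local Notation normc := (@Normc.normc R).

Lemma period_sum m : \sum_(k < p) @residue_char R p chi (m + k)%:R = 0.
Proof.
rewrite -[RHS](sum_chi_eq0 (residue_charM p_pr chiD) r0 chir).
have bij : bijective (fun k : 'I_p => (m + k)%:R : 'F_p).
  apply: inj_card_bij; last by rewrite card_Fp // card_ord.
  move=> i j /eqP; rewrite (eqr_nat_mod (pchar_Fp p_pr)) eqn_modDl !modn_small //.
  by move/eqP/val_inj.
by rewrite [RHS](reindex _ (onW_bij _ bij)).
Qed.

Lemma drop_periods m q n :
  \sum_(k < q * p + n) chi (m + k)%N%:Z = \sum_(k < n) chi (m + q * p + k)%N%:Z.
Proof.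
elim: q m => [|q IH] m; first by rewrite mul0n addn0.
rewrite mulSn -addnA big_split_ord /= -[RHS]add0r.
congr (_ + _).
  by rewrite -[RHS](period_sum m); apply: eq_bigr => k _; rewrite residue_char_nat.
under eq_bigr do rewrite addnA.
by rewrite IH; apply: eq_bigr => k _; rewrite !addnA.
Qed.

(** Complete periods sum to 0, so [cY], which holds up to length p, is applied to n mod p. *)
Lemma partial_sum_le m n : normc (\sum_(k < n) chi (m + k)%N%:Z) <= Y * Num.sqrt (minn n p)%:R.
Proof.
rewrite (divn_eq n p) drop_periods.
under eq_bigr do rewrite -(residue_char_nat p_pr chiD).
have lp : (n %% p <= p)%N by rewrite ltnW // ltn_pmod // prime_gt0.
apply: (le_trans (cY _ lp)); rewrite ler_wpM2l // ler_wsqrtr // ler_nat leq_min lp andbT.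
by rewrite leq_addl.
Qed.

Lemma partial_sum_bounded m n : normc (\sum_(m <= k < n) chi k%:Z) <= Y * Num.sqrt p%:R.
Proof.
have [mn|/ltnW nm] := leqP m n; last by rewrite big_geq // Normc.normc0 mulr_ge0 ?sqrtr_ge0.
rewrite -(subnKC mn) sum_shift; apply: (le_trans (partial_sum_le _ _)).
by rewrite ler_wpM2l // ler_wsqrtr // ler_nat geq_minr.
Qed.

End PartialSums.

(** * Explicit estimates for the final bound *)

Section Numerics.
Variable R : realType.

Lemma harm_le_ln n : (0 < n)%N -> harm R n <= 1 + ln n%:R.
Proof.
case: n => // n _; elim: n => [|n IH]; first by rewrite /harm big_ord1 ln1 invr1 addr0.
rewrite /harm big_ord_recr /=; apply: (le_trans (lerD IH (lexx _))).
rewrite -addrA lerD2l addrC -lerBrDr -opprB lerNr.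
rewrite -ln_div ?posrE ?ltr0n //.
have -> : n.+1%:R / n.+2%:R = 1 + - n.+2%:R^-1 :> R.
  by rewrite -[n.+1%:R](addrK 1) natr1 mulrBl divff ?pnatr_eq0 // mul1r.
by apply: le_ln1Dx; rewrite ltrN2 invf_lt1 ?ltr0n // ltr1n.
Qed.

(** For the largest B with B^4 <= p, p < (B + 1)^4 <= (2 B)^4. *)
Lemma fourth_root_floor p : (0 < p)%N -> exists B, [/\ (0 < B)%N, (B ^ 4 <= p)%N & (p <= 16 * B ^ 4)%N].
Proof.
move=> p0; have ex : exists B, (B ^ 4 <= p)%N by exists 0%N.
have ub B : (B ^ 4 <= p)%N -> (B <= p)%N.
  by apply: leq_trans; case: B => // B; rewrite -[X in (X <= _)%N]expn1 leq_pexp2l.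
have [B Bp Bmax] := ex_maxnP ex ub.
have B0 : (0 < B)%N by apply: Bmax; rewrite exp1n.
exists B; split=> //; have : ~~ (B.+1 ^ 4 <= p)%N by apply/negP => /Bmax; rewrite ltnn.
rewrite -ltnNge => /ltnW h; apply: (leq_trans h).
apply: (@leq_trans ((2 * B) ^ 4)); last by rewrite expnMn.
by rewrite leq_exp2r //; lia.
Qed.

Lemma harm_le_powR (delta : R) p : (0 < p)%N -> 0 < delta ->
  harm R p <= (1 + delta^-1) * expR (delta * ln p%:R).
Proof.
move=> p0 d0; apply: (le_trans (harm_le_ln p0)).
have l0 : 0 <= ln p%:R :> R by rewrite ln_ge0 // ler1n.
have dV : 0 < delta^-1 by rewrite invr_gt0.
apply: (@le_trans _ _ ((1 + delta^-1) * (1 + delta * ln p%:R))); last first.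
  by rewrite ler_wpM2l ?expR_ge1Dx // addr_ge0 // ltW.
have -> : (1 + delta^-1) * (1 + delta * ln p%:R) = 1 + ln p%:R + (delta^-1 + delta * ln p%:R).
  by field; rewrite gt_eqF.
by rewrite lerDl addr_ge0 ?mulr_ge0 // ltW.
Qed.

(** With q = p^(1/16), B <= q^4 and 2^24 = 64^4; the harmonic sum H is at least 1, so H^2 <= H^4. *)
Lemma burgess_constant_le p B (Y : R) : (0 < p)%N -> (B ^ 4 <= p)%N -> 0 <= Y ->
  Y ^+ 4 = 2 ^+ 24 * (B ^ 3)%:R * harm R p ^+ 2 ->
  Y <= 64 * expR (3 / 16 * ln p%:R) * harm R p.
Proof.
move=> p0 Bp Y0 Y4; have H1 := harm_ge1 R p0.
have H0 : 0 <= harm R p by apply: harm_ge0.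
pose q : R := expR (ln p%:R / 16).
have qp k : q ^+ k = expR (k%:R / 16 * ln p%:R).
  by rewrite /q -expRM_natr; congr expR; ring.
have Bq : B%:R <= q ^+ 4.
  rewrite -(@ler_pXn2r _ 4) ?nnegrE ?exprn_ge0 ?expR_ge0 //.
  rewrite -natrX -exprM qp divff // mul1r lnK ?posrE ?ltr0n // ler_nat //.
rewrite -qp -(@ler_pXn2r _ 4) ?nnegrE ?mulr_ge0 ?exprn_ge0 ?expR_ge0 // Y4.
have -> (a b c : R) : (a * b ^+ 3 * c) ^+ 4 = a ^+ 4 * (b ^+ 4) ^+ 3 * c ^+ 4 by ring.
have -> : 64 ^+ 4 = 2 ^+ 24 :> R by rewrite (exprM 2 6 4); congr (_ ^+ 4); ring.
apply: ler_pM.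
- by rewrite mulr_ge0 ?exprn_ge0.
- by rewrite sqr_ge0.
- rewrite ler_wpM2l ?exprn_ge0 // natrX ler_pXn2r ?nnegrE //.
  by rewrite exprn_ge0 ?expR_ge0.
- by rewrite ler_weXn2l.
Qed.

End Numerics.

Theorem theorem2 (R : realType) (eps : R) (eps_gt0 : 0 < eps) :
  exists C : R, 0 < C /\
    forall (M : nat) (chi : int -> R[i]) (L : R[i] -> R[i]),
      prime M ->
      primitive_dirichlet_character M chi ->
      is_dirichlet_L chi L ->
      `|L (1 / 2)| <= (C * M%:R `^ (1 / 4 - 1 / 16 + eps))%:C.
Proof.
(* Two harmonic sums occur, one in the bound for Y and one from partial summation; each is traded
   for a factor p^(eps/2). *)
pose d := eps / 2; have d0 : 0 < d by rewrite divr_gt0.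
pose c := 1 + d^-1; have c0 : 0 < c by rewrite ltr_wpDr // invr_ge0 ltW.
(* 192 = 64 * 3: 64 from [burgess_constant_le], and 3 from 2 + H <= 3 H. *)
exists (192 * c ^+ 2); split; first by rewrite mulr_gt0 // exprn_gt0.
move=> p chi L p_pr [chiD prim] HL.
have p0 := prime_gt0 p_pr.
have [r r0 chir] := residue_char_nontrivial p_pr chiD prim.
have p2 := residue_char_odd p_pr chiD r0 chir.
have [B [B0 Bp pB]] := fourth_root_floor p0.
have H0 : 0 <= harm R p by exact: harm_ge0.
have H1 : 1 <= harm R p by exact: harm_ge1.
pose Y := Num.sqrt (Num.sqrt (2 ^+ 24 * (B ^ 3)%:R * harm R p ^+ 2)).
have Y0 : 0 <= Y by exact: sqrtr_ge0.
have Y4 : Y ^+ 4 = 2 ^+ 24 * (B ^ 3)%:R * harm R p ^+ 2.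
  by rewrite (exprM Y 2 2) !sqr_sqrtr ?sqrtr_ge0 // mulr_ge0 ?sqr_ge0 // mulr_ge0 // exprn_ge0.
have cY := burgess p_pr (card_Fp p_pr) p2 (residue_charM p_pr chiD) (residue_char_eq0 p_pr chiD)
  r0 chir B0 Bp pB Y0 Y4.
have le : Normc.normc (L (1 / 2)) <= Y * (2 + harm R p).
  (* P governs only the convergence to L(1/2) and leaves no trace in the bound. *)
  apply: (normc_half_le (P := Y * Num.sqrt p%:R) (chi := chi)) => //.
    by move=> m n; apply: (partial_sum_bounded p_pr chiD r0 chir).
  by apply: dsum_half_le => // n; apply: (partial_sum_le p_pr chiD r0 chir).
rewrite normr_complex lecR; apply: (le_trans le).
have YH := burgess_constant_le p0 Bp Y0 Y4.
have Hd := harm_le_powR p0 d0.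
set E := expR (3 / 16 * ln p%:R) in YH.
have E0 : 0 <= E by exact: expR_ge0.
set X := expR (d * ln p%:R) in Hd.
have -> : p%:R `^ (1 / 4 - 1 / 16 + eps) = E * X ^+ 2 :> R.
  rewrite /powR pnatr_eq0 gtn_eqF // /E /X -expRM_natr -expRD; congr expR.
  by rewrite /d; field.
apply: (@le_trans _ _ (64 * E * harm R p * (3 * harm R p))).
  by apply: ler_pM => //; [rewrite addr_ge0 | lra].
have -> : 64 * E * harm R p * (3 * harm R p) = 192 * E * harm R p ^+ 2 by ring.
have -> : 192 * c ^+ 2 * (E * X ^+ 2) = 192 * E * (c * X) ^+ 2 by ring.
by rewrite ler_wpM2l ?mulr_ge0 // ler_pXn2r ?nnegrE // mulr_ge0 ?expR_ge0 // ltW.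
Qed.
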